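(* There exist a unital C*-algebra $\mathcal A$ and a kernel $J$ in $\mathcal A$ such that the norm $\|\cdot\|_{osy}$ induced on $\mathcal A/J$ by the quotient operator system structure is not complete. Moreover, for such $\mathcal A$ and $J$, if $q:\mathcal A\to C_u^*(\mathcal A)/\langle J\rangle$ denotes the quotient map (the restriction to $\mathcal A\subseteq C_u^*(\mathcal A)$ of the canonical quotient map), then the range $q(\mathcal A)$ is not closed.
   Context: Operator system: a selfadjoint subspace of some $\mathcal B(H)$ containing the identity (equivalently, an abstract Choi–Effros operator system); its operator space norms are those induced by any unital complete order embedding in $\mathcal B(H)$. A kernel in an operator system $\mathcal S$ is a subspace $J=\ker\phi$ for some unital completely positive map $\phi$ from $\mathcal S$ into a (nonzero) operator system. The quotient operator system $\mathcal S/J$ has cones $C_n(\mathcal S/J)=\{(x_{ij}+J):\forall\epsilon>0\ \exists k_{ij}\in J,\ \epsilon 1\otimes I_n+(x_{ij}+k_{ij})\in M_n(\mathcal S)^+\}$ and Archimedean matrix order unit $1+J$; $\|\cdot\|_{osy}$ is the norm on $\mathcal S/J$ coming from this operator system structure (as opposed to the usual quotient norm). $C_u^*(\mathcal S)$ is the universal (maximal) C*-algebra of $\mathcal S$: the C*-algebra generated by $\mathcal S$ (completely order isomorphically and unitally embedded) such that every unital completely positive map from $\mathcal S$ into a C*-algebra extends to a $*$-homomorphism on $C_u^*(\mathcal S)$. Here it is applied to $\mathcal A$ viewed as an operator system. $\langle J\rangle$ is the closed two-sided ideal of $C_u^*(\mathcal S)$ generated by $J$. *)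

(* Defs.v *)
From HB Require Import structures.
From mathcomp Require Import all_boot all_order all_algebra sesquilinear.
From mathcomp Require Import complex.
From mathcomp Require Import all_classical all_reals.
From mathcomp Require Import topology normedtype.

Set Implicit Arguments.
Unset Strict Implicit.
Unset Printing Implicit Defensive.

Import Order.TTheory GRing.Theory Num.Theory.
Import numFieldNormedType.Exports.

Local Open Scope classical_set_scope.
Local Open Scope ring_scope.
Local Open Scope complex_scope.
Local Open Scope quotient_scope.

(* Completeness and closedness are relative to an explicit real-valued norm,
   because a quotient carries several of them and because the library
   hierarchy has no join of algebras and normed modules. *)

Section Norms.
Context {R : realType} {V : zmodType} (N : V -> R).

Definition norm_cvg (u : nat -> V) (l : V) : Prop :=
  (fun n => N (u n - l)) @ \oo --> (0 : R).

Definition norm_cauchy (u : nat -> V) : Prop :=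
  forall e : R, 0 < e -> exists M : nat,
    forall m n : nat, (M <= m)%N -> (M <= n)%N -> N (u m - u n) < e.

Definition norm_complete : Prop :=
  forall u, norm_cauchy u -> exists l, norm_cvg u l.

Definition norm_closed (D : set V) : Prop :=
  forall u l, (forall n, D (u n)) -> norm_cvg u l -> D l.

End Norms.

(* An algType is nonzero, so the zero C*-algebra is excluded. *)
HB.mixin Record Algebra_isCStar (R : realType) A of GRing.Algebra R[i] A := {
  star : A -> A ;
  cnorm : A -> R ;
  starK : involutive star ;
  starD : {morph star : x y / x + y} ;
  starZ : forall (a : R[i]) x, star (a *: x) = a^* *: star x ;
  starM : forall x y, star (x * y) = star y * star x ;
  cnorm_eq0 : forall x, cnorm x = 0 -> x = 0 ;
  cnormD : forall x y, cnorm (x + y) <= cnorm x + cnorm y ;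
  cnormZ : forall (a : R[i]) x, cnorm (a *: x) = complex.Re `|a| * cnorm x ;
  cnormM : forall x y, cnorm (x * y) <= cnorm x * cnorm y ;
  cnorm_star : forall x, cnorm (star x * x) = cnorm x ^+ 2 ;
  cnorm_complete : norm_complete cnorm
}.

#[short(type="cstarType")]
HB.structure Definition CStar (R : realType) :=
  { A of GRing.Algebra R[i] A & Algebra_isCStar R A }.

(* Bare data: the axioms are imposed by [operator_system], through a concrete
   representation on a Hilbert space. *)
Record mospace (R : realType) := MOSpace {
  mos_sort :> lmodType R[i] ;
  mos_star : mos_sort -> mos_sort ;
  mos_unit : mos_sort ;
  mos_pos : forall n : nat, set 'M[mos_sort]_n
}.

(* The positive elements of the C*-algebra M_n(A) are the Y^* Y, where
   (Y^* )_ij = (Y_ji)^*. *)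
Definition cstar_mos (R : realType) (A : cstarType R) : mospace R :=
  @MOSpace R A star 1
    (fun n => [set X | exists Y : 'M[A]_n, X = (map_mx star Y)^T *m Y]).

Section Maps.
Context {R : realType} (S T : mospace R) (f : {linear S -> T}).

Definition ucp : Prop :=
  f (mos_unit S) = mos_unit T /\
  forall n (X : 'M[S]_n), mos_pos X -> mos_pos (map_mx f X).

Definition unital_complete_order_embedding : Prop :=
  [/\ injective f,
      forall x, f (mos_star x) = mos_star (f x),
      f (mos_unit S) = mos_unit T
    & forall n (X : 'M[S]_n), mos_pos X <-> mos_pos (map_mx f X)].

End Maps.

Record hilbert (R : realType) := Hilbert {
  hilbert_sort :> completeNormedModType R[i] ;
  inner : {dot hilbert_sort for Num.conj} ;
  inner_norm : forall x : hilbert_sort, `|x| ^+ 2 = inner x x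
}.

Section Operators.
Context {R : realType}.

(* Positivity of the operator [T i j] on the n-fold direct sum of H. *)
Definition opmx_pos (H : hilbert R) n (T : 'I_n -> 'I_n -> H -> H) : Prop :=
  forall h : 'I_n -> H, 0 <= \sum_i \sum_j inner H (T i j (h j)) (h i).

Definition opnorm (H : hilbert R) (T : H -> H) : R :=
  sup [set complex.Re `|T h| | h in [set h : H | `|h| <= 1]].

(* Phi is a unital complete order embedding of S in B(H): it identifies S, with
   its involution, unit and cones, with a selfadjoint subspace of B(H) containing
   the identity. *)
Definition BH_embedding (S : mospace R) (H : hilbert R)
    (Phi : S -> {linear H -> H}) : Prop :=
  [/\ forall x, continuous (Phi x),
      forall (a : R[i]) x y h, Phi (a *: x + y) h = a *: Phi x h + Phi y h,
      forall x, (forall h, Phi x h = 0) -> x = 0,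
      (forall x h k, inner H (Phi (mos_star x) h) k = inner H h (Phi x k)) /\
      (forall h, Phi (mos_unit S) h = h)
    & forall n (X : 'M[S]_n), mos_pos X <-> opmx_pos (fun i j => Phi (X i j))].

Definition operator_system (S : mospace R) : Prop :=
  exists (H : hilbert R) (Phi : S -> {linear H -> H}), BH_embedding Phi.

(* N is the norm of the operator system S, i.e. the one induced by its unital
   complete order embeddings in the algebras B(H). *)
Definition is_operator_norm (S : mospace R) (N : S -> R) : Prop :=
  operator_system S /\
  forall (H : hilbert R) (Phi : S -> {linear H -> H}),
    BH_embedding Phi -> forall x, N x = opnorm (Phi x).

Definition is_kernel (S : mospace R) (J : submodClosed S) : Prop :=
  exists (T : mospace R) (f : {linear S -> T}),
    [/\ operator_system T, (exists t : T, t != 0), ucp f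
      & forall x, x \in J <-> f x = 0].

End Operators.

Section QuotientModule.
Context {K : nzRingType} {V : lmodType K} (J : submodClosed V).

(* SubmodClosed does not inherit from ZmodClosed, on which the library quotient
   is based. *)
Definition submod_pred : {pred V} := fun x => x \in J.
Fact submod_pred_zmod : zmod_closed submod_pred.
Proof.
split=> [|x y Jx Jy]; first exact: (rpred0 J).
by have : x - y \in J by rewrite -scaleN1r rpredD ?rpredZ.
Qed.
HB.instance Definition _ := GRing.isZmodClosed.Build V submod_pred submod_pred_zmod.

Definition mquot : Type := {ideal_quot submod_pred}.
HB.instance Definition _ := GRing.Zmodule.on mquot.

Definition mproj (x : V) : mquot := \pi_({ideal_quot submod_pred}) x.

Definition mrepr (y : mquot) : V := repr (y : {ideal_quot submod_pred}).

Lemma mproj_surj (y : mquot) : mproj (mrepr y) = y.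
Proof. exact: reprK. Qed.

Lemma mproj_eq x y : (mproj x = mproj y) <-> (x - y \in J).
Proof.
rewrite -[x - y \in J]/(x - y \in submod_pred) Quotient.idealrBE.
by split=> [/eqP|/eqP].
Qed.

Fact mproj_zmod : zmod_morphism mproj.
Proof. by move=> x y; rewrite /mproj raddfB. Qed.
HB.instance Definition _ := GRing.isZmodMorphism.Build V mquot mproj mproj_zmod.

Definition mscale (a : K) (y : mquot) : mquot := mproj (a *: mrepr y).

Fact mproj_scale a x : mproj (a *: x) = mscale a (mproj x).
Proof.
by apply/mproj_eq; rewrite -scalerBr rpredZ //; apply/mproj_eq; rewrite mproj_surj.
Qed.

Fact mscaleA a b v : mscale a (mscale b v) = mscale (a * b) v.
Proof. by rewrite -[v]mproj_surj -!mproj_scale scalerA. Qed.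
Fact mscale1 : left_id 1 mscale.
Proof. by move=> v; rewrite -[v]mproj_surj -!mproj_scale scale1r. Qed.
Fact mscaleDr : right_distributive mscale +%R.
Proof.
move=> a u v; rewrite -[u]mproj_surj -[v]mproj_surj -raddfD -!mproj_scale.
by rewrite scalerDr raddfD.
Qed.
Fact mscaleDl v : {morph mscale^~ v : a b / a + b}.
Proof.
by move=> a b; rewrite -[v]mproj_surj -!mproj_scale scalerDl raddfD.
Qed.
HB.instance Definition _ :=
  GRing.Zmodule_isLmodule.Build K mquot mscaleA mscale1 mscaleDr mscaleDl.
HB.instance Definition _ := GRing.isScalable.Build K V mquot *:%R mproj mproj_scale.

End QuotientModule.

(* [mos_star] of a class does not depend on the representative when J is
   selfadjoint, which every kernel is. *)
Definition quot_mos (R : realType) (S : mospace R) (J : submodClosed S) : mospace R :=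
  @MOSpace R (mquot J)
    (fun y => mproj J (mos_star (mrepr y)))
    (mproj J (mos_unit S))
    (fun n => [set X | exists x : 'M[S]_n, X = map_mx (mproj J) x /\
       forall e : R, 0 < e -> exists k : 'M[S]_n, (forall i j, k i j \in J) /\
         mos_pos (\matrix_(i, j) ((e%:C *: mos_unit S) *+ (i == j)) + (x + k))]).

Definition quot_norm (R : realType) (A : cstarType R) (J : submodClosed A)
    (y : mquot J) : R :=
  inf [set cnorm x | x in [set x : A | mproj J x = y]].

Section Ideals.
Context {R : realType} {A : cstarType R}.

Definition closed_ideal (I : set A) : Prop :=
  [/\ norm_closed (@cnorm R A) I, I 0,
      forall x y, I x -> I y -> I (x + y),
      forall a x, I x -> I (a * x)
    & forall a x, I x -> I (x * a)].

Definition ideal_gen (E : set A) : {pred A} :=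
  fun x => `[< forall I, closed_ideal I -> E `<=` I -> I x >].

Fact ideal_gen_submod (E : set A) : submod_closed (ideal_gen E).
Proof.
split=> [|a x y /asboolP Ix /asboolP Iy]; apply/asboolP => I clI EI.
  by case: (clI).
have [_ _ ID IMl _] := clI; apply: ID; last exact: Iy.
by rewrite -[x]mul1r scalerAl; apply: IMl; exact: Ix.
Qed.
HB.instance Definition _ (E : set A) :=
  GRing.isSubmodClosed.Build R[i] A (ideal_gen E)
    (GRing.submod_closed_semi (ideal_gen_submod E)).

End Ideals.

Section Universal.
Context {R : realType}.

Definition is_star_hom (A B : cstarType R) (f : {lrmorphism A -> B}) : Prop :=
  forall x, f (star x) = star (f x).

Definition cstar_generated (U : cstarType R) (E : set U) : Prop :=
  forall D : set U, norm_closed (@cnorm R U) D -> E `<=` D -> D 1 ->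
    (forall x y, D x -> D y -> D (x + y)) ->
    (forall (a : R[i]) x, D x -> D (a *: x)) ->
    (forall x y, D x -> D y -> D (x * y)) ->
    (forall x, D x -> D (star x)) -> D = setT.

Definition universal_cstar (S : mospace R) (U : cstarType R)
    (iota : {linear S -> cstar_mos U}) : Prop :=
  [/\ unital_complete_order_embedding iota,
      cstar_generated (range iota : set U)
    & forall (B : cstarType R) (f : {linear S -> cstar_mos B}), ucp f ->
        exists pi : {lrmorphism U -> B}, is_star_hom pi /\
          forall x, pi (iota x : U) = f x].

End Universal.

(* Main.v *)
(* Incompleteness. On B(l2), with x_p the p-th diagonal coefficient of x and
   e_n = (n+2)^-2, let f(x)_(2n+i) = e_n x_(4n+2i) + (1 - e_n) x_(2n+1) for i = 0, 1,
   and J = ker f. A positive f(x) lifts, up to an arbitrarily small multiple of the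
   unit, to a positive diagonal operator, so B(l2)/J is completely order isomorphic
   to the range of f, seen as diagonal operators. This range consists of the bounded
   sequences (t_m) with t_2n - t_(2n+1) = O(e_n), and it is not closed in norm.

   Range of q. Let Phi embed A/J in B(H). By universality A -> A/J -> B(H) extends to
   a *-homomorphism of U which kills <J>, so |a + J|_osy <= |q a|. Conversely, if
   |a + J|_osy <= s then iota sends a lift of [[s, a], [a*, s]] (with s enlarged) to
   some Z* Z, whose diagonal is scalar modulo <J>; truncating the columns of Z by
   elements of 1 + <J> gives |q a| <= 4 s. As U/<J> is complete, a closed range of q
   would make the equivalent norm |.|_osy complete.

   Positivity in an abstract C*-algebra is treated without spectra: square roots come
   from the iteration y := (t + y^2) / 2, and a selfadjoint x is positive when
   |t - x| <= t for some t > 0, which holds exactly when x is a selfadjoint square;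
   that z* z is positive follows from these two facts. *)

Require Import Defs.
From HB Require Import structures.
From mathcomp Require Import all_boot all_order all_algebra sesquilinear.
From mathcomp Require Import complex.
From mathcomp Require Import all_classical all_reals.
From mathcomp Require Import topology normedtype sequences.
From mathcomp Require Import ring lra.
From Stdlib Require Ncring Ncring_tac.

Set Implicit Arguments.
Unset Strict Implicit.
Unset Printing Implicit Defensive.

Import Order.TTheory GRing.Theory Num.Theory.
Import numFieldNormedType.Exports.

Local Open Scope classical_set_scope.
Local Open Scope ring_scope.

(** The tension behind the example: the cones of a quotient ask, for each tolerance, for some
    positive lift, without a bound on its norm. The lift found in [lift_psd] grows like the inverse
    of the tolerance, so [|.|_osy] can lie far below the quotient norm, which is complete. Sharing a
    coefficient forces the two values of a pair to differ by [O(eps n)] on a bounded operator. Since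
    [1 / (n + 2)], the square root of [eps n], tends to 0 more slowly, the sequence with these
    differences is a limit of values without being one.

    On the abstract side the obstacle is that the cones live in [M_n(A)]. Instead of giving matrices
    a C*-norm, positivity is tested with the [A]-valued form of the module [A^n], and the square
    root iteration is proved for an abstract size relation, then used both for elements and for
    matrices. An equivalence of norms suffices at the end, so constants are not optimised. *)

#[local] Instance ncring_ops (V : pzRingType) :
  @Ncring.Ring_ops V 0 1 +%R *%R (fun x y => x - y) -%R eq := {}.

#[local] Instance ncring (V : pzRingType) :
  @Ncring.Ring V 0 1 +%R *%R (fun x y => x - y) -%R eq _.
Proof.
split; try exact: RelationClasses.eq_equivalence; try by move=> ? ? -> ? ? ->.
- by move=> ? ? ->.
- exact: add0r.
- exact: addrC.
- exact: addrA.
- exact: mul1r.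
- exact: mulr1.
- exact: mulrA.
- by move=> x y z; exact: mulrDl.
- by move=> x y z; exact: mulrDr.
- by [].
- exact: addrN.
Qed.

Ltac ncring := Ncring_tac.non_commutative_ring.

(** * Square roots by iteration, for an abstract size relation *)

Section SquareRootIteration.
Variables (R : realType) (V : pzRingType) (bd : V -> R -> Prop) (h : V).

(** [bd x a] reads: the size of [x] is at most [a]. A relation replaces a norm so that the iteration
    serves both a C*-algebra, with [cnorm x <= a], and the matrices over it, with the operator bound
    [mbd]. *)
Definition bd_cvg (u : nat -> V) (l : V) : Prop :=
  forall e : R, 0 < e -> exists N, forall n, (N <= n)%N -> bd (u n - l) e.

Hypothesis bd_le : forall x a b, bd x a -> a <= b -> bd x b.
Hypothesis bd0 : bd 0 0.
Hypothesis bdN : forall x a, bd x a -> bd (- x) a.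
Hypothesis bdD : forall x y a b, bd x a -> bd y b -> bd (x + y) (a + b).
Hypothesis bdM : forall x y a b, bd x a -> bd y b -> bd (x * y) (a * b).
Hypothesis bd_eq0 : forall x, (forall e, 0 < e -> bd x e) -> x = 0.
Hypothesis bd_complete : forall (u : nat -> V) (c : nat -> R) M,
  (forall n, bd (u n.+1 - u n) (c n.+1 - c n)) ->
  (forall n, c n <= c n.+1) -> (forall n, c n <= M) -> exists l, bd_cvg u l.
Hypothesis hh : h + h = 1.
Hypothesis bd_half : forall x a, bd x a -> bd (h * x) (a / 2).

Variable T : V.
Hypothesis bdT : bd T 1.

Let step (y : V) : V := h * (T + y * y).
Let u n := iter n step 0.
(** The same iteration run on the bound 1 of [T]. It increases within [[0, 1]] and majorizes [u]
    together with its increments, so the convergence of [u] reduces to that of a bounded monotone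
    real sequence. *)
Let c n : R := iter n (fun t => (1 + t ^+ 2) / 2) 0.

Let c_bnd n : 0 <= c n <= 1.
Proof. elim: n => [|n IHn]; rewrite /c /= -?/(c n) ?lexx ?ler01 //; nra. Qed.

Let c_incr n : c n <= c n.+1.
Proof. rewrite {2}/c /= -/(c n); have := c_bnd n; nra. Qed.

Let bdu n : bd (u n) (c n).
Proof.
elim: n => [|n IHn]; first exact: bd0.
rewrite /u /c /= -/(u n) -/(c n); apply/bd_half/bdD => //.
by rewrite expr2; exact: bdM.
Qed.

Let bdu1 n : bd (u n) 1.
Proof. by apply: bd_le (bdu n) _; have /andP[] := c_bnd n. Qed.

Let bd_incr n : bd (u n.+1 - u n) (c n.+1 - c n).
Proof.
elim: n => [|n IHn].
  by rewrite subr0 subr0; exact: bdu.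
rewrite [u n.+2]/(step (u n.+1)) [X in step _ - X]/(step (u n)).
(* A difference of squares, split without commutativity; the increments of [c] split in the same
   way, so the bounds match exactly. *)
have -> : step (u n.+1) - step (u n)
    = h * (u n.+1 * (u n.+1 - u n) + (u n.+1 - u n) * u n).
  by rewrite /step; ncring.
have -> : c n.+2 - c n.+1
    = (c n.+1 * (c n.+1 - c n) + (c n.+1 - c n) * c n) / 2.
  have : c n.+2 = (1 + c n.+1 ^+ 2) / 2 by [].
  have : c n.+1 = (1 + c n ^+ 2) / 2 by [].
  by move: (c n.+2) (c n.+1) (c n) => x y z; lra.
by apply/bd_half/bdD; apply: bdM.
Qed.

(* [1 - Y] is a square root of [1 - T]; the last clause transfers to [Y] every
   closed property which the iteration [y := (T + y ^ 2) / 2] preserves. *)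
Lemma visser_sqrt : exists Y : V, [/\ Y + Y = T + Y * Y,
    (1 - Y) * (1 - Y) = 1 - T
  & forall P : V -> Prop, P 0 -> (forall y, P y -> P (h * (T + y * y))) ->
      (forall v l, (forall n, P (v n)) -> bd_cvg v l -> P l) -> P Y].
Proof.
have [n|Y uY] := bd_complete bd_incr c_incr (M := 1).
  by have /andP[] := c_bnd n.
(* A crude bound: it only has to absorb the factor [Y] in the residual below, where the errors add
   up to [e/4 + (e/4 + 2 e/4) / 2 <= e]. *)
have bdY : bd Y 2.
  have [N /(_ N (leqnn N)) uNY] := uY 1 ltr01.
  have -> : Y = u N + - (u N - Y) by ncring.
  by apply: bd_le (bdD (bdu1 N) (bdN uNY)) _; rewrite -[2]/(1 + 1).
have YE : Y = h * (T + Y * Y).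
  apply/eqP; rewrite -subr_eq0; apply/eqP/bd_eq0 => e e0.
  have [N uNY] := uY (e / 4) ltac:(lra).
  have -> : Y - h * (T + Y * Y) = - (u N.+1 - Y)
      + h * (u N * (u N - Y) + (u N - Y) * Y).
    by rewrite [u N.+1]/(step (u N)) /step; ncring.
  apply: bd_le (bdD (bdN (uNY N.+1 (leqnSn N)))
    (bd_half (bdD (bdM (bdu1 N) (uNY N (leqnn N)))
                  (bdM (uNY N (leqnn N)) bdY)))) _.
  lra.
have YY : Y + Y = T + Y * Y.
  by rewrite {1 2}YE -mulrDl hh mul1r.
exists Y; split=> //.
  have -> : (1 - Y) * (1 - Y) = 1 - (Y + Y) + Y * Y by ncring.
  by rewrite YY; ncring.
move=> P P0 PS Pcl; apply: (Pcl u Y) => //.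
by elim=> [|n IHn]; [exact: P0 | exact: PS].
Qed.

End SquareRootIteration.

(** * Square roots in a C*-algebra *)

Lemma nondecreasing_bounded_cauchy (R : realType) (c : nat -> R) (M : R) :
  (forall n, c n <= c n.+1) -> (forall n, c n <= M) ->
  forall e, 0 < e -> exists N, forall m n, (N <= m)%N -> (N <= n)%N ->
    c n - c m < e.
Proof.
move=> c_incr c_le e e0.
have c_homo : nondecreasing_seq c by apply/nondecreasing_seqP.
have c_cvg : cvgn c.
  by apply: nondecreasing_is_cvgn => //; exists M => _ [n _ <-].
have /cvgrPdist_lt/(_ (e / 2)) := c_cvg.
case=> [|N _ cN]; first by rewrite divr_gt0.
exists N => m n Nm Nn; have /= := cN m Nm; have /= := cN n Nn.
rewrite !ltr_norml => /andP[? ?] /andP[? ?]; lra.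
Qed.

Section NormConvergence.
Variables (R : realType) (V : zmodType) (N : V -> R).
Hypothesis N_ge0 : forall x, 0 <= N x.

Lemma norm_cvgP u l : norm_cvg N u l <->
  forall e, 0 < e -> exists M, forall n, (M <= n)%N -> N (u n - l) < e.
Proof.
split=> [/cvgrPdist_lt ul e e0|ul].
  have [M _ ulM] := ul e e0; exists M => n /ulM.
  by rewrite sub0r normrN ger0_norm.
apply/cvgrPdist_lt => e e0; have [M ulM] := ul e e0.
by exists M => // n /ulM; rewrite /= sub0r normrN ger0_norm.
Qed.

End NormConvergence.

Lemma conjC_real_complex (R : rcfType) (t : R) : (t%:C%C)^* = t%:C%C.
Proof. by apply: conj_Creal; apply/complex_realP; exists t. Qed.

Section CStarTheory.
Context {R : realType} {A : cstarType R}.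
Implicit Types (x y z : A) (t : R).
Local Notation N := (@cnorm R A).

Lemma Re_normC_real t : complex.Re `|t%:C%C| = `|t|.
Proof. by rewrite normc_def /= expr0n addr0 sqrtr_sqr. Qed.

Lemma cnorm0 : N 0 = 0.
Proof. by rewrite -(scale0r (0 : A)) cnormZ normr0 mul0r. Qed.

Lemma cnormN x : N (- x) = N x.
Proof. by rewrite -scaleN1r cnormZ normrN normr1 mul1r. Qed.

Lemma cnormB x y : N (x - y) <= N x + N y.
Proof. by rewrite -(cnormN y) cnormD. Qed.

Lemma cnormBC x y : N (x - y) = N (y - x).
Proof. by rewrite -cnormN opprB. Qed.

Lemma cnorm_ge0 x : 0 <= N x.
Proof. by have := cnormB x x; rewrite subrr cnorm0; lra. Qed.

Lemma cnorm_gt0 x : x != 0 -> 0 < N x.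
Proof.
move=> x0; rewrite lt_def cnorm_ge0 andbT.
by apply: contraNneq x0 => /cnorm_eq0 ->.
Qed.

Lemma cnorm_small x : (forall e, 0 < e -> N x <= e) -> x = 0.
Proof.
move=> xe; apply: cnorm_eq0; apply/eqP; rewrite eq_le cnorm_ge0 andbT.
by apply/ler_addgt0Pl => e e0; rewrite addr0 xe.
Qed.

Lemma star0 : star (0 : A) = 0.
Proof. by apply: (addrI (star 0)); rewrite -starD !addr0. Qed.

Lemma starN x : star (- x) = - star x.
Proof. by apply/eqP; rewrite -addr_eq0 -starD addNr star0. Qed.

Lemma starB x y : star (x - y) = star x - star y.
Proof. by rewrite starD starN. Qed.

Lemma star1 : star (1 : A) = 1.
Proof. by have := starM (star (1 : A)) 1; rewrite starK mulr1 starK. Qed.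

Lemma cnorm_starE x : N (star x) = N x.
Proof.
have le y : N y <= N (star y).
  have [->|/cnorm_gt0 y0] := eqVneq y 0; first by rewrite star0.
  by rewrite -(ler_pM2r y0) -expr2 -cnorm_star cnormM.
by apply/eqP; rewrite eq_le le andbT -{2}(starK x) le.
Qed.

Lemma cnorm_sqr_sa x : star x = x -> N (x * x) = N x ^+ 2.
Proof. by move=> xs; rewrite -{1}xs cnorm_star. Qed.

Lemma cnorm1 : N 1 = 1.
Proof.
have := cnorm_sqr_sa star1; rewrite mulr1 expr2 => /esym.
have n1 : N 1 != 0 by rewrite gt_eqF// cnorm_gt0// oner_neq0.
by rewrite -{3}(mulr1 (N 1)) => /(mulfI n1).
Qed.

(** Real scalars as central elements of the algebra: identities mixing scalars and products then
    become ring identities, within reach of [ncring] once [rscC] has moved the scalars. *)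
Definition rsc t : A := (t%:C%C)%:A.

Lemma rscE t x : rsc t * x = t%:C%C *: x.
Proof. by rewrite /rsc -scalerAl mul1r. Qed.
Lemma rscC t x : rsc t * x = x * rsc t.
Proof. by rewrite rscE /rsc -scalerAr mulr1. Qed.
Lemma rsc1 : rsc 1 = 1.
Proof. by rewrite /rsc scale1r. Qed.
Lemma rscD s t : rsc (s + t) = rsc s + rsc t.
Proof. by rewrite /rsc rmorphD scalerDl. Qed.
Lemma rscM s t : rsc (s * t) = rsc s * rsc t.
Proof. by rewrite rscE /rsc rmorphM scalerA. Qed.
Lemma star_rsc t : star (rsc t) = rsc t.
Proof. by rewrite /rsc starZ star1 conjC_real_complex. Qed.
Lemma cnorm_rscM t x : N (rsc t * x) = `|t| * N x.
Proof. by rewrite rscE cnormZ Re_normC_real. Qed.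
Lemma cnorm_rsc t : N (rsc t) = `|t|.
Proof. by rewrite -[rsc t]mulr1 cnorm_rscM cnorm1 mulr1. Qed.
Lemma rscV t : t != 0 -> rsc t * rsc t^-1 = 1.
Proof. by move=> t0; rewrite -rscM divff// rsc1. Qed.
Lemma rscVK t x : t != 0 -> rsc t * (rsc t^-1 * x) = x.
Proof. by move=> t0; rewrite mulrA rscV// mul1r. Qed.

Definition iunit : A := ('i : R[i])%:A.

Lemma iunitE x : iunit * x = 'i *: x.
Proof. by rewrite /iunit -scalerAl mul1r. Qed.
Lemma iunitC x : iunit * x = x * iunit.
Proof. by rewrite iunitE /iunit -scalerAr mulr1. Qed.
Lemma iunitM : iunit * iunit = -1.
Proof. by rewrite iunitE /iunit scalerA -expr2 sqrCi scaleN1r. Qed.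
Lemma star_iunit : star iunit = - iunit.
Proof. by rewrite /iunit starZ star1 conjCi scaleNr. Qed.

Definition sa x := star x = x.

Lemma saD x y : sa x -> sa y -> sa (x + y).
Proof. by rewrite /sa starD => -> ->. Qed.
Lemma saN x : sa x -> sa (- x).
Proof. by rewrite /sa starN => ->. Qed.
Lemma saB x y : sa x -> sa y -> sa (x - y).
Proof. by move=> sx sy; apply/saD/saN. Qed.
Lemma sa1 : sa 1. Proof. exact: star1. Qed.
Lemma saM x y : sa x -> sa y -> x * y = y * x -> sa (x * y).
Proof. by rewrite /sa starM => -> -> ->. Qed.
Lemma sa_sqr x : sa x -> sa (x * x).
Proof. by move=> sx; apply: saM. Qed.
Lemma sa_rsc t : sa (rsc t). Proof. exact: star_rsc. Qed.
Lemma sa_rscM t x : sa x -> sa (rsc t * x).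
Proof. by move=> sx; apply: saM => //; [exact: sa_rsc | exact: rscC]. Qed.
Lemma sa_starM x : sa (star x * x).
Proof. by rewrite /sa starM starK. Qed.

(** Repeated squaring is what the C*-identity controls; this is the trace left here by the spectral
    radius formula. *)
Lemma cnorm_exp2_sa x k : sa x -> N (x ^+ (2 ^ k)) = N x ^+ (2 ^ k).
Proof.
move=> sx; elim: k => [|k IHk]; first by rewrite !expr1.
rewrite expnS mulnC !exprM -IHk expr2 cnorm_sqr_sa//.
by rewrite /sa; elim: (2 ^ k)%N => [|n]; rewrite ?expr0 ?star1// exprS starM
  {1}sx => ->; rewrite -exprSr exprS.
Qed.

Definition cvg_bd := bd_cvg (fun (x : A) a => N x <= a).

Lemma telescope_cvg (u : nat -> A) (c : nat -> R) M :
  (forall n, N (u n.+1 - u n) <= c n.+1 - c n) ->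
  (forall n, c n <= c n.+1) -> (forall n, c n <= M) -> exists l, cvg_bd u l.
Proof.
move=> uc c_incr c_le.
have umn m n : (m <= n)%N -> N (u n - u m) <= c n - c m.
  move=> /subnK <-; elim: (n - m)%N => [|k IHk].
    by rewrite !subrr cnorm0.
  rewrite addSn; have -> : u (k + m).+1 - u m =
    (u (k + m).+1 - u (k + m)%N) + (u (k + m)%N - u m) by ncring.
  by have := cnormD (u (k + m).+1 - u (k + m)%N) (u (k + m)%N - u m);
    have := uc (k + m)%N; lra.
have [e e0|l /(norm_cvgP cnorm_ge0) ul] := @cnorm_complete R A u.
  have [K cK] := nondecreasing_bounded_cauchy c_incr c_le e0.
  exists K => m n Km Kn; case/orP: (leq_total m n) => /umn le.
    by rewrite cnormBC; apply: le_lt_trans le _; exact: cK.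
  by apply: le_lt_trans le _; exact: cK.
exists l => e /ul[K uK]; exists K => n /uK; exact: ltW.
Qed.

(** The tool that passes equations to the limit: [x] is the defect of the equation at [l],
    controlled by the distance to each approximant. *)
Lemma cvg_bd_le (v : nat -> A) l x K :
  cvg_bd v l -> (forall n, N x <= K * N (v n - l)) -> x = 0.
Proof.
move=> vl xK; apply: cnorm_small => e e0.
have K1 : 0 < `|K| + 1 by have := normr_ge0 K; lra.
have [M /(_ M (leqnn M)) vM] := vl (e / (`|K| + 1)) ltac:(by rewrite divr_gt0).
apply: le_trans (xK M) _; rewrite ler_pdivlMr// in vM.
by have := cnorm_ge0 (v M - l); have := ler_norm K; nra.
Qed.

Let half : A := rsc (1 / 2).

(** [visser_sqrt] at [T = 1 - x]. Self-adjointness, the norm bound and commutation with the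
    commutant of [x] are closed properties kept by the iteration. The commutation clause stands in
    for functional calculus: it is what makes roots of commuting elements commute. *)
Lemma sqrt_near1 x : sa x -> N (1 - x) <= 1 ->
  exists y, [/\ sa y, y * y = x, N (1 - y) <= 1
    & forall c, c * x = x * c -> c * y = y * c].
Proof.
move=> sx x1.
have hh : half + half = 1 by rewrite -rscD -splitr rsc1.
have halfn y a : N y <= a -> N (half * y) <= a / 2.
  by rewrite cnorm_rscM ger0_norm ?divr_ge0//; lra.
have bdM y z a b : N y <= a -> N z <= b -> N (y * z) <= a * b.
  move=> ya zb; apply: le_trans (cnormM _ _) _.
  by apply: ler_pM => //; exact: cnorm_ge0.
have bdD y z a b : N y <= a -> N z <= b -> N (y + z) <= a + b.
  by move=> ya zb; apply: le_trans (cnormD _ _) _; exact: lerD.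
have [||Y [_ YY YP]] := @visser_sqrt R A (fun x a => N x <= a) half
    (fun x a b xa ab => le_trans xa ab) _ _ bdD bdM cnorm_small telescope_cvg hh
    halfn (1 - x) x1.
- by rewrite cnorm0.
- by move=> y a; rewrite cnormN.
exists (1 - Y); split.
- apply: saB; first exact: sa1.
  apply: (YP sa); first exact: star0.
    by move=> y sy; apply/sa_rscM/saD/sa_sqr => //; apply/saB => //; exact: sa1.
  move=> v l sv vl; apply/eqP; rewrite -subr_eq0; apply/eqP.
  apply: (cvg_bd_le (K := 2) vl) => n.
  have -> : star l - l = (v n - l) - star (v n - l).
    by rewrite starB sv; ncring.
  by apply: le_trans (cnormB _ _) _; rewrite cnorm_starE; lra.
- by rewrite YY; ncring.
- have -> : 1 - (1 - Y) = Y by ncring.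
  apply: (YP (fun y => N y <= 1)); first by rewrite cnorm0.
    move=> y y1; apply: le_trans (halfn _ _ (bdD _ _ _ _ x1 (bdM _ _ _ _ y1 y1))) _.
    lra.
  move=> v l v1 vl; apply/ler_addgt0Pl => e /vl[M /(_ M (leqnn M)) vM].
  have -> : l = v M - (v M - l) by ncring.
  by apply: le_trans (cnormB _ _) _; have := v1 M; lra.
- move=> c cx; suff : c * Y = Y * c by rewrite mulrBr mulrBl mulr1 mul1r => ->.
  apply: (YP (fun y => c * y = y * c)); first by rewrite mulr0 mul0r.
    move=> y cy; rewrite mulrA -rscC -!mulrA; congr (_ * _).
    have -> : c * (1 - x + y * y) = c - c * x + c * y * y by ncring.
    rewrite cx cy.
    have -> : c - x * c + y * c * y = c - x * c + y * (c * y) by ncring.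
    by rewrite cy; ncring.
  move=> v l cv vl; apply/eqP; rewrite -subr_eq0; apply/eqP.
  apply: (cvg_bd_le (K := 2 * N c) vl) => n.
  have -> : c * l - l * c = (v n - l) * c - c * (v n - l).
    by rewrite mulrBl mulrBr cv; ncring.
  apply: le_trans (cnormB _ _) _.
  have := cnormM (v n - l) c; have := cnormM c (v n - l); lra.
Qed.

End CStarTheory.

(** * Positive elements of a C*-algebra *)

Section Positivity.
Context {R : realType} {A : cstarType R}.
Implicit Types (x y z a b c : A) (t : R).
Local Notation N := (@cnorm R A).

(* [N (rsc t - x) <= t] means that the spectrum of [x] lies in [0, 2t]. *)
Definition psd x := sa x /\ exists2 t, 0 < t & N (rsc t - x) <= t.

Lemma psd_sa x : psd x -> sa x. Proof. by case. Qed.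

Lemma psdD x y : psd x -> psd y -> psd (x + y).
Proof.
move=> [sx [s s0 xs]] [sy [t t0 yt]]; split; first exact: saD.
exists (s + t); first by rewrite addr_gt0.
have -> : rsc (s + t) - (x + y) = (rsc s - x) + (rsc t - y).
  by rewrite rscD; ncring.
by apply: le_trans (cnormD _ _) _; exact: lerD.
Qed.

Lemma psdZ t x : 0 < t -> psd x -> psd (rsc t * x).
Proof.
move=> t0 [sx [s s0 xs]]; split; first exact: sa_rscM.
exists (t * s); first by rewrite mulr_gt0.
by rewrite rscM -mulrBr cnorm_rscM gtr0_norm// ler_pM2l.
Qed.

Lemma psdZE t x : 0 < t -> psd (rsc t * x) <-> psd x.
Proof.
move=> t0; split; last exact: psdZ.
have ti0 : 0 < t^-1 by rewrite invr_gt0.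
by move=> /(psdZ ti0); rewrite -{2}[t]invrK rscVK// gt_eqF.
Qed.

Lemma psd_subr t x : 0 < t -> sa x -> N x <= t -> psd (rsc t - x).
Proof.
move=> t0 sx xt; split; first by apply: saB => //; exact: sa_rsc.
by exists t => //; rewrite opprB addrC subrK.
Qed.

Lemma psd_sqrt x : psd x -> exists y, [/\ psd y, y * y = x
  & forall c, c * x = x * c -> c * y = y * c].
Proof.
move=> [sx [t t0 xt]].
have t1 : N (1 - rsc t^-1 * x) <= 1.
  rewrite -(rscV (A := A) (lt0r_neq0 t0)) rscC -mulrBr cnorm_rscM.
  by rewrite gtr0_norm ?invr_gt0// ler_pdivrMl// mulr1.
have [|y [sy yy y1 yc]] := sqrt_near1 _ t1; first exact: sa_rscM.
have s0 : 0 < Num.sqrt t by rewrite sqrtr_gt0.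
exists (rsc (Num.sqrt t) * y); split.
- apply: psdZ => //; split=> //; exists 1 => //; by rewrite rsc1.
- rewrite mulrA -(mulrA _ y) -rscC mulrA -rscM -mulrA yy -expr2 sqr_sqrtr 1?ltW//.
  by rewrite rscVK// gt_eqF.
- move=> c cx; rewrite mulrA -rscC -!mulrA; congr (_ * _).
  by apply: yc; rewrite mulrA -rscC -!mulrA cx.
Qed.

(* [x + i y] is unitary. *)
Lemma circle_norm x y : sa x -> sa y -> x * y = y * x -> x * x + y * y = 1 ->
  N x <= 1.
Proof.
move=> sx sy xy xxyy; set u := x + iunit * y.
have su : star u = x - iunit * y.
  by rewrite /u starD starM sx sy star_iunit mulrN -iunitC.
have uu : star u * u = 1.
  have -> : star u * u = x * x + (x * iunit) * y - iunit * (y * x) - iunit * (y * iunit) * y.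
    by rewrite su /u; ncring.
  by rewrite -!iunitC !mulrA iunitM -mulrA xy; rewrite mulrA addrK mulN1r mulNr opprK.
have u1 : N u ^+ 2 = 1 by rewrite -cnorm_star uu cnorm1.
have {}u1 : N u = 1.
  by apply/eqP; rewrite -[_ == _](eqrXn2 (n := 2)) ?cnorm_ge0// u1 expr1n.
have xE : x = rsc (1 / 2) * (u + star u).
  have -> : u + star u = x + x by rewrite su /u; ncring.
  by rewrite mulrDr -mulrDl -rscD -splitr rsc1 mul1r.
rewrite xE cnorm_rscM gtr0_norm ?divr_gt0//.
by have := cnormD u (star u); rewrite cnorm_starE u1; lra.
Qed.

(** After scaling to [|y| <= 1], the element [1 - y^2] is within 1 of the unit and has a root [z].
    As [z^2 + y^2 = 1] with [z] and [y] commuting, [circle_norm] gives [|1 - y^2| = |z|^2 <= 1], the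
    inequality of [psd] at [t = 1]. *)
Lemma psd_sqr x : sa x -> psd (x * x).
Proof.
move=> sx; set t := N x + 1.
have t0 : 0 < t by rewrite /t; have := cnorm_ge0 x; lra.
pose y := rsc t^-1 * x.
have sy : sa y by exact: sa_rscM.
have y1 : N y <= 1.
  rewrite cnorm_rscM gtr0_norm ?invr_gt0// ler_pdivrMl// mulr1 /t; lra.
have xy : x = rsc t * y by rewrite rscVK// gt_eqF.
move: y sy y1 xy => y sy y1 xy.
have yyE : 1 - (1 - y * y) = y * y by ncring.
have [||z [sz zz z1 zc]] := @sqrt_near1 _ _ (1 - y * y).
- by apply/saB/sa_sqr => //; exact: sa1.
- by rewrite yyE cnorm_sqr_sa// expr_le1 ?cnorm_ge0.
have xx : x * x = rsc (t * t) * (y * y).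
  by rewrite xy rscM !mulrA -(mulrA _ y) -rscC mulrA.
rewrite xx; apply: psdZ; first exact: mulr_gt0.
split; first exact: sa_sqr.
exists 1 => //; rewrite rsc1 -zz cnorm_sqr_sa// expr_le1 ?cnorm_ge0//.
apply: (@circle_norm _ y) => //; last by rewrite zz subrK.
by apply/esym/zc; ncring.
Qed.

(** The circle again: commuting roots [a] and [b] of [x / t] and [1 - x / t] satisfy
    [a^2 + b^2 = 1], so [|x / t| = |a|^2 <= 1]. *)
Lemma psd_le_norm t x : 0 < t -> psd x -> psd (rsc t - x) -> N x <= t.
Proof.
move=> t0 px ptx.
have {}px : psd (rsc t^-1 * x) by apply: psdZ; rewrite ?invr_gt0.
have {}ptx : psd (1 - rsc t^-1 * x).
  rewrite -(rscV (A := A) (lt0r_neq0 t0)) rscC -mulrBr.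
  by apply: psdZ; rewrite ?invr_gt0.
rewrite -(rscVK x (lt0r_neq0 t0)) cnorm_rscM gtr0_norm// -[leRHS]mulr1 ler_pM2l//.
move: (rsc t^-1 * x) px ptx => y py pty.
have [a [pa aa ac]] := psd_sqrt py; have [b [pb bb bc]] := psd_sqrt pty.
rewrite -aa cnorm_sqr_sa ?expr_le1 ?cnorm_ge0//; last exact: psd_sa.
apply: (@circle_norm _ b); try exact: psd_sa; last by rewrite aa bb addrC subrK.
by apply/esym/ac/esym; apply: bc; ncring.
Qed.

Lemma psd_norm_mono x y : psd x -> sa y -> psd (y - x) -> N x <= N y.
Proof.
move=> px sy pyx; apply/ler_addgt0Pl => e e0.
have t0 : 0 < e + N y by have := cnorm_ge0 y; lra.
apply: psd_le_norm => //.
have -> : rsc (e + N y) - x = (rsc (e + N y) - y) + (y - x) by ncring.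
by apply: psdD => //; apply: psd_subr => //; lra.
Qed.

Lemma psd0 : psd 0.
Proof. by rewrite -(mulr0 0); apply: psd_sqr; exact: star0. Qed.

Lemma psd_anti x : psd x -> psd (- x) -> x = 0.
Proof.
move=> px pnx; apply: cnorm_eq0; apply/eqP; rewrite eq_le cnorm_ge0 andbT.
by rewrite -(cnorm0 (A := A)) psd_norm_mono ?sub0r//; exact: star0.
Qed.

(** The commutant clause, used once for each root, makes the roots commute; the product is then the
    square of a self-adjoint element. *)
Lemma psdM x y : psd x -> psd y -> x * y = y * x -> psd (x * y).
Proof.
move=> px py xy.
have [a [pa aa ac]] := psd_sqrt px; have [b [pb bb bc]] := psd_sqrt py.
have ab : a * b = b * a by apply/esym/ac/esym/bc.
have -> : x * y = (a * b) * (a * b).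
  by rewrite -aa -bb !mulrA -(mulrA a b a) -ab !mulrA.
by apply/psd_sqr/saM => //; exact: psd_sa.
Qed.

(** By Bernoulli's inequality the powers of a number above 1 are unbounded. *)
Let le1_of_exp2 t : 0 <= t -> (forall k, t ^+ (2 ^ k) <= 2) -> t <= 1.
Proof.
move=> t0 tk; rewrite leNgt; apply/negP => t1.
have bern n : 1 + n%:R * (t - 1) <= t ^+ n.
  elim: n => [|n IHn]; first by rewrite mul0r addr0 expr0.
  rewrite exprS -natr1; have n0 : 0 <= n%:R :> R by [].
  have := ler_wpM2l t0 IHn; have := mulr_ge0 n0 (sqr_ge0 (t - 1)).
  lra.
pose n := Num.Def.archi_bound (t - 1)^-1.
have nt : 1 < n%:R * (t - 1).
  rewrite -ltr_pdivrMr ?subr_gt0// div1r.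
  by apply: archi_boundP; rewrite invr_ge0 subr_ge0 ltW.
have := tk n; have := bern (2 ^ n)%N.
have : n%:R <= (2 ^ n)%:R :> R by rewrite ler_nat ltnW// ltn_expl.
nra.
Qed.

(* With [X = (1 - a)^n], [Y = (1 - b)^n] and [H = (1 - a - b)^n] one has
   [X + Y = 1 + H] and [X Y = H], so [(X - Y)^2 = (1 - H)^2]; hence the powers of
   [1 - a] are bounded. *)
Lemma orth_norm_le1 a b : sa a -> sa b -> a * b = 0 -> N (1 - (a + b)) <= 1 ->
  N (1 - a) <= 1.
Proof.
move=> sA sB ab h1.
have ba : b * a = 0 by rewrite -(star0 (A := A)) -ab starM sA sB.
have pw n : [/\ (1 - a) ^+ n + (1 - b) ^+ n = 1 + (1 - (a + b)) ^+ n,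
    (1 - a) ^+ n * (1 - b) ^+ n = (1 - (a + b)) ^+ n,
    (1 - b) ^+ n * a = a, (1 - a) ^+ n * b = b
  & (1 - b) ^+ n * (1 - a) ^+ n = (1 - (a + b)) ^+ n].
  elim: n => [|n [XY XYM Ya Xb YXM]]; first by rewrite !expr0 !mul1r.
  have Ha : (1 - (a + b)) ^+ n * a = (1 - a) ^+ n * a by rewrite -XYM -mulrA Ya.
  have Hb : (1 - (a + b)) ^+ n * b = (1 - b) ^+ n * b by rewrite -YXM -mulrA Xb.
  have e1 : (1 - a) * (1 - b) = 1 - (a + b).
    have -> : (1 - a) * (1 - b) = 1 - (a + b) + a * b by ncring.
    by rewrite ab addr0.
  have e2 : (1 - b) * (1 - a) = 1 - (a + b).
    have -> : (1 - b) * (1 - a) = 1 - (a + b) + b * a by ncring.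
    by rewrite ba addr0.
  have cm : GRing.comm (1 - a) (1 - b) by rewrite /GRing.comm e1 e2.
  split.
  - rewrite !exprSr !mulrBr !mulr1 mulrDr Ha Hb.
    have -> (p q r s : A) : p - q + (r - s) = (p + r) - (q + s) by ncring.
    by rewrite XY; ncring.
  - by rewrite -exprMn_comm// e1.
  - by rewrite exprSr -mulrA mulrBl mul1r ba subr0.
  - by rewrite exprSr -mulrA mulrBl mul1r ab subr0.
  - by rewrite -exprMn_comm// ?e2//; exact/commr_sym.
apply: le1_of_exp2 => [|k]; first exact: cnorm_ge0.
have s1 x : sa x -> sa (1 - x) by move=> sx; apply: saB => //; exact: sa1.
have sX x n : sa x -> sa (x ^+ n).
  move=> sx; elim: n => [|n IHn]; first exact: sa1.
  by rewrite exprS; apply: saM => //; rewrite -exprS exprSr.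
rewrite -cnorm_exp2_sa; last exact: s1.
have H1 n : N ((1 - (a + b)) ^+ n) <= 1.
  elim: n => [|n IHn]; first by rewrite cnorm1.
  rewrite exprS; apply: le_trans (cnormM _ _) _.
  by rewrite mulr_ile1 ?cnorm_ge0.
have [XY XYM _ _ YXM] := pw (2 ^ k)%N.
have sXX := sX _ (2 ^ k)%N (s1 _ sA); have sYY := sX _ (2 ^ k)%N (s1 _ sB).
have := H1 (2 ^ k)%N.
move: ((1 - a) ^+ _) ((1 - b) ^+ _) ((1 - (a + b)) ^+ _) XY XYM YXM sXX sYY.
move=> X Y H XY XYM YXM sX' sY' HN.
have sXYY : sa (X - Y) by exact: saB.
have XYH : N (X - Y) <= 2.
  have : (X - Y) * (X - Y) = (1 - H) * (1 - H).
    have -> : (X - Y) * (X - Y) = (X + Y) * (X + Y) - X * Y - X * Y - Y * X - Y * X.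
      by ncring.
    by rewrite XY XYM YXM; ncring.
  move=> /(congr1 N); rewrite cnorm_sqr_sa// => e.
  rewrite -(ler_pXn2r (n := 2)) ?nnegrE ?cnorm_ge0// e.
  have := cnormM (1 - H) (1 - H); have := cnormB 1 H; rewrite cnorm1.
  have := cnorm_ge0 (1 - H); nra.
have : N (X + X) <= 4.
  have -> : X + X = (X + Y) + (X - Y) by ncring.
  have := cnormD (X + Y) (X - Y); have := cnormD 1 H; rewrite XY cnorm1; lra.
have -> : X + X = rsc 2 * X by rewrite -[2]/(1 + 1) rscD rsc1 mulrDl mul1r.
by rewrite cnorm_rscM ger0_norm//; lra.
Qed.

Lemma psd_orth a b : sa a -> sa b -> a * b = 0 -> psd (a + b) -> psd a.
Proof.
move=> sA sB ab [_ [t t0 abt]].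
have t0' : 0 < t^-1 by rewrite invr_gt0.
apply/(psdZE _ t0'); split; first exact: sa_rscM.
exists 1 => //; rewrite rsc1; apply: (@orth_norm_le1 _ (rsc t^-1 * b)).
- exact: sa_rscM.
- exact: sa_rscM.
- by rewrite -mulrA (mulrA a) -rscC -mulrA ab !mulr0.
rewrite -mulrDr -(rscV (A := A) (lt0r_neq0 t0)) rscC -mulrBr cnorm_rscM.
by rewrite gtr0_norm// ler_pdivrMl// mulr1.
Qed.

(** With [h] the root of [x^2], that is [|x|], the elements [h + x] and [h - x] have product 0 and
    the positive sum [2 h]; [psd_orth] makes each of them positive. *)
Lemma jordan x : sa x -> exists p m, [/\ psd p, psd m, x = p - m & p * m = 0].
Proof.
move=> sx; have [h [ph hh hc]] := psd_sqrt (psd_sqr sx).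
have sh := psd_sa ph.
have hx : x * h = h * x by apply: hc; rewrite mulrA.
have pm : (h + x) * (h - x) = 0.
  have -> : (h + x) * (h - x) = h * h - x * x + (x * h - h * x) by ncring.
  by rewrite hh hx !subrr addr0.
have mp : (h - x) * (h + x) = 0.
  have -> : (h - x) * (h + x) = h * h - x * x - (x * h - h * x) by ncring.
  by rewrite hh hx !subrr.
have p4 : psd (h + x + (h - x)).
  by have -> : h + x + (h - x) = h + h; [ncring | exact: psdD].
have pp : psd (h + x) by apply: psd_orth pm p4; [exact: saD|exact: saB].
have pm' : psd (h - x).
  apply: (psd_orth (b := h + x)) mp _; [exact: saB|exact: saD|].
  by rewrite addrC.
exists (rsc (1 / 2) * (h + x)), (rsc (1 / 2) * (h - x)); split.
- by apply: psdZ => //; rewrite divr_gt0.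
- by apply: psdZ => //; rewrite divr_gt0.
- rewrite -mulrBr; have -> : h + x - (h - x) = x + x by ncring.
  by rewrite mulrDr -mulrDl -rscD -splitr rsc1 mul1r.
- by rewrite -mulrA (mulrA (h + x)) -rscC -mulrA pm !mulr0.
Qed.

End Positivity.

(** * Positivity of [star z * z], and inverses of [1 + y] *)

Section StarSquares.
Context {R : realType} {A : cstarType R}.
Implicit Types (x y z a b c : A) (t : R).
Local Notation N := (@cnorm R A).

(** The binomial expansion cut after its first-order term. The induction also carries commutation
    with [c], which [psdM] requires at each step. *)
Lemma psd_pow_bound c n : psd c ->
  psd (c * (1 + c) ^+ n - (rsc n%:R * (c * c) + c)).
Proof.
move=> pc; have sc := psd_sa pc; have pcc := psd_sqr sc.
suff [] : psd (c * (1 + c) ^+ n - (rsc n%:R * (c * c) + c)) /\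
  GRing.comm c (c * (1 + c) ^+ n - (rsc n%:R * (c * c) + c)) by [].
have c1 : GRing.comm c (1 + c) by rewrite /GRing.comm; ncring.
elim: n => [|n [IHp IHc]].
  rewrite /rsc scale0r expr0 mulr1 mul0r add0r subrr; split; first exact: psd0.
  by rewrite /GRing.comm mulr0 mul0r.
have -> : c * (1 + c) ^+ n.+1 - (rsc n.+1%:R * (c * c) + c)
    = (c * (1 + c) ^+ n - (rsc n%:R * (c * c) + c))
      + (c * (1 + c) ^+ n - (rsc n%:R * (c * c) + c)) * c
      + rsc n%:R * (c * (c * c)).
  rewrite exprSr -natr1 rscD rsc1.
  by move: (_ ^+ n) (rsc n%:R) => X r; ncring.
have p3 : psd (rsc n%:R * (c * (c * c))).
  case: n {IHp IHc} => [|n]; first by rewrite /rsc scale0r mul0r; exact: psd0.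
  by apply: psdZ => //; apply: psdM => //; rewrite mulrA.
split.
  by apply: psdD => //; apply: psdD => //; apply: psdM.
apply: commrD; first by apply: commrD => //; apply: commrM => //.
apply: commrM; first by rewrite /GRing.comm -rscC.
by apply: commrM => //; apply: commrM.
Qed.

Lemma star_expr z n : star (z ^+ n) = star z ^+ n.
Proof.
by elim: n => [|n IHn]; rewrite ?expr0 ?star1// exprS starM IHn -exprSr.
Qed.

(* If [star v * v = - c] with [c >= 0], then [v * star v >= 0], whence the bound
   [|c (1 + c)^n| <= |v|^2], although [c (1 + c)^n >= n c^2]. *)
Lemma star_sqr_neg (v c : A) : psd c -> star v * v = - c -> c = 0.
Proof.
move=> pc vc; have sc := psd_sa pc.
pose p := rsc (1 / 2) * (v + star v).
pose q := rsc (1 / 2) * (iunit * (v - star v)).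
have sp : sa p by apply: sa_rscM; rewrite /sa starD starK addrC.
have sq : sa q.
  by apply: sa_rscM; rewrite /sa starM starB starK star_iunit iunitC; ncring.
have pq : p * p + q * q = rsc (1 / 2) * (star v * v + v * star v).
  rewrite /p /q.
  have -> x y : rsc (1 / 2) * x * (rsc (1 / 2) * x) + rsc (1 / 2) * y * (rsc (1 / 2) * y)
      = rsc (1 / 2) * (rsc (1 / 2) * (x * x + y * y)).
    by rewrite -!mulrA !(mulrA x) !(mulrA y) -!rscC; ncring.
  congr (_ * _).
  have -> : iunit * (v - star v) * (iunit * (v - star v)) =
     iunit * ((v - star v) * iunit) * (v - star v) by ncring.
  rewrite -iunitC mulrA iunitM mulN1r mulNr.
  have -> : (v + star v) * (v + star v) - (v - star v) * (v - star v)
      = (star v * v + v * star v) + (star v * v + v * star v) by ncring.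
  by rewrite mulrDr -mulrDl -rscD -splitr rsc1 mul1r.
have pQ : psd (v * star v).
  have -> : v * star v = (rsc 2 * (p * p + q * q)) + c.
    rewrite pq mulrA -rscM (_ : 2 * (1 / 2) = 1) ?rsc1 ?mul1r ?vc; last by field.
    by ncring.
  by apply: psdD => //; apply: psdZ => //; apply: psdD; exact: psd_sqr.
have [_ [t t0 Qt]] := pQ; have tn0 := lt0r_neq0 t0.
pose d := rsc t^-1 * c.
have pd : psd d by apply: psdZ; rewrite ?invr_gt0.
(* The intertwining [(1 - v v* / t) v = v (1 + d)] trades a power of [1 + d] for a power of the
   contraction [1 - v v* / t]. *)
have tr n : d * (1 + d) ^+ n =
    - (rsc t^-1 * (star v * (1 - rsc t^-1 * (v * star v)) ^+ n * v)).
  have -> : star v * (1 - rsc t^-1 * (v * star v)) ^+ n * v = star v * v * (1 + d) ^+ n.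
    rewrite -mulrA; have -> : (1 - rsc t^-1 * (v * star v)) ^+ n * v = v * (1 + d) ^+ n.
      have Qv : (1 - rsc t^-1 * (v * star v)) * v = v * (1 + d).
        rewrite mulrBl mul1r mulrDr mulr1; congr (_ + _).
        have vvv : v * star v * v = - (v * c) by rewrite -mulrA vc mulrN.
        by rewrite -mulrA vvv mulrN opprK /d [RHS]mulrA -rscC mulrA.
      elim: n => [|n IHn]; first by rewrite !expr0 mul1r mulr1.
      by rewrite exprS -mulrA IHn (mulrA (1 - _) v) Qv [in RHS]exprS -mulrA.
    by rewrite mulrA.
  by rewrite vc mulNr mulrN opprK /d mulrA.
have cb n : N (d * (1 + d) ^+ n) <= t^-1 * (N v * N v).
  rewrite tr cnormN cnorm_rscM gtr0_norm ?invr_gt0// ler_pM2l ?invr_gt0//.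
  have u1 : N ((1 - rsc t^-1 * (v * star v)) ^+ n) <= 1.
    have u1 : N (1 - rsc t^-1 * (v * star v)) <= 1.
      rewrite -(rscV (A := A) tn0) rscC -mulrBr cnorm_rscM.
      by rewrite gtr0_norm ?invr_gt0// ler_pdivrMl// mulr1.
    elim: n => [|n IHn]; first by rewrite cnorm1.
    rewrite exprS; apply: le_trans (cnormM _ _) _.
    by rewrite mulr_ile1 ?cnorm_ge0.
  apply: le_trans (cnormM _ _) _; rewrite ler_wpM2r ?cnorm_ge0//.
  apply: le_trans (cnormM _ _) _; rewrite cnorm_starE.
  by rewrite ler_piMr ?cnorm_ge0.
suff d0 : d = 0 by rewrite -(rscVK c tn0) -/d d0 mulr0.
have sd := psd_sa pd.
have nb n : n%:R * N d ^+ 2 <= t^-1 * (N v * N v).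
  apply: le_trans (cb n); rewrite -cnorm_sqr_sa//.
  case: n => [|n]; first by rewrite mul0r cnorm_ge0.
  have <- : N (rsc n.+1%:R * (d * d)) = n.+1%:R * N (d * d).
    by rewrite cnorm_rscM ger0_norm.
  apply: psd_norm_mono.
  - by apply: psdZ => //; exact: psd_sqr.
  - have cm : GRing.comm d ((1 + d) ^+ n.+1).
      by apply: commrX; rewrite /GRing.comm; ncring.
    apply: saM => //; rewrite /sa star_expr starD star1 sd//.
  - have := psdD (psd_pow_bound n.+1 pd) pd.
    by congr (psd _); rewrite opprD addrA subrK.
apply: cnorm_eq0; apply/eqP; rewrite eq_le cnorm_ge0 andbT leNgt; apply/negP => d0.
set K := t^-1 * (N v * N v) in nb.
have d2 : 0 < N d ^+ 2 by rewrite exprn_gt0.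
have := nb (Num.Def.archi_bound (K / N d ^+ 2)).
rewrite -ler_pdivlMr// leNgt => /negP; apply; apply: archi_boundP.
by rewrite divr_ge0 ?(ltW d2)// /K !mulr_ge0 ?invr_ge0 ?cnorm_ge0 ?(ltW t0).
Qed.

(** If [z* z = p - m] is the decomposition of [jordan], then [v = z m] has [v* v = - m^3]. By
    [star_sqr_neg] the cube vanishes, and two uses of the C*-identity give [m = 0]. *)
Lemma psd_starM z : psd (star z * z).
Proof.
have sx := sa_starM z.
have [p [m [pp pm xE pm0]]] := jordan sx.
have sp := psd_sa pp; have sm := psd_sa pm.
have mp0 : m * p = 0 by rewrite -(star0 (A := A)) -pm0 starM sp sm.
suff m0 : m = 0 by rewrite xE m0 subr0.
have c0 : m * (m * m) = 0.
  apply: (@star_sqr_neg (z * m)).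
    by apply: psdM => //; [exact: psd_sqr | rewrite mulrA].
  rewrite starM sm.
  have -> : m * star z * (z * m) = m * (star z * z) * m by ncring.
  rewrite xE.
  have -> : m * (p - m) * m = m * p * m - m * (m * m) by ncring.
  by rewrite mp0 mul0r sub0r.
have mm : m * m = 0.
  apply: cnorm_eq0; apply/eqP.
  rewrite -sqrf_eq0 -cnorm_sqr_sa; last exact: sa_sqr.
  have -> : m * m * (m * m) = m * (m * (m * m)) by ncring.
  by rewrite c0 mulr0 cnorm0.
by apply: cnorm_eq0; apply/eqP; rewrite -sqrf_eq0 -cnorm_sqr_sa// mm cnorm0.
Qed.

(** The geometric series as the iteration [w := 1 + q w], majorized by the same iteration on [r]. It
    yields a right inverse; [psd_inv1] makes it two-sided by taking adjoints. *)
Lemma neumann q (r : R) : N q <= r -> r < 1 -> exists w, (1 - q) * w = 1.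
Proof.
move=> qr r1; have r0 : 0 <= r := le_trans (cnorm_ge0 q) qr.
pose u n := iter n (fun z => 1 + q * z) 0.
pose c n : R := iter n (fun s : R => 1 + r * s) 0.
have c_bnd n : 0 <= c n /\ (1 - r) * c n <= 1.
  elim: n => [|n [IH0 IH1]]; rewrite /c /= ?mulr0 ?ler01 ?lexx// -/(c n).
  by split; nra.
have c_incr n : c n <= c n.+1 by rewrite {2}/c /= -/(c n); have := c_bnd n; lra.
have [n|n|l ul] := @telescope_cvg _ A u c (1 - r)^-1 _ c_incr.
- elim: n => [|n IHn].
    by rewrite /u /c /= !mulr0 !addr0 !subr0 cnorm1.
  have -> : u n.+2 - u n.+1 = q * (u n.+1 - u n).
    by rewrite [u n.+2]/(1 + q * u n.+1) [X in _ - X = _]/(1 + q * u n); ncring.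
  have -> : c n.+2 - c n.+1 = r * (c n.+1 - c n).
    have : c n.+2 = 1 + r * c n.+1 by [].
    have : c n.+1 = 1 + r * c n by [].
    by move: (c n.+2) (c n.+1) => x y -> ->; ring.
  by apply: le_trans (cnormM _ _) _; apply: ler_pM; rewrite ?cnorm_ge0.
- by have [_] := c_bnd n; rewrite mulrC -ler_pdivlMr ?subr_gt0// div1r.
exists l; apply/eqP; rewrite -subr_eq0; apply/eqP; apply: cnorm_small => e e0.
have [M uM] := ul (e / 2) ltac:(by rewrite divr_gt0).
have -> : (1 - q) * l - 1 = (u M.+1 - q * u M - 1) - ((u M.+1 - l) - q * (u M - l)).
  by ncring.
have -> : u M.+1 - q * u M - 1 = 0.
  by rewrite [u M.+1]/(1 + q * u M); ncring.
rewrite sub0r cnormN; apply: le_trans (cnormB _ _) _.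
have := uM M (leqnn M); have := uM M.+1 (leqnSn M).
have := cnormM q (u M - l); have := cnorm_ge0 (u M - l); have := cnorm_ge0 q; nra.
Qed.

(** The bound [|t - y| <= t] lets [1 + y] be written [(1 + t) (1 - q)] with
    [|q| <= t / (1 + t) < 1]. *)
Lemma psd_inv1 y : psd y -> exists w, [/\ sa w, (1 + y) * w = 1 & w * (1 + y) = 1].
Proof.
move=> [sy [t t0 yt]].
have t1 : 0 < 1 + t by rewrite addr_gt0.
have tn0 := lt0r_neq0 t1.
pose q := rsc (1 + t)^-1 * (rsc t - y).
have qt : N q <= t / (1 + t).
  by rewrite cnorm_rscM gtr0_norm ?invr_gt0// mulrC ler_wpM2r// invr_ge0 ltW.
have [|w0 qw] := neumann qt; first by rewrite ltr_pdivrMr// mul1r; lra.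
have qE : 1 + y = rsc (1 + t) * (1 - q).
  rewrite mulrBr mulr1 /q rscVK// rscD rsc1; ncring.
pose w := w0 * rsc (1 + t)^-1.
have yw : (1 + y) * w = 1.
  by rewrite qE /w -rscC -mulrA (mulrA (1 - q)) -rscC -mulrA qw mulr1 rscV.
have wy : star w * (1 + y) = 1.
  by have := congr1 star yw; rewrite starM starD star1 sy.
have sw : star w = w.
  by rewrite -[star w]mulr1 -yw mulrA wy mul1r.
by exists w; split=> //; rewrite -{1}sw.
Qed.

(* The function [t / (1 + t)^2] is bounded by [1 / 4]. *)
Lemma inv1_norm y w : psd y -> sa w -> (1 + y) * w = 1 -> w * (1 + y) = 1 ->
  N ((w + w) * y * (w + w)) <= 1.
Proof.
move=> py sw yw wy; have [b [pb bb _]] := psd_sqrt py; have sb := psd_sa pb.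
have yw' : y * w = w * y.
  by have := etrans yw (esym wy); rewrite mulrDl mulrDr mul1r mulr1 => /addrI.
apply: psd_le_norm => //.
  have -> : (w + w) * y * (w + w) = star (b * (w + w)) * (b * (w + w)).
    by rewrite starM starD sw sb -bb; ncring.
  exact: psd_starM.
(* The identity [(1 + y)^2 - 4 y = (1 - y)^2], multiplied by [w] on both sides. *)
have -> : rsc 1 - (w + w) * y * (w + w) = (w * (1 - y)) * (w * (1 - y)).
  have w1 : w * ((1 + y) * (1 + y)) * w = rsc 1.
    by rewrite mulrA wy mul1r yw rsc1.
  rewrite -w1.
  have -> : w * (1 - y) * (w * (1 - y)) = w * (1 - y) * (w - w * y) by ncring.
  by rewrite -yw'; ncring.
have cw : w * (1 - y) = (1 - y) * w by rewrite mulrBr mulrBl mulr1 mul1r yw'.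
have s1 : sa (1 - y) by apply: saB (psd_sa py); exact: sa1.
by apply/psd_sqr/saM.
Qed.

End StarSquares.

(** * Distance to a closed ideal *)

Section IdealDistance.
Context {R : realType} {U : cstarType R}.
Local Notation N := (@cnorm R U).

(* Truncation by [e = 2 (1 + p / s)^-1]: it is [1] modulo the ideal, and
   [e p e <= s]. *)
Lemma ideal_truncation (I : set U) (s : R) (a b : U) : closed_ideal I -> 0 < s ->
  I (star a * a + star b * b - rsc s) ->
  exists e, [/\ I (e - 1), I (star e - 1), N (a * e) ^+ 2 <= s & N (b * e) ^+ 2 <= s].
Proof.
move=> [_ I0 ID IMl IMr] s0; set p := (X in X - _) => Ip.
have sn0 := lt0r_neq0 s0.
have si0 : 0 < s^-1 by rewrite invr_gt0.
have pp : psd p by apply: psdD; exact: psd_starM.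
pose y := rsc s^-1 * p.
have py : psd y by exact: psdZ.
have [w [sw yw wy]] := psd_inv1 py.
(* Since [(1 + y) w = 1], one has [2 w - 1 = (1 - y) w], and [1 - y] is a multiple of [p - s]. *)
have w1 : I (w + w - 1).
  have -> : w + w - 1 = - rsc s^-1 * (p - rsc s) * w.
    rewrite mulrBr !mulNr -/y (rscC s^-1) rscV// -[X in _ - X = _]yw.
    by ncring.
  exact/IMr/IMl.
have sE : star (w + w) = w + w by rewrite starD sw.
have eaux (z z' : U) : star a * a + star b * b = star z * z + star z' * z' ->
    N (z * (w + w)) ^+ 2 <= s.
  move=> pE; rewrite -cnorm_star starM sE.
  have -> : (w + w) * star z * (z * (w + w)) = (w + w) * (star z * z) * (w + w).
    by ncring.
  apply: (@le_trans _ _ (N ((w + w) * p * (w + w)))).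
    have psdc (x : U) : psd ((w + w) * (star x * x) * (w + w)).
      have -> : (w + w) * (star x * x) * (w + w)
        = star (x * (w + w)) * (x * (w + w)) by rewrite starM sE; ncring.
      exact: psd_starM.
    apply: psd_norm_mono => //.
      by rewrite /sa !starM sE (psd_sa pp) mulrA.
    have -> : (w + w) * p * (w + w) - (w + w) * (star z * z) * (w + w)
        = (w + w) * (star z' * z') * (w + w) by rewrite /p pE; ncring.
    exact: psdc.
  have -> : (w + w) * p * (w + w) = rsc s * ((w + w) * y * (w + w)).
    by rewrite -(rscVK p sn0) -/y (mulrA (w + w)) -rscC -!mulrA.
  rewrite cnorm_rscM gtr0_norm// -[leRHS]mulr1 ler_pM2l//; exact: inv1_norm.
exists (w + w); split=> //; first by rewrite sE.
- exact: eaux erefl.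
- by apply: (eaux b a); rewrite addrC.
Qed.

(** The columns [(a, b)] and [(c, d)] are truncated separately. Their product is unchanged modulo
    the ideal and every truncated entry has norm at most [sqrt s]; estimating the two products one
    by one costs the factor 2. *)
Lemma ideal_dist (I : set U) (s : R) (a b c d : U) : closed_ideal I -> 0 < s ->
  I (star a * a + star b * b - rsc s) -> I (star c * c + star d * d - rsc s) ->
  exists x, I (x - (star a * c + star b * d)) /\ N x <= 2 * s.
Proof.
move=> clI s0 /(ideal_truncation clI s0)[e [_ Ie ae be]].
move=> /(ideal_truncation clI s0)[f [If _ cf df]].
have [_ _ ID IMl IMr] := clI.
exists (star (a * e) * (c * f) + star (b * e) * (d * f)); split.
  have -> : star (a * e) * (c * f) + star (b * e) * (d * f)
      - (star a * c + star b * d)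
      = (star e - 1) * ((star a * c + star b * d) * f)
        + (star a * c + star b * d) * (f - 1).
    by rewrite !starM; ncring.
  by apply: ID; [exact: IMr | exact: IMl].
have aux (x y : U) : N x ^+ 2 <= s -> N y ^+ 2 <= s -> N (star x * y) <= s.
  move=> xs ys; apply: le_trans (cnormM _ _) _; rewrite cnorm_starE.
  by have := sqr_ge0 (N x - N y); nra.
apply: le_trans (cnormD _ _) _.
by have := aux _ _ ae cf; have := aux _ _ be df; lra.
Qed.

End IdealDistance.

(** For [t] above [|x|^2], [t - x* x] is the square of a self-adjoint element. Homomorphisms
    preserve such squares, so the order bound, and with it the norm bound, passes to [f x]. *)
Lemma star_hom_contractive (R : realType) (A B : cstarType R)
  (f : {lrmorphism A -> B}) : is_star_hom f -> forall x, cnorm (f x) <= cnorm x.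
Proof.
move=> fs x; have frsc t : f (rsc t) = rsc t by rewrite /rsc linearZ rmorph1.
rewrite -(ler_pXn2r (n := 2)) ?nnegrE ?cnorm_ge0// -!cnorm_star.
apply/ler_addgt0Pl => e e0; set t := e + _.
have t0 : 0 < t by rewrite /t; have := cnorm_ge0 (star x * x); lra.
have [|y [/psd_sa sy yy _]] := @psd_sqrt _ _ (rsc t - star x * x).
  by apply: psd_subr => //; [exact: sa_starM | rewrite /t lerDr ltW].
apply: psd_le_norm => //; first exact: psd_starM.
have -> : rsc t - star (f x) * f x = f y * f y.
  have fE : f (rsc t - star x * x) = f (rsc t) - f (star x) * f x.
    by rewrite rmorphB rmorphM.
  have fyy : f (y * y) = f y * f y by rewrite rmorphM.
  by rewrite -fyy yy fE frsc fs.
by apply: psd_sqr; rewrite /sa -fs sy.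
Qed.

(** * Hilbert spaces and the C*-algebra of adjointable operators *)

Section RealForm.
Variables (R : realType) (E : lmodType R[i]) (b : E -> E -> R).
Hypothesis bDl : forall x y z, b (x + y) z = b x z + b y z.
Hypothesis bZl : forall (t : R) x y, b (t%:C%C *: x) y = t * b x y.
Hypothesis bC : forall x y, b x y = b y x.
Hypothesis b_ge0 : forall x, 0 <= b x x.

Let bDr x y z : b x (y + z) = b x y + b x z.
Proof. by rewrite bC bDl !(bC x). Qed.
Let bZr (t : R) x y : b x (t%:C%C *: y) = t * b x y.
Proof. by rewrite bC bZl bC. Qed.

(** Stated for an abstract real form because it serves twice: for the real part of an inner product,
    and for [l2dot] before [l2] has a norm. *)
Lemma real_form_CS x y : b x y <= Num.sqrt (b x x) * Num.sqrt (b y y).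
Proof.
have key s t : 2 * (s * t) * b x y <= s ^+ 2 * b x x + t ^+ 2 * b y y.
  have := b_ge0 (s%:C%C *: x + (- t)%:C%C *: y).
  rewrite !(bDl, bDr, bZl, bZr) (bC y x); lra.
set p := Num.sqrt _; set q := Num.sqrt _.
have p0 : 0 <= p by exact: sqrtr_ge0.
have q0 : 0 <= q by exact: sqrtr_ge0.
have pE : b x x = p ^+ 2 by rewrite sqr_sqrtr.
have qE : b y y = q ^+ 2 by rewrite sqr_sqrtr.
move: key; rewrite pE qE => key.
(* When one norm vanishes, a positive [b x y] is refuted by a parameter that makes the left side of
   [key] exceed the right side by 1. Otherwise [s = q] and [t = p] give the inequality. *)
have [q1|q1] := eqVneq q 0; [|have [p1|p1] := eqVneq p 0].
- rewrite q1 mulr0 leNgt; apply/negP => bxy.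
  have := key 1 ((p ^+ 2 + 1) / (2 * b x y)).
  rewrite q1 expr0n mulr0 addr0 expr1n !mul1r.
  rewrite (_ : 2 * _ * _ = p ^+ 2 + 1); first by lra.
  by field; rewrite gt_eqF.
- rewrite p1 mul0r leNgt; apply/negP => bxy.
  have := key ((q ^+ 2 + 1) / (2 * b x y)) 1.
  rewrite p1 expr0n mulr0 add0r expr1n mulr1 !mul1r.
  rewrite (_ : 2 * _ * _ = q ^+ 2 + 1); first by lra.
  by field; rewrite gt_eqF.
have pq : 0 < p * q by rewrite mulr_gt0 ?lt_def ?p0 ?q0 ?p1 ?q1.
rewrite -(ler_pM2l pq); have := key q p; lra.
Qed.

Lemma real_form_triangle x y :
  Num.sqrt (b (x + y) (x + y)) <= Num.sqrt (b x x) + Num.sqrt (b y y).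
Proof.
rewrite -(ler_pXn2r (n := 2)) ?nnegrE ?addr_ge0 ?sqrtr_ge0// sqr_sqrtr//.
rewrite sqrrD !sqr_sqrtr// !(bDl, bDr) (bC y x).
by have := real_form_CS x y; lra.
Qed.

(** Positivity of [X] at [h - X h / t], together with [X <= t] at [X h], gives
    [|X h|^2 <= t <X h, h>], from which the claim follows by expansion. This is how positivity on
    vectors becomes the norm inequality in [psd]. *)
Lemma form_contraction (X : E -> E) (t : R) : 0 < t ->
  (forall h k, X (h + k) = X h + X k) -> (forall (s : R) h, X (s%:C%C *: h) = s%:C%C *: X h) ->
  (forall h k, b (X h) k = b h (X k)) ->
  (forall h, 0 <= b (X h) h <= t * b h h) ->
  forall h, b (h + (- t^-1)%:C%C *: X h) (h + (- t^-1)%:C%C *: X h) <= b h h.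
Proof.
move=> t0 XD XZ XC Xp h; set r := - t^-1.
have /andP[pos1 _] := Xp (h + r%:C%C *: X h).
have /andP[_ pos2] := Xp (X h); have /andP[pos3 _] := Xp h.
move: pos1; rewrite !(XD, XZ, bDl, bDr, bZl, bZr) (XC (X h) h) (bC h (X h)).
move: pos2 pos3 (b_ge0 (X h)).
move: (b (X h) h) (b (X h) (X h)) (b (X (X h)) (X h)) => u v w.
have rt : r * t = -1 by rewrite /r mulNr mulVf// gt_eqF.
have r0 : 0 < - r by rewrite /r opprK invr_gt0.
move=> w1 u0 v0 pos.
have rw : - r * (- r * w) <= - r * v.
  rewrite ler_pM2l//; have := ler_wpM2l (ltW r0) w1.
  by rewrite (mulrA (- r) t) (_ : - r * t = 1) ?mul1r// mulNr rt opprK.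
have ruv : 0 <= r * v + u by lra.
have := mulr_ge0 (ltW r0) ruv; have := mulr_ge0 (ltW r0) u0; lra.
Qed.

End RealForm.

Section HilbertNorm.
Context {R : realType} {H : hilbert R}.
Implicit Types (x y z h k : H) (t : R).
Local Notation ip := (inner H).

(** The norm of a [hilbert] takes complex values; estimates use its real part [hn] and the real
    inner product [rip], and [ip_eq_rip] recovers complex identities. *)
Definition hn h : R := complex.Re `|h|.
Definition rip x y : R := complex.Re (ip x y).

Lemma hn_real h : `|h| = (hn h)%:C%C.
Proof. by rewrite RRe_real// ger0_real. Qed.

Lemma hn_ge0 h : 0 <= hn h.
Proof. by rewrite -ler0c -hn_real. Qed.

Lemma innerE h : ip h h = (hn h ^+ 2)%:C%C.
Proof. by rewrite -inner_norm hn_real rmorphXn. Qed.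

Lemma ripE h : rip h h = hn h ^+ 2.
Proof. by rewrite /rip innerE. Qed.

Lemma hn_sqrt h : hn h = Num.sqrt (rip h h).
Proof. by rewrite ripE sqrtr_sqr ger0_norm// hn_ge0. Qed.

Lemma ipDl x y z : ip (x + y) z = ip x z + ip y z. Proof. exact: linearDl. Qed.
Lemma ipDr x y z : ip x (y + z) = ip x y + ip x z. Proof. exact: linearDr. Qed.
Lemma ipBr x y z : ip x (y - z) = ip x y - ip x z. Proof. exact: linearBr. Qed.
Lemma ipZl (a : R[i]) x y : ip (a *: x) y = a * ip x y.
Proof. exact: linearZl_LR. Qed.
Lemma ipZr (a : R[i]) x y : ip x (a *: y) = a^* * ip x y.
Proof. exact: linearZr_LR. Qed.
Lemma ipC x y : ip x y = (ip y x)^*.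
Proof. by rewrite hermC expr0 mul1r. Qed.

Lemma ReD (a b : R[i]) : complex.Re (a + b) = complex.Re a + complex.Re b.
Proof. by case: a => ? ?; case: b. Qed.
Lemma Re_rM t (a : R[i]) : complex.Re (t%:C%C * a) = t * complex.Re a.
Proof. by case: a => u v /=; rewrite mul0r subr0. Qed.
Lemma Re_conj (a : R[i]) : complex.Re a^* = complex.Re a.
Proof. by case: a. Qed.

Lemma ripDl x y z : rip (x + y) z = rip x z + rip y z.
Proof. by rewrite /rip ipDl ReD. Qed.
Lemma ripZl t x y : rip (t%:C%C *: x) y = t * rip x y.
Proof. by rewrite /rip ipZl Re_rM. Qed.
Lemma ripC x y : rip x y = rip y x.
Proof. by rewrite /rip ipC Re_conj. Qed.
Lemma rip_ge0 x : 0 <= rip x x.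
Proof. by rewrite ripE sqr_ge0. Qed.

Lemma rip_CS x y : rip x y <= hn x * hn y.
Proof. by rewrite !hn_sqrt; apply: real_form_CS ripDl ripZl ripC rip_ge0 _ _. Qed.

Lemma hnD x y : hn (x + y) <= hn x + hn y.
Proof.
by rewrite !hn_sqrt; apply: real_form_triangle ripDl ripZl ripC rip_ge0 _ _.
Qed.

Lemma hn0 : hn 0 = 0. Proof. by rewrite /hn normr0. Qed.
Lemma hnN x : hn (- x) = hn x. Proof. by rewrite /hn normrN. Qed.
Lemma hnB x y : hn (x - y) <= hn x + hn y.
Proof. by rewrite -(hnN y) hnD. Qed.
Lemma hnBC x y : hn (x - y) = hn (y - x). Proof. by rewrite -hnN opprB. Qed.
Lemma hn_eq0 x : hn x = 0 -> x = 0.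
Proof. by move=> x0; apply/normr0_eq0; rewrite hn_real x0. Qed.
Lemma hnZ (a : R[i]) x : hn (a *: x) = complex.Re `|a| * hn x.
Proof. by rewrite /hn normrZ hn_real -(RRe_real (normr_real a)) Re_rM. Qed.
Lemma hn_gt0 x : x != 0 -> 0 < hn x.
Proof.
by move=> x0; rewrite lt_def hn_ge0 andbT; apply: contraNneq x0 => /hn_eq0 ->.
Qed.

Lemma ip_ext x y : (forall z, ip z x = ip z y) -> x = y.
Proof.
move=> xy; apply/eqP; rewrite -subr_eq0 -(dnorm_eq0 (inner H)).
by rewrite ipBr !xy subrr.
Qed.

Definition hcvg (u : nat -> H) (l : H) : Prop :=
  forall e, 0 < e -> exists N, forall n, (N <= n)%N -> hn (u n - l) < e.

Lemma hn_cvg (u : nat -> H) :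
  (forall e, 0 < e -> exists N, forall m n, (N <= m)%N -> (N <= n)%N ->
    hn (u m - u n) < e) ->
  exists l, hcvg u l.
Proof.
move=> uc; have : cvg (u @ \oo).
  apply: cauchy_cvg; apply/cauchy_ballP => e e0.
  have er : e \is Num.real by exact: gtr0_real.
  have e1 : 0 < complex.Re e by rewrite -ltcR RRe_real.
  have [N uN] := uc _ e1.
  exists (u @` [set n | (N <= n)%N], u @` [set n | (N <= n)%N]) => /=.
    by split; exists N => // n Nn; exists n.
  move=> [_ _] [/= [m Nm <-] [n Nn <-]].
  by rewrite -ball_normE /= hn_real -(RRe_real er) ltcR uN.
move=> /cvg_ex[l /cvgrPdist_lt ul]; exists l => e e0.
have [|N _ uN] := ul e%:C%C; first by rewrite ltcR.
by exists N => n /uN /=; rewrite hn_real ltcR hnBC.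
Qed.

Lemma hn_limit_le (u : nat -> H) l K : hcvg u l ->
  (exists N, forall n, (N <= n)%N -> hn (u n) <= K) -> hn l <= K.
Proof.
move=> ul [M uK]; apply/ler_addgt0Pl => e /ul[N uN].
have := uN (maxn M N) (leq_maxr _ _); have := uK (maxn M N) (leq_maxl _ _).
have -> : l = u (maxn M N) - (u (maxn M N) - l) by rewrite subKr.
by have := hnB (u (maxn M N)) (u (maxn M N) - l); rewrite subKr; lra.
Qed.

(** The adjoint relation survives pointwise limits; this is what gives the limit operator an adjoint
    in [bnorm_complete]. *)
Lemma rip_limit (u v : nat -> H) x y h k : hcvg u x -> hcvg v y ->
  (forall n, rip (u n) k = rip h (v n)) -> rip x k = rip h y.
Proof.
move=> ux vy uv; apply/eqP; rewrite -subr_eq0 -normr_le0.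
apply/ler_addgt0Pl => e e0; rewrite addr0.
set M := hn k + hn h + 1.
have M0 : 0 < M by rewrite /M; have := hn_ge0 k; have := hn_ge0 h; lra.
have [N1 uN] := ux (e / M) ltac:(by rewrite divr_gt0).
have [N2 vN] := vy (e / M) ltac:(by rewrite divr_gt0).
pose n := maxn N1 N2.
have un := uN n (leq_maxl _ _); have vn := vN n (leq_maxr _ _).
have ripN z w : rip (- z) w = - rip z w.
  by have := ripZl (-1) z w; rewrite rmorphN1 scaleN1r mulN1r.
have aE : rip x k - rip h y = rip (x - u n) k + rip (v n - y) h.
  by rewrite !ripDl !ripN (ripC (v n)) (ripC y) uv; ring.
have bE : - (rip x k - rip h y) = rip (u n - x) k + rip (y - v n) h.
  by rewrite !ripDl !ripN (ripC (v n)) (ripC y) uv; ring.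
have le : hn (u n - x) * hn k + hn (v n - y) * hn h <= e.
  rewrite ltr_pdivlMr// in un; rewrite ltr_pdivlMr// in vn.
  rewrite /M in un vn.
  have := hn_ge0 k; have := hn_ge0 h.
  have := hn_ge0 (u n - x); have := hn_ge0 (v n - y).
  move: (hn (u n - x)) (hn (v n - y)) (hn h) (hn k) un vn => a b c d; nra.
rewrite ler_norml; apply/andP; split.
  rewrite lerNl bE (le_trans _ le)// lerD// (le_trans (rip_CS _ _))//.
  by rewrite (hnBC y).
by rewrite aE (le_trans _ le)// lerD// (le_trans (rip_CS _ _))// (hnBC x).
Qed.

End HilbertNorm.

Section OperatorNorm.
Context {R : realType} {H : hilbert R}.
Variable T : H -> H.
Hypothesis TZ : forall (a : R[i]) h, T (a *: h) = a *: T h.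

Let T0 : T 0 = 0.
Proof. by rewrite -(scale0r 0) TZ !scale0r. Qed.

Let unit_ball (h : H) : (`|h| <= 1) = (hn h <= 1).
Proof. by rewrite hn_real -[1 in LHS]/((1 : R)%:C%C) lecR. Qed.

Lemma opnorm_le (M : R) : 0 <= M -> (forall h : H, hn (T h) <= M * hn h) -> opnorm T <= M.
Proof.
move=> M0 TM; apply: ge_sup.
  by exists 0, 0 => /=; rewrite ?normr0 ?ler01// T0 normr0.
move=> _ [h /= h1 <-]; apply: le_trans (TM h) _.
by rewrite unit_ball in h1; rewrite ler_piMr.
Qed.

Variable M : R.
Hypothesis TM : forall h : H, hn (T h) <= M * hn h.

Let T_has_sup : has_sup [set complex.Re `|T h| | h in [set h : H | `|h| <= 1]].
Proof.
split; first by exists 0, 0 => /=; rewrite ?normr0 ?ler01// T0 normr0.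
exists `|M| => _ [h /= h1 <-]; apply: le_trans (TM h) _.
rewrite unit_ball in h1; apply: le_trans (ler_norm _) _.
by rewrite normrM (ger0_norm (hn_ge0 h)) ler_piMr.
Qed.

Lemma opnorm_ge0 : 0 <= opnorm T.
Proof.
by apply: (ub_le_sup (proj2 T_has_sup)); exists 0; rewrite /= ?normr0 ?ler01// T0 normr0.
Qed.

Lemma opnorm_ub h : hn (T h) <= opnorm T * hn h.
Proof.
have [->|h0] := eqVneq h 0; first by rewrite T0 hn0 mulr0.
have hp := hn_gt0 h0.
rewrite -ler_pdivrMr// mulrC.
have c0 : 0 <= (hn h)^-1 by rewrite invr_ge0 ltW.
have cE k : (hn h)^-1 * hn k = hn ((hn h)^-1%:C%C *: k).
  by rewrite hnZ Re_normC_real ger0_norm.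
rewrite cE -TZ; apply: (ub_le_sup (proj2 T_has_sup)).
exists ((hn h)^-1%:C%C *: h) => //=.
by rewrite unit_ball -cE mulVf ?gt_eqF.
Qed.

End OperatorNorm.

Section Adjointable.
Context {R : realType} {H : hilbert R}.
Local Notation ip := (inner H).

(** The adjoint is part of the condition, so no representation theorem enters; linearity follows
    from it ([bopZh], [bopDh]). *)
Definition adjointable (T : H -> H) : Prop := exists (T' : H -> H) (M : R),
  (forall h k, ip (T h) k = ip h (T' k)) /\ forall h : H, hn (T h) <= M * hn h.

Definition adjointable_pred : {pred (H -> H)} := fun T => `[< adjointable T >].

Fact adjointable_submod : submod_closed adjointable_pred.
Proof.
split=> [|a T S /asboolP[T' [M [TT TM]]] /asboolP[S' [K [SS SK]]]].
  apply/asboolP; exists (fun=> 0), 0; split=> [h k|h].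
    by rewrite linear0l linear0r.
  by rewrite hn0 mul0r.
apply/asboolP; exists (fun h => a^* *: T' h + S' h), (complex.Re `|a| * M + K).
split=> [h k|h]; rewrite [(_ + _) _]/(a *: T h + S h).
  by rewrite ipDl ipDr ipZl ipZr TT SS conjCK.
apply: le_trans (hnD _ _) _; rewrite hnZ mulrDl lerD// -mulrA ler_wpM2l//.
by rewrite -ler0c RRe_real ?normr_ge0// ger0_real.
Qed.

HB.instance Definition _ := GRing.isSubmodClosed.Build R[i] (H -> H) adjointable_pred
  (GRing.submod_closed_semi adjointable_submod).

End Adjointable.

(* The operators with a bounded adjoint. The nonzero vector makes the identity
   differ from zero, as [algType] requires. *)
Record bop (R : realType) (H : hilbert R) (h0 : H) (h0n : h0 != 0) :=
  Bop { bfun :> H -> H; bopP : bfun \in @adjointable_pred R H }.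

Section BopModule.
Context {R : realType} {H : hilbert R} {h0 : H} {h0n : h0 != 0}.
Local Notation bop := (bop h0n).

HB.instance Definition _ := [isSub for @bfun R H h0 h0n].
HB.instance Definition _ := [Choice of bop by <:].
HB.instance Definition _ := [SubChoice_isSubLmodule of bop by <:].

End BopModule.

Section BopRing.
Context {R : realType} {H : hilbert R} {h0 : H} {h0n : h0 != 0}.
Local Notation bop := (bop h0n).
Local Notation ip := (inner H).
Implicit Types (S T : bop) (h k : H) (a : R[i]).

(** Multiplying the left argument by [- 'i] turns the imaginary part of the inner product into a
    real part. *)
Lemma ip_eq_rip (x y z w : H) : rip x y = rip z w ->
  rip (- 'i *: x) y = rip (- 'i *: z) w -> ip x y = ip z w.
Proof.
rewrite /rip !ipZl -complexiE.
case: (ip x y) => a b; case: (ip z w) => c d /= -> /eqP.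
by rewrite !oppr0 !mul0r !sub0r !mulN1r !opprK => /eqP ->.
Qed.

Lemma bop_ext S T : (forall h, S h = T h) -> S = T.
Proof. by move=> ST; apply/val_inj/funext. Qed.

Lemma bop_adj T : exists T' : H -> H, forall h k, ip (T h) k = ip h (T' k).
Proof. by have /asboolP[T' [M [TT _]]] := bopP T; exists T'. Qed.

Definition badj T : H -> H := sval (cid (bop_adj T)).

Lemma badjP T h k : ip (T h) k = ip h (badj T k).
Proof. exact: (svalP (cid (bop_adj T))). Qed.

Lemma badjP' T h k : ip (badj T h) k = ip h (T k).
Proof. by rewrite ipC -badjP -ipC. Qed.

Lemma bopZh T a h : T (a *: h) = a *: T h.
Proof. by apply: ip_ext => z; rewrite -badjP' ipZr badjP' -ipZr. Qed.

Lemma bopDh T h k : T (h + k) = T h + T k.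
Proof. by apply: ip_ext => z; rewrite -badjP' ipDr !badjP' -ipDr. Qed.

Lemma bop0h T : T 0 = 0. Proof. by rewrite -(scale0r 0) bopZh !scale0r. Qed.

Lemma bopD S T h : (S + T) h = S h + T h.
Proof. by rewrite -[bfun (S + T)]/(val (S + T)) raddfD. Qed.
Lemma bopN T h : (- T) h = - T h.
Proof. by rewrite -[bfun (- T)]/(val (- T)) raddfN. Qed.
Lemma bopB S T h : (S - T) h = S h - T h.
Proof. by rewrite bopD bopN. Qed.
Lemma bopZ a T h : (a *: T) h = a *: T h.
Proof. by rewrite -[bfun (a *: T)]/(val (a *: T)) linearZ. Qed.
Lemma bop0 h : (0 : bop) h = 0.
Proof. by rewrite -(scale0r 0) bopZ scale0r. Qed.

Definition bnorm T : R := opnorm T.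

Lemma bop_bounded T : exists M, forall h, hn (T h) <= M * hn h.
Proof. by have /asboolP[T' [M [_ TM]]] := bopP T; exists M. Qed.

Lemma bnorm_ge0 T : 0 <= bnorm T.
Proof. by have [M] := bop_bounded T; apply: opnorm_ge0; exact: bopZh. Qed.

Lemma bnorm_ub T h : hn (T h) <= bnorm T * hn h.
Proof. by have [M TM] := bop_bounded T; apply: opnorm_ub TM _; exact: bopZh. Qed.

Lemma bnorm_le T M : 0 <= M -> (forall h, hn (T h) <= M * hn h) -> bnorm T <= M.
Proof. exact/opnorm_le/bopZh. Qed.

Lemma badj_ub T h : hn (badj T h) <= bnorm T * hn h.
Proof.
have [->|k0] := eqVneq (badj T h) 0.
  by rewrite hn0 mulr_ge0 ?bnorm_ge0 ?hn_ge0.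
rewrite -(ler_pM2r (hn_gt0 k0)) -expr2 -ripE /rip badjP' -/(rip _ _).
apply: le_trans (rip_CS _ _) _; rewrite mulrC mulrAC ler_wpM2r ?hn_ge0//.
exact: bnorm_ub.
Qed.

Fact bop1_subproof : (fun h : H => h) \in @adjointable_pred R H.
Proof. by apply/asboolP; exists (fun h => h), 1; split=> // h; rewrite mul1r. Qed.
Definition bop1 : bop := Bop h0n bop1_subproof.

Fact bop_mul_subproof S T : (fun h => S (T h)) \in @adjointable_pred R H.
Proof.
apply/asboolP; exists (fun h => badj T (badj S h)), (bnorm S * bnorm T).
split=> [h k|h]; first by rewrite !badjP.
apply: le_trans (bnorm_ub _ _) _; rewrite -mulrA ler_wpM2l ?bnorm_ge0//.
exact: bnorm_ub.
Qed.
Definition bop_mul S T : bop := Bop h0n (bop_mul_subproof S T).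

Fact bop_mulA : associative bop_mul.
Proof. by move=> *; apply: bop_ext. Qed.
Fact bop_mul1l : left_id bop1 bop_mul.
Proof. by move=> *; apply: bop_ext. Qed.
Fact bop_mul1r : right_id bop1 bop_mul.
Proof. by move=> *; apply: bop_ext. Qed.
Fact bop_mulDl : left_distributive bop_mul +%R.
Proof. by move=> S T U; apply: bop_ext => h; exact: bopD. Qed.
Fact bop_mulDr : right_distributive bop_mul +%R.
Proof.
move=> S T U; apply: bop_ext => h; rewrite bopD.
by rewrite -[LHS]/(S ((T + U) h)) bopD bopDh.
Qed.
Fact bop_oner_neq0 : bop1 != 0.
Proof.
apply/eqP => /(congr1 (fun T : bop => T h0)); rewrite bop0 => /eqP.
by rewrite -[bop1 h0]/h0 (negbTE h0n).
Qed.

HB.instance Definition _ := GRing.Zmodule_isNzRing.Build bop bop_mulA bop_mul1l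
  bop_mul1r bop_mulDl bop_mulDr bop_oner_neq0.

Lemma bopM S T h : (S * T) h = S (T h). Proof. by []. Qed.
Lemma bop1h h : (1 : bop) h = h. Proof. by []. Qed.

Fact bop_scaleAl a S T : a *: (S * T) = a *: S * T.
Proof. by apply: bop_ext => h; rewrite bopZ !bopM bopZ. Qed.
HB.instance Definition _ :=
  GRing.LSemiModule_isLSemiAlgebra.Build R[i] bop bop_scaleAl.
Fact bop_scaleAr a S T : a *: (S * T) = S * (a *: T).
Proof. by apply: bop_ext => h; rewrite bopZ !bopM bopZ bopZh. Qed.
HB.instance Definition _ := GRing.LSemiAlgebra_isSemiAlgebra.Build R[i] bop bop_scaleAr.

Fact bop_star_subproof T : badj T \in @adjointable_pred R H.
Proof.
apply/asboolP; exists T, (bnorm T); split=> [h k|h]; first exact: badjP'.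
exact: badj_ub.
Qed.
Definition bop_star T : bop := Bop h0n (bop_star_subproof T).

Lemma bop_star_unique T S : (forall h k, ip (T h) k = ip h (S k)) -> bop_star T = S.
Proof.
by move=> TS; apply: bop_ext => k; apply: ip_ext => h; rewrite -TS /= -badjP.
Qed.

Lemma bop_starP T h k : ip (T h) k = ip h (bop_star T k).
Proof. exact: badjP. Qed.

Fact bop_starK : involutive bop_star.
Proof. by move=> T; apply: bop_star_unique => h k; rewrite badjP'. Qed.
Fact bop_starD : {morph bop_star : x y / x + y}.
Proof.
by move=> S T; apply: bop_star_unique => h k; rewrite !bopD ipDl ipDr !bop_starP.
Qed.
Fact bop_starZ a T : bop_star (a *: T) = a^* *: bop_star T.
Proof.
by apply: bop_star_unique => h k; rewrite !bopZ ipZl ipZr conjCK bop_starP.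
Qed.
Fact bop_starM S T : bop_star (S * T) = bop_star T * bop_star S.
Proof. by apply: bop_star_unique => h k; rewrite !bopM !bop_starP. Qed.

Fact bnorm_eq0 T : bnorm T = 0 -> T = 0.
Proof.
move=> T0; apply: bop_ext => h; rewrite bop0; apply: hn_eq0; apply/eqP.
by rewrite eq_le hn_ge0 andbT -(mul0r (hn h)) -T0 bnorm_ub.
Qed.

Fact bnormD S T : bnorm (S + T) <= bnorm S + bnorm T.
Proof.
apply: bnorm_le => [|h]; first by rewrite addr_ge0 ?bnorm_ge0.
by rewrite bopD mulrDl; apply: le_trans (hnD _ _) _; rewrite lerD ?bnorm_ub.
Qed.

Lemma ReN_ge0 a : 0 <= complex.Re `|a|.
Proof. by rewrite -ler0c RRe_real// ger0_real. Qed.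

Fact bnormZ a T : bnorm (a *: T) = complex.Re `|a| * bnorm T.
Proof.
have le b S : bnorm (b *: S) <= complex.Re `|b| * bnorm S.
  apply: bnorm_le => [|h]; first by rewrite mulr_ge0 ?bnorm_ge0 ?ReN_ge0.
  by rewrite bopZ hnZ -mulrA ler_wpM2l ?ReN_ge0 ?bnorm_ub.
apply/eqP; rewrite eq_le le andTb.
have [->|a0] := eqVneq a 0; first by rewrite normr0 mul0r bnorm_ge0.
have n0 : 0 < complex.Re `|a| by rewrite -ltcR RRe_real ?normr_gt0// ger0_real.
rewrite -ler_pdivlMl//; have := le a^-1 (a *: T).
rewrite scalerA mulVf// scale1r; congr (_ <= _ * _).
by apply: complexI; rewrite fmorphV !RRe_real ?ger0_real// normfV.
Qed.

Fact bnormM S T : bnorm (S * T) <= bnorm S * bnorm T.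
Proof.
apply: bnorm_le => [|h]; first by rewrite mulr_ge0 ?bnorm_ge0.
by rewrite bopM -mulrA (le_trans (bnorm_ub _ _))// ler_wpM2l ?bnorm_ge0 ?bnorm_ub.
Qed.

Fact bnorm_star T : bnorm (bop_star T * T) = bnorm T ^+ 2.
Proof.
apply/eqP; rewrite eq_le; apply/andP; split.
  apply: le_trans (bnormM _ _) _; rewrite expr2 ler_wpM2r ?bnorm_ge0//.
  by apply: bnorm_le => [|h]; [exact: bnorm_ge0 | exact: badj_ub].
rewrite -(sqr_sqrtr (bnorm_ge0 (bop_star T * T))).
rewrite ler_pXn2r ?nnegrE ?bnorm_ge0 ?sqrtr_ge0//.
apply: bnorm_le => [|h]; first exact: sqrtr_ge0.
rewrite -(ler_pXn2r (n := 2)) ?nnegrE ?mulr_ge0 ?hn_ge0 ?sqrtr_ge0//.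
rewrite exprMn sqr_sqrtr ?bnorm_ge0// -ripE /rip bop_starP -/(rip _ _).
rewrite ripC expr2 mulrA; apply: le_trans (rip_CS _ _) _.
by rewrite ler_wpM2r ?hn_ge0//; exact: (bnorm_ub (bop_star T * T)).
Qed.

(** The operators and their adjoints are both Cauchy, hence converge pointwise. The limit of the
    adjoints is an adjoint of the limit, by [rip_limit] applied to [u n] and to [- 'i *: u n]. *)
Fact bnorm_complete : norm_complete bnorm.
Proof.
move=> u uc.
have ptc h : exists l, hcvg (fun n => u n h) l.
  apply: hn_cvg => e e0.
  have h1 : 0 < hn h + 1 by have := hn_ge0 h; lra.
  have [N uN] := uc (e / (hn h + 1)) ltac:(by rewrite divr_gt0).
  exists N => m n Nm Nn; have := uN m n Nm Nn; rewrite ltr_pdivlMr// -bopB.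
  have := bnorm_ub (u m - u n) h; have := bnorm_ge0 (u m - u n).
  have := hn_ge0 h; nra.
have ptc' h : exists l, hcvg (fun n => bop_star (u n) h) l.
  apply: hn_cvg => e e0.
  have h1 : 0 < hn h + 1 by have := hn_ge0 h; lra.
  have [N uN] := uc (e / (hn h + 1)) ltac:(by rewrite divr_gt0).
  exists N => m n Nm Nn; have := uN m n Nm Nn; rewrite ltr_pdivlMr// -bopB.
  have -> : bop_star (u m) - bop_star (u n) = bop_star (u m - u n).
    by rewrite bop_starD -[- u n]scaleN1r bop_starZ rmorphN1 scaleN1r.
  have := badj_ub (u m - u n) h; have := bnorm_ge0 (u m - u n).
  rewrite -[badj _ h]/(bop_star (u m - u n) h); have := hn_ge0 h; nra.
pose T h := sval (cid (ptc h)); pose T' h := sval (cid (ptc' h)).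
have uT h : hcvg (fun n => u n h) (T h) := svalP (cid (ptc h)).
have uT' h : hcvg (fun n => bop_star (u n) h) (T' h) := svalP (cid (ptc' h)).
have ripT h k : rip (T h) k = rip h (T' k).
  by apply: rip_limit (uT h) (uT' k) _ => n; rewrite /rip bop_starP.
have TT' h k : ip (T h) k = ip h (T' k).
  apply: ip_eq_rip => //.
  apply: (rip_limit (u := fun n => - 'i *: u n h) (v := fun n => bop_star (u n) k)) => //.
    move=> e /(uT h)[N uN]; exists N => n /uN; rewrite -scalerBr.
    by rewrite hnZ normrN -complexiE normc_def /= expr0n expr1n add0r sqrtr1 mul1r.
  by move=> n; rewrite -bopZh /rip bop_starP.
have uTe e : 0 < e -> exists N, forall n, (N <= n)%N ->
    forall h, hn (T h - u n h) <= e * hn h.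
  move=> /uc[N uN]; exists N => n Nn h.
  apply: (hn_limit_le (u := fun m => u m h - u n h)).
    move=> d /(uT h)[M uM]; exists M => m /uM.
    by rewrite opprB addrA subrK.
  exists N => m Nm; rewrite -bopB; apply: le_trans (bnorm_ub _ _) _.
  by rewrite ler_wpM2r ?hn_ge0// ltW// uN.
have Tadj : T \in @adjointable_pred R H.
  apply/asboolP; exists T'; have [N /(_ N (leqnn N)) uN] := uTe 1 ltr01.
  exists (1 + bnorm (u N)); split=> // h.
  rewrite -[T h](subrK (u N h)) mulrDl; apply: le_trans (hnD _ _) _.
  by rewrite lerD ?bnorm_ub.
exists (Bop h0n Tadj); apply/(norm_cvgP bnorm_ge0) => e e0.
have [N uN] := uTe (e / 2) ltac:(by rewrite divr_gt0).
exists N => n Nn; apply: (@le_lt_trans _ _ (e / 2)); last by lra.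
apply: bnorm_le => [|h]; first by rewrite divr_ge0// ltW.
by rewrite bopB hnBC; exact: uN.
Qed.

HB.instance Definition _ := Algebra_isCStar.Build R bop bop_starK bop_starD bop_starZ
  bop_starM bnorm_eq0 bnormD bnormZ bnormM bnorm_star bnorm_complete.

End BopRing.


(** * Positive matrices over a C*-algebra *)

Lemma le_double_sum (R : numDomainType) n (F : 'I_n -> 'I_n -> R) i j :
  (forall i j, 0 <= F i j) -> F i j <= \sum_i \sum_j F i j.
Proof.
move=> F0; rewrite (bigD1 i)//= (bigD1 j)//= -addrA lerDl addr_ge0//.
  exact: sumr_ge0.
by apply: sumr_ge0 => ? _; exact: sumr_ge0.
Qed.

Section MatrixCone.
Context {R : realType} {A : cstarType R}.
Local Notation N := (@cnorm R A).

Lemma psdZ0 (t : R) (x : A) : 0 <= t -> psd x -> psd (rsc t * x).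
Proof.
rewrite le_eqVlt => /predU1P[<- _|t0]; last exact: psdZ.
by rewrite /rsc scale0r mul0r; exact: psd0.
Qed.

Lemma psd_conj (x y : A) : psd x -> psd (star y * x * y).
Proof.
move=> /psd_sqrt[z [/psd_sa sz <- _]].
have -> : star y * (z * z) * y = star (z * y) * (z * y) by rewrite starM sz; ncring.
exact: psd_starM.
Qed.

Lemma psd_starM_le (x : A) : psd (rsc (N x ^+ 2) - star x * x).
Proof.
have [->|x0] := eqVneq x 0.
  by rewrite cnorm0 expr0n mulr0 subr0 /rsc scale0r; exact: psd0.
apply: psd_subr; [by rewrite exprn_gt0 ?cnorm_gt0 | exact: sa_starM |].
by rewrite cnorm_star.
Qed.

Lemma psd_sum (I : finType) (P : pred I) (F : I -> A) :
  (forall i, P i -> psd (F i)) -> psd (\sum_(i | P i) F i).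
Proof.
move=> FP; elim/big_ind: _ => //; [exact: psd0 | exact: psdD].
Qed.

Definition mstar {m p} (X : 'M[A]_(m, p)) : 'M[A]_(p, m) := (map_mx star X)^T.

Lemma star_sum (I : finType) (F : I -> A) : star (\sum_i F i) = \sum_i star (F i).
Proof. exact: (big_morph star (@starD _ _) star0). Qed.

Lemma mstarK m p (X : 'M[A]_(m, p)) : mstar (mstar X) = X.
Proof. by apply/matrixP => i j; rewrite !mxE starK. Qed.
Lemma mstarM m p q (X : 'M[A]_(m, p)) (Y : 'M[A]_(p, q)) :
  mstar (X *m Y) = mstar Y *m mstar X.
Proof.
apply/matrixP => i j; rewrite !mxE star_sum.
by apply: eq_bigr => k _; rewrite !mxE starM.
Qed.
Lemma mstarD m p (X Y : 'M[A]_(m, p)) : mstar (X + Y) = mstar X + mstar Y.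
Proof. by apply/matrixP => i j; rewrite !mxE starD. Qed.
Lemma mstarN m p (X : 'M[A]_(m, p)) : mstar (- X) = - mstar X.
Proof. by apply/matrixP => i j; rewrite !mxE starN. Qed.
Lemma mstar_rsc m p (t : R) (X : 'M[A]_(m, p)) : mstar (rsc t *: X) = rsc t *: mstar X.
Proof. by apply/matrixP => i j; rewrite !mxE starM star_rsc -rscC. Qed.
Lemma mstar1 n : mstar (1%:M : 'M[A]_n) = 1%:M.
Proof.
by apply/matrixP => i j; rewrite !mxE eq_sym; case: eqP; rewrite ?star1 ?star0.
Qed.

Lemma mulmx_rscr m p q (t : R) (X : 'M[A]_(m, p)) (Y : 'M[A]_(p, q)) :
  X *m (rsc t *: Y) = rsc t *: (X *m Y).
Proof.
apply/matrixP => i j; rewrite !mxE mulr_sumr; apply: eq_bigr => k _.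
by rewrite mxE mulrA -rscC mulrA.
Qed.

Section Forms.
Variable n : nat.
Implicit Types (a b c : 'cV[A]_n) (X Y : 'M[A]_n) (t : R).

(** The [A]-valued inner product of the Hilbert module [A^n], conjugate linear on the left. By
    [mform_square] and [square_mform] it describes the cones of [cstar_mos A]. *)
Definition mform a b : A := (mstar a *m b) 0 0.

Lemma mformE a b : mform a b = \sum_i star (a i 0) * b i 0.
Proof. by rewrite /mform mxE; apply: eq_bigr => i _; rewrite !mxE. Qed.

Lemma mformDl a b c : mform (a + b) c = mform a c + mform b c.
Proof. by rewrite /mform mstarD mulmxDl mxE. Qed.
Lemma mformDr a b c : mform a (b + c) = mform a b + mform a c.
Proof. by rewrite /mform mulmxDr mxE. Qed.
Lemma mformNl a b : mform (- a) b = - mform a b.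
Proof. by rewrite /mform mstarN mulNmx mxE. Qed.
Lemma mformNr a b : mform a (- b) = - mform a b.
Proof. by rewrite /mform mulmxN mxE. Qed.
Lemma mformZl t a b : mform (rsc t *: a) b = rsc t * mform a b.
Proof. by rewrite /mform mstar_rsc -scalemxAl mxE. Qed.
Lemma mformZr t a b : mform a (rsc t *: b) = rsc t * mform a b.
Proof. by rewrite /mform mulmx_rscr mxE. Qed.
Lemma mform_adj X a b : mform (X *m a) b = mform a (mstar X *m b).
Proof. by rewrite /mform mstarM mulmxA. Qed.

Lemma mform_ge0 a : psd (mform a a).
Proof. by rewrite mformE; apply: psd_sum => i _; exact: psd_starM. Qed.

Lemma mform_entry a i : psd (mform a a - star (a i 0) * a i 0).
Proof.
rewrite mformE (bigD1 i)//= addrC addrK; apply: psd_sum => j _.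
exact: psd_starM.
Qed.

Lemma cnorm_entry a i : N (a i 0) ^+ 2 <= N (mform a a).
Proof.
rewrite -cnorm_star; apply: psd_norm_mono; first exact: psd_starM.
  exact: psd_sa (mform_ge0 a).
exact: mform_entry.
Qed.

Lemma mform_eq0 a : mform a a = 0 -> a = 0.
Proof.
move=> a0; apply/colP => i; rewrite mxE; apply: cnorm_eq0; apply/eqP.
rewrite -sqrf_eq0 eq_le sqr_ge0 andbT.
by have := cnorm_entry a i; rewrite a0 cnorm0.
Qed.

(* [X] has norm at most [s] as an operator on the Hilbert module [A^n]. *)
Definition mbd X (s : R) : Prop :=
  0 <= s /\ forall a, psd (rsc (s ^+ 2) * mform a a - mform (X *m a) (X *m a)).

Lemma mbd_ge0 X s : mbd X s -> 0 <= s. Proof. by case. Qed.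

Lemma mbd_le X s t : mbd X s -> s <= t -> mbd X t.
Proof.
move=> [s0 Xs] st; split=> [|a]; first exact: le_trans st.
have -> : rsc (t ^+ 2) * mform a a - mform (X *m a) (X *m a) =
    rsc (t ^+ 2 - s ^+ 2) * mform a a
    + (rsc (s ^+ 2) * mform a a - mform (X *m a) (X *m a)).
  by rewrite addrA -mulrDl -rscD subrK.
apply: psdD => //; apply: psdZ0; last exact: mform_ge0.
by rewrite subr_ge0 ler_pXn2r// nnegrE (le_trans s0).
Qed.

Lemma mbd0 : mbd 0 0.
Proof.
split=> // a; rewrite mul0mx (_ : mform 0 0 = 0) ?subr0; last first.
  by rewrite /mform mulmx0 mxE.
by apply: psdZ0 (mform_ge0 a); rewrite sqr_ge0.
Qed.

Lemma mbdN X s : mbd X s -> mbd (- X) s.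
Proof.
by move=> [s0 Xs]; split=> // a; rewrite mulNmx mformNl mformNr opprK.
Qed.

Lemma mbd_eq0 X a : mbd X 0 -> X *m a = 0.
Proof.
move=> [_ /(_ a)]; rewrite expr0n /rsc scale0r mul0r sub0r => X0.
by apply: mform_eq0; apply: psd_anti X0; exact: mform_ge0.
Qed.

(** [|X a + Y a|^2] is [(1 + t/s) |X a|^2 + (1 + s/t) |Y a|^2] minus the positive
    [(t/s) |X a - (s/t) Y a|^2], and [(1 + t/s) s^2 + (1 + s/t) t^2 = (s + t)^2]. Zero bounds are
    set apart because of the divisions. *)
Lemma mbdD X Y s t : mbd X s -> mbd Y t -> mbd (X + Y) (s + t).
Proof.
move=> Xs Yt; have s0 := mbd_ge0 Xs; have t0 := mbd_ge0 Yt.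
split=> [|a]; first exact: addr_ge0.
rewrite mulmxDl.
have [s00|sn0] := eqVneq s 0.
  move: Xs; rewrite s00 => /(mbd_eq0 (X := X)) ->.
  by rewrite !add0r; have [_] := Yt.
have [t00|tn0] := eqVneq t 0.
  move: Yt; rewrite t00 => /(mbd_eq0 (X := Y)) ->.
  by rewrite !addr0; have [_] := Xs.
have sp : 0 < s by rewrite lt_def sn0.
have tp : 0 < t by rewrite lt_def tn0.
have [_ /(_ a) Xa] := Xs; have [_ /(_ a) Ya] := Yt.
have st0 : 0 < 1 + t / s by rewrite addr_gt0// divr_gt0.
have ts0 : 0 < 1 + s / t by rewrite addr_gt0// divr_gt0.
have := psdD (psdD (psdZ st0 Xa) (psdZ ts0 Ya))
  (psdZ (divr_gt0 tp sp) (mform_ge0 (X *m a - rsc (s / t) *: (Y *m a)))).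
congr psd; rewrite -scaleNr !(mformDl, mformDr).
have -> : - (rsc (s / t)) = rsc (- (s / t)) :> A by rewrite /rsc rmorphN scaleNr.
rewrite !(mformZl, mformZr).
move: (mform a a) (mform (X *m a) (X *m a)) (mform (X *m a) (Y *m a))
  (mform (Y *m a) (X *m a)) (mform (Y *m a) (Y *m a)) => g x xy yx y.
rewrite !mulrDr !mulrN !mulrA -!rscM.
have -> : (1 + t / s) * s ^+ 2 = s ^+ 2 + s * t by field.
have -> : (1 + s / t) * t ^+ 2 = t ^+ 2 + s * t by field; rewrite ?sn0 ?tn0.
have -> : t / s * - (s / t) = -1 by field; rewrite ?sn0 ?tn0.
have -> : - 1 * - (s / t) = s / t by rewrite mulN1r opprK.
have -> : (s + t) ^+ 2 = s ^+ 2 + t ^+ 2 + s * t + s * t by ring.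
have -> : rsc (-1) = -1 :> A by rewrite /rsc rmorphN1 scaleN1r.
by rewrite !rscD rsc1; ncring.
Qed.

Lemma mbdM X Y s t : mbd X s -> mbd Y t -> mbd (X *m Y) (s * t).
Proof.
move=> [s0 Xs] [t0 Yt]; split=> [|a]; first exact: mulr_ge0.
have := psdD (psdZ0 (sqr_ge0 s) (Yt a)) (Xs (Y *m a)).
congr psd; rewrite -mulmxA mulrBr mulrA -rscM -exprMn.
by rewrite addrA subrK.
Qed.

Lemma mbd_rsc X s t : mbd X s -> mbd (rsc t *: X) (`|t| * s).
Proof.
move=> [s0 Xs]; split=> [|a]; first exact: mulr_ge0.
have := psdZ0 (sqr_ge0 t) (Xs a); congr psd.
rewrite -scalemxAl mformZl mformZr mulrBr !mulrA -!rscM.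
by rewrite exprMn real_normK ?num_real.
Qed.

Lemma mbd_entry X s i j : mbd X s -> N (X i j) <= s.
Proof.
move=> [s0 /(_ (delta_mx j 0)) Xs].
have g1 : mform (delta_mx j 0) (delta_mx j 0) = 1.
  rewrite mformE (bigD1 j)//= !mxE !eqxx star1 mul1r big1 ?addr0// => k /negbTE kj.
  by rewrite !mxE kj mulr0.
rewrite -(ler_pXn2r (n := 2)) ?nnegrE ?cnorm_ge0//.
have <- : (X *m delta_mx j 0 : 'cV_n) i 0 = X i j by rewrite -colE mxE.
apply: le_trans (cnorm_entry _ _) _.
rewrite g1 mulr1 in Xs; rewrite -[leRHS]ger0_norm ?sqr_ge0// -(cnorm_rsc (A := A)).
by apply: psd_norm_mono => //; [exact: mform_ge0 | exact: sa_rsc].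
Qed.

Lemma mbd_delta (x : A) i j : mbd (x *: delta_mx i j) (N x).
Proof.
split=> [|a]; first exact: cnorm_ge0.
have -> : mform (x *: delta_mx i j *m a) (x *: delta_mx i j *m a)
    = star (a j 0) * (star x * x) * a j 0.
  have E k : (x *: delta_mx i j *m a) k 0 = if k == i then x * a j 0 else 0.
    rewrite mxE (bigD1 j)//= !mxE eqxx andbT big1 => [|l /negbTE lj].
      by case: eqP; rewrite ?mulr1 ?mulr0 ?mul0r addr0.
    by rewrite !mxE lj andbF mulr0 mul0r.
  rewrite mformE (bigD1 i)//= E eqxx big1 => [|k /negbTE ki]; last first.
    by rewrite E ki mulr0.
  by rewrite addr0 starM; ncring.
have -> : rsc (N x ^+ 2) * mform a a - star (a j 0) * (star x * x) * a j 0
    = rsc (N x ^+ 2) * (mform a a - star (a j 0) * a j 0)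
      + star (a j 0) * (rsc (N x ^+ 2) - star x * x) * a j 0.
  rewrite !(mulrBr, mulrBl) -(rscC _ (star (a j 0))) mulrA; ncring.
apply: psdD; first by apply: psdZ0 (mform_entry _ _); exact: sqr_ge0.
exact/psd_conj/psd_starM_le.
Qed.

Lemma mbd_sum X : mbd X (\sum_i \sum_j N (X i j)).
Proof.
rewrite {1}(matrix_sum_delta X).
elim/big_ind2: _ => [||i _]; [exact: mbd0 | by move=> *; exact: mbdD|].
elim/big_ind2: _ => [||j _]; [exact: mbd0 | by move=> *; exact: mbdD|].
exact: mbd_delta.
Qed.

(** [mbd_entry] makes the entries converge, and [mbd_sum] turns entrywise convergence back into
    convergence for [mbd]. *)
Lemma mbd_complete (u : nat -> 'M[A]_n) (c : nat -> R) M :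
  (forall m, mbd (u m.+1 - u m) (c m.+1 - c m)) -> (forall m, c m <= c m.+1) ->
  (forall m, c m <= M) -> exists l, bd_cvg mbd u l.
Proof.
move=> uc c_incr cM.
have ent i j : exists l, cvg_bd (fun m => u m i j) l.
  apply: telescope_cvg c_incr cM => m.
  by have := mbd_entry i j (uc m); rewrite !mxE.
exists (\matrix_(i, j) sval (cid (ent i j))) => e e0.
(* The successor keeps the denominator nonzero for [n = 0]; [n * n] terms still sum to at most
   [e]. *)
pose d := e / (n * n).+1%:R.
have d0 : 0 < d by rewrite divr_gt0.
have dN i j := svalP (cid (ent i j)) d d0.
pose K := \max_i \max_j sval (cid (dN i j)).
exists K => m Km; apply: mbd_le (mbd_sum _) _.
apply: (@le_trans _ _ (\sum_(i < n) \sum_(j < n) d)).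
  apply: ler_sum => i _; apply: ler_sum => j _; rewrite !mxE.
  apply: (svalP (cid (dN i j))); apply: leq_trans Km.
  by rewrite /K (leq_trans _ (leq_bigmax i))// (leq_bigmax j).
rewrite !sumr_const !card_ord -mulrnA -[leLHS]mulr_natr /d mulrAC.
rewrite ler_pdivrMr// ler_wpM2l ?(ltW e0)// ler_nat.
by rewrite leqW.
Qed.

(** The argument of [form_contraction] with values in [A]. The bound [X <= t] comes from
    [|X a|^2 <= t^2 |a|^2] and the positivity of [|X a - t a|^2]. *)
Lemma mbd_contraction X : mstar X = X -> (forall a, psd (mform a (X *m a))) ->
  exists t, 0 < t /\ mbd (1 - rsc t^-1 *: X) 1.
Proof.
move=> sX Xp; have [t t0 [_ Xt]] : exists2 t, 0 < t & mbd X t.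
  exists (\sum_i \sum_j N (X i j) + 1); last by apply: mbd_le (mbd_sum X) _; rewrite lerDl.
  by rewrite ltr_wpDl ?(mbd_ge0 (mbd_sum X)).
have tn0 := lt0r_neq0 t0.
have rN r : - rsc r = rsc (- r) :> A by rewrite /rsc rmorphN scaleNr.
have rZN r (v : 'cV[A]_n) : - (rsc r *: v) = rsc (- r) *: v.
  by rewrite -rN scaleNr.
have XC a b : mform (X *m a) b = mform a (X *m b) by rewrite mform_adj sX.
have le a : psd (rsc t * mform a a - mform a (X *m a)).
  have t20 : 0 < 2 * t by rewrite mulr_gt0.
  apply/(psdZE _ t20).
  have := psdD (Xt a) (mform_ge0 (X *m a - rsc t *: a)); congr psd.
  rewrite !rZN !(mformDl, mformDr) !(mformZl, mformZr) !(XC a) -rN.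
  rewrite -[2]/(1 + 1) mulrDl mul1r rscD expr2 rscM; ncring.
have key a : psd (mform a (X *m a) - rsc t^-1 * mform (X *m a) (X *m a)).
  set b := X *m a.
  have lb : psd (rsc t^-1 * (mform b b - rsc t^-1 * mform b (X *m b))).
    apply: psdZ; first by rewrite invr_gt0.
    have := psdZ (t := t^-1) _ (le b); rewrite invr_gt0 => /(_ t0); congr psd.
    rewrite mulrBr; congr (_ - _).
    by rewrite -{2}[t]invrK rscVK// invr_neq0.
  have := psdD (Xp (a - rsc t^-1 *: b)) lb; congr psd.
  rewrite mulmxBr mulmx_rscr !rZN !(mformDl, mformDr) !(mformZl, mformZr) -rN.
  rewrite -(XC a b) -/b; ncring.
exists t; split=> //; split=> // a; rewrite expr1n rsc1 mul1r.
have := psdD (psdZ (t := t^-1) _ (key a)) (psdZ (t := t^-1) _ (Xp a)).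
rewrite invr_gt0 => /(_ t0 t0); congr psd.
rewrite mulmxBl mul1mx -scalemxAl !rZN !(mformDl, mformDr) !(mformZl, mformZr) -rN.
by rewrite !XC; ncring.
Qed.

(** [visser_sqrt] in the ring of matrices with size [mbd], at [T = 1 - X / t]. With [square_mform]
    it characterises the squares by a condition that is visibly additive, whence [mos_posD]. *)
Lemma mform_square X : mstar X = X -> (forall a, psd (mform a (X *m a))) ->
  exists Y, X = mstar Y *m Y.
Proof.
move=> sX Xp; have [t [t0 bdT]] := mbd_contraction sX Xp.
pose half : 'M[A]_n := (rsc (1 / 2))%:M.
have halfE X' : half * X' = rsc (1 / 2) *: X' by exact: mul_scalar_mx.
have hh : half + half = 1.
  by rewrite /half -raddfD -rscD -splitr rsc1.
have bdh X' s : mbd X' s -> mbd (half * X') (s / 2).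
  move=> /(mbd_rsc (1 / 2)); rewrite halfE; congr (mbd _ _).
  by rewrite ger0_norm ?divr_ge0// mulrC mul1r.
have bdeq0 X' : (forall e, 0 < e -> mbd X' e) -> X' = 0.
  move=> Xe; apply/matrixP => i j; rewrite mxE; apply: cnorm_small => e /Xe.
  exact: mbd_entry.
have [Y [_ YY YP]] := visser_sqrt mbd_le mbd0 mbdN mbdD mbdM bdeq0 mbd_complete
  hh bdh bdT.
have sT : mstar (1 - rsc t^-1 *: X) = 1 - rsc t^-1 *: X.
  by rewrite mstarD mstarN mstar_rsc sX mstar1.
have sY : mstar Y = Y.
  apply: (YP (fun Y => mstar Y = Y)).
  - by apply/matrixP => i j; rewrite !mxE star0.
  - by move=> y sy; rewrite halfE mstar_rsc mstarD sT mstarM sy.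
  move=> v l sv vl; apply/matrixP => i j; rewrite !mxE; apply/eqP; rewrite -subr_eq0.
  apply/eqP/cnorm_small => e e0.
  have [K /(_ K (leqnn K)) vK] := vl (e / 2) ltac:(by rewrite divr_gt0).
  have vKs : star (v K j i) = v K i j.
    by have := congr1 (fun Z : 'M[A]_n => Z i j) (sv K); rewrite !mxE.
  have -> : star (l j i) - l i j = (v K i j - l i j) - star (v K j i - l j i).
    by rewrite starB vKs; ncring.
  apply: le_trans (cnormB _ _) _; rewrite cnorm_starE.
  have := mbd_entry i j vK; have := mbd_entry j i vK; rewrite !mxE; lra.
exists (rsc (Num.sqrt t) *: (1 - Y)).
rewrite mstar_rsc mstarD mstarN mstar1 sY.
have -> (Z : 'M[A]_n) s : (rsc s *: Z) *m (rsc s *: Z) = rsc (s * s) *: (Z * Z).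
  apply/matrixP => i j; rewrite !mxE mulr_sumr; apply: eq_bigr => k _.
  by rewrite !mxE rscM -!mulrA (mulrA (Z i k)) -rscC -!mulrA.
rewrite YY subKr -expr2 sqr_sqrtr 1?ltW// scalerA rscV ?gt_eqF//.
by rewrite scale1r.
Qed.

Lemma square_mform X Y : X = mstar Y *m Y ->
  mstar X = X /\ forall a, psd (mform a (X *m a)).
Proof.
move=> ->; split=> [|a]; first by rewrite mstarM mstarK.
by rewrite -mulmxA -{1}(mstarK Y) -mform_adj mstarK; exact: mform_ge0.
Qed.

Lemma mos_posD X Y : mos_pos (m := cstar_mos A) X -> mos_pos (m := cstar_mos A) Y ->
  mos_pos (m := cstar_mos A) (X + Y).
Proof.
move=> [X' /square_mform[sX Xp]] [Y' /square_mform[sY Yp]].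
apply: mform_square => [|a]; first by rewrite mstarD sX sY.
by rewrite mulmxDl mformDr; exact: psdD.
Qed.

Lemma mos_pos_rsc (t : R) : 0 <= t -> mos_pos (m := cstar_mos A) ((rsc t)%:M : 'M[A]_n).
Proof.
move=> t0; apply: mform_square => [|a].
  by rewrite -[_%:M]mulmx1 mul_scalar_mx mstar_rsc mstar1.
by rewrite mul_scalar_mx mformZr; apply: psdZ0 (mform_ge0 a).
Qed.

End Forms.
End MatrixCone.

(** * Positive matrices of operators on a Hilbert space *)

Section BopPositive.
Context {R : realType} {H : hilbert R} {h0 : H} {h0n : h0 != 0} {n : nat}.
Local Notation bop := (bop h0n).
Local Notation ip := (inner H).
Local Notation E := ('I_n -> H).
Local Notation MB := ('M[bop]_n).
Implicit Types (X Y Z : MB) (h k : E).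

Definition delta (j : 'I_n) (x : H) : E := fun i => if i == j then x else 0.

Lemma bop_sum (I : finType) (F : I -> bop) (x : H) : (\sum_i F i) x = \sum_i F i x.
Proof.
by apply: (big_morph (fun T : bop => T x) (id1 := 0) (op1 := +%R)) => [S T|];
  rewrite ?bopD ?bop0.
Qed.

(** Polarization: the form is real at [h + k] and at [h + i k], hence hermitian, and vectors
    supported at one index read off the entries. *)
Lemma opmx_pos_herm X : opmx_pos (fun i j => X i j) -> mstar X = X.
Proof.
move=> Xp; pose F h k := \sum_i \sum_j ip (X i j (h j)) (k i).
have FDl h h' k : F (h + h') k = F h k + F h' k.
  rewrite /F -big_split; apply: eq_bigr => i _; rewrite -big_split.
  by apply: eq_bigr => j _; rewrite -[(h + h') j]/(h j + h' j) bopDh ipDl.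
have FDr h k k' : F h (k + k') = F h k + F h k'.
  rewrite /F -big_split; apply: eq_bigr => i _; rewrite -big_split.
  by apply: eq_bigr => j _; rewrite -[(k + k') i]/(k i + k' i) ipDr.
have FZl a h k : F (a *: h) k = a * F h k.
  rewrite /F mulr_sumr; apply: eq_bigr => i _; rewrite mulr_sumr.
  by apply: eq_bigr => j _; rewrite -[(a *: h) j]/(a *: h j) bopZh ipZl.
have FZr a h k : F h (a *: k) = a^* * F h k.
  rewrite /F mulr_sumr; apply: eq_bigr => i _; rewrite mulr_sumr.
  by apply: eq_bigr => j _; rewrite -[(a *: k) i]/(a *: k i) ipZr.
have Fim h : complex.Im (F h h) = 0 by have := ger0_Im (Xp h).
have FC h k : F h k = (F k h)^*.
  have := Fim (h + k); have := Fim (h + 'i *: k).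
  rewrite !(FDl, FDr, FZl, FZr).
  have := Fim h; have := Fim k.
  rewrite -complexiE.
  case: (F h h) (F h k) (F k h) (F k k) => [a a'] [b b'] [c c'] [d d'] /=.
  move=> -> ->.
  rewrite !(mul0r, mul1r, mulr0, mulr1, add0r, addr0, sub0r, subr0, oppr0, mulN1r, mulNr, opprK).
  move=> e1 e2; apply/eqP; rewrite eq_complex /=.
  by apply/andP; split; apply/eqP; lra.
have Fdelta i j x y : F (delta j x) (delta i y) = ip (X i j x) y.
  rewrite /F (bigD1 i)//= [X in _ + X]big1 => [|i' /negbTE ii']; last first.
    by rewrite big1// => j' _; rewrite {2}/delta ii' linear0r.
  rewrite addr0 (bigD1 j)//= [X in _ + X]big1 => [|j' /negbTE jj']; last first.
    by rewrite /delta jj' bop0h linear0l.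
  by rewrite addr0 /delta !eqxx.
apply/matrixP => i j; rewrite !mxE; apply: bop_star_unique => x y.
by rewrite -Fdelta FC Fdelta -ipC.
Qed.

End BopPositive.

Section BopSquare.
Context {R : realType} {H : hilbert R} {h0 : H} {h0n : h0 != 0}.
Local Notation bop := (bop h0n).
Local Notation ip := (inner H).

(** [form_contraction] with [t = |T| + 1], where the 1 ensures [t > 0]; self-adjointness is the case
    of matrices of size 1. *)
Lemma bop_psd (T : bop) : (forall h, 0 <= ip (T h) h) -> psd T.
Proof.
move=> Tp; have sT : sa T.
  have /opmx_pos_herm : opmx_pos (fun i j : 'I_1 => (T%:M : 'M[bop]_1) i j).
    by move=> h; rewrite !big_ord1 mxE.
  by move=> /matrixP/(_ 0 0); rewrite !mxE.
have t0 : 0 < bnorm T + 1 by have := bnorm_ge0 T; lra.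
split=> //; exists (bnorm T + 1) => //; set t := bnorm T + 1 in t0 *.
have tn0 := lt0r_neq0 t0.
have -> : rsc t - T = rsc t * (1 - rsc t^-1 * T) by rewrite mulrBr mulr1 rscVK.
rewrite cnorm_rscM gtr0_norm// -[leRHS]mulr1 ler_pM2l//.
apply: bnorm_le => // h; rewrite mul1r !hn_sqrt; apply: ler_wsqrtr.
have -> : (1 - rsc t^-1 * T) h = h + (- t^-1)%:C%C *: T h.
  by rewrite bopB bop1h rscE bopZ rmorphN scaleNr.
apply: (form_contraction ripDl ripZl ripC rip_ge0) => //.
- exact: bopDh.
- by move=> s k; exact: bopZh.
- by move=> k k'; rewrite /rip bop_starP -[bop_star T]/(star T) sT.
move=> k; apply/andP; split.
  by rewrite -ler0c /rip RRe_real ?Tp// ger0_real ?Tp.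
apply: le_trans (rip_CS _ _) _; rewrite ripE expr2 mulrA ler_wpM2r ?hn_ge0//.
apply: le_trans (bnorm_ub _ _) _; rewrite ler_wpM2r ?hn_ge0// /t; lra.
Qed.

(** At a vector [h], [mform a (X *m a)] evaluates to the scalar form of [X] at the vectors
    [a i 0 h], so the test of [mform_square] reduces to [bop_psd]. *)
Lemma opmx_pos_square n (X : 'M[bop]_n) :
  opmx_pos (fun i j => X i j) -> mos_pos (m := cstar_mos bop) X.
Proof.
move=> Xp; have sX := opmx_pos_herm Xp.
apply: mform_square => // a; apply: bop_psd => h.
rewrite mformE bop_sum linear_sumlz.
have := Xp (fun i => a i 0 h); congr (0 <= _); apply: eq_bigr => i _.
transitivity (ip ((X *m a) i 0 h) (a i 0 h)); last exact: (esym (badjP' _ _ _)).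
by rewrite mxE bop_sum linear_sumlz; apply: eq_bigr.
Qed.

End BopSquare.

(** * Norms of operator systems and of quotients *)

Section EmbeddingNorm.
Context {R : realType} {S : mospace R} {H : hilbert R}.
Variables (Phi : S -> {linear H -> H}) (embPhi : BH_embedding Phi).
Local Notation ip := (inner H).

Lemma embedding_linear (a : R[i]) x y h : Phi (a *: x + y) h = a *: Phi x h + Phi y h.
Proof. by case: embPhi. Qed.

Lemma embedding0 h : Phi 0 h = 0.
Proof.
by have := embedding_linear (-1) 0 0 h; rewrite !scaleN1r !addNr.
Qed.

Lemma embedding_bounded x : exists M, forall h, hn (Phi x h) <= M * hn h.
Proof.
case: embPhi => /(_ x)/linear_bounded_continuous/linear_boundedP.
move=> /pinfty_ex_gt0[r r0 Pr] _ _ _ _; exists (complex.Re r) => h.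
have := Pr h; rewrite !hn_real -(RRe_real (gtr0_real r0)) -rmorphM.
by rewrite lecR.
Qed.

Let PhiZ x (a : R[i]) h : Phi x (a *: h) = a *: Phi x h.
Proof. exact: linearZ. Qed.

Lemma embedding_norm_ge0 x : 0 <= opnorm (Phi x).
Proof. by have [M] := embedding_bounded x; apply: opnorm_ge0; exact: PhiZ. Qed.

Lemma embedding_norm_ub x h : hn (Phi x h) <= opnorm (Phi x) * hn h.
Proof. by have [M PM] := embedding_bounded x; apply: opnorm_ub PM _; exact: PhiZ. Qed.

Definition norm_mx (x : S) (r : R) : 'M[S]_2 :=
  \matrix_(i, j) if i == j then r%:C%C *: mos_unit S
                 else if i == 0 then x else mos_star x.

(** The norm is read from the cone of order 2 alone, which is why it does not depend on the
    embedding and why cone arguments in the quotient yield norm estimates. *)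
Lemma embedding_norm_mx x (r : R) : 0 < r ->
  mos_pos (norm_mx x r) <-> opnorm (Phi x) <= r.
Proof.
move=> r0; case: embPhi => _ _ _ [_ PhiU] ->.
have formE (h : 'I_2 -> H) :
    \sum_i \sum_j ip (Phi (norm_mx x r i j) (h j)) (h i)
    = (r * hn (h 0) ^+ 2 + r * hn (h 1) ^+ 2 + 2 * rip (Phi x (h 1)) (h 0))%:C%C.
  have Phir k : Phi (r%:C%C *: mos_unit S) k = r%:C%C *: k.
    by rewrite -[_ *: _]addr0 embedding_linear PhiU embedding0 addr0.
  rewrite !big_ord_recl !big_ord0 !mxE /= !addr0.
  have -> : lift ord0 ord0 = 1 :> 'I_2 by exact/val_inj.
  rewrite -[ord0]/(0 : 'I_2) !Phir !ipZl !innerE -!rmorphM.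
  have -> : ip (Phi (mos_star x) (h 0)) (h 1) = (ip (Phi x (h 1)) (h 0))^*.
    by rewrite -ipC; case: embPhi => _ _ _ [].
  rewrite /rip; case: (ip _ (h 0)) => p q; apply/eqP; rewrite eq_complex /=.
  by apply/andP; split; apply/eqP; ring.
have ripNl (y z : H) : rip (- y) z = - rip y z.
  by have := ripZl (-1) y z; rewrite rmorphN1 scaleN1r mulN1r.
split=> [xp|xr h]; last first.
  rewrite formE ler0c.
  have := rip_CS (- Phi x (h 1)) (h 0); rewrite ripNl hnN.
  have := embedding_norm_ub x (h 1); have := embedding_norm_ge0 x.
  have := hn_ge0 (h 0); have := hn_ge0 (h 1); have := hn_ge0 (Phi x (h 1)).
  move: (hn (h 0)) (hn (h 1)) (hn (Phi x (h 1))) (rip _ _) (opnorm _) xr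
    => a b p q m mr p0 b0 a0 m0 pm qp.
  have prb : p <= r * b by apply: le_trans pm _; rewrite ler_wpM2r.
  have : p * a <= r * b * a by rewrite ler_wpM2r.
  have := mulr_ge0 (ltW r0) (sqr_ge0 (a - b)); lra.
apply: opnorm_le => [||k]; [exact: PhiZ | exact: ltW |].
(* For second component [k], this first component minimizes the form. *)
pose g (i : 'I_2) := if i == 0 then - (r^-1%:C%C *: Phi x k) else k.
have g0 : g 0 = - (r^-1%:C%C *: Phi x k) by [].
have g1 : g 1 = k by [].
have := xp g; rewrite formE ler0c g0 g1 hnN hnZ Re_normC_real gtr0_norm ?invr_gt0//.
have -> : rip (Phi x k) (- (r^-1%:C%C *: Phi x k)) = - r^-1 * hn (Phi x k) ^+ 2.
  by rewrite ripC ripNl ripZl ripE mulNr.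
rewrite exprMn; have := hn_ge0 (Phi x k); have := hn_ge0 k.
move: (hn (Phi x k)) (hn k) => p q q0 p0 pos.
rewrite -(ler_pXn2r (n := 2)) ?nnegrE ?mulr_ge0 ?(ltW r0)// exprMn.
have := mulr_ge0 (ltW r0) pos.
have -> : r * (r * (r^-1 ^+ 2 * p ^+ 2) + r * q ^+ 2 + 2 * (- r^-1 * p ^+ 2))
    = r ^+ 2 * q ^+ 2 - p ^+ 2 by field; rewrite gt_eqF.
by rewrite subr_ge0.
Qed.

End EmbeddingNorm.

Lemma embedding_norm_le (R : realType) (S : mospace R) (H H' : hilbert R)
    (Phi : S -> {linear H -> H}) (Phi' : S -> {linear H' -> H'}) x :
  BH_embedding Phi -> BH_embedding Phi' -> opnorm (Phi x) <= opnorm (Phi' x).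
Proof.
move=> embP embP'; apply/ler_addgt0Pl => e e0.
have r0 : 0 < e + opnorm (Phi' x).
  by have := embedding_norm_ge0 embP' x; lra.
apply/(embedding_norm_mx embP _ r0)/(embedding_norm_mx embP' _ r0).
by rewrite lerDr ltW.
Qed.

Lemma embedding_operator_norm (R : realType) (S : mospace R) (H : hilbert R)
    (Phi : S -> {linear H -> H}) :
  BH_embedding Phi -> is_operator_norm (fun x => opnorm (Phi x)).
Proof.
move=> embP; split; first by exists H, Phi.
by move=> H' Phi' embP' x; apply/eqP; rewrite eq_le !embedding_norm_le.
Qed.

Section EmbeddingToBop.
Context {R : realType} {S : mospace R} {H : hilbert R} {h0 : H} (h0n : h0 != 0).
Variables (Phi : S -> {linear H -> H}) (embPhi : BH_embedding Phi).

Fact embedding_adjointable x : (Phi x : H -> H) \in @adjointable_pred R H.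
Proof.
have [M PM] := embedding_bounded embPhi x.
apply/asboolP; exists (Phi (mos_star x)), M; split=> // h k.
by case: embPhi => _ _ _ [st _] _; rewrite ipC -st -ipC.
Qed.

Definition embop x : bop h0n := Bop h0n (embedding_adjointable x).

Fact embop_linear : linear embop.
Proof.
move=> a x y; apply: bop_ext => h; rewrite bopD bopZ.
exact: (embedding_linear embPhi).
Qed.
HB.instance Definition _ := GRing.isLinear.Build R[i] S (bop h0n) *:%R embop embop_linear.

End EmbeddingToBop.

Section QuotientNorm.
Context {R : realType} {U : cstarType R} (J : submodClosed U).
Local Notation qn := (quot_norm (J := J)).
Implicit Types (y z : mquot J).

Let qn_has_inf y : has_inf [set cnorm x | x in [set x : U | mproj J x = y]].
Proof.
split; first by exists (cnorm (mrepr y)), (mrepr y) => //; exact: mproj_surj.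
by exists 0 => _ [x _ <-]; exact: cnorm_ge0.
Qed.

Lemma quot_norm_le x : qn (mproj J x) <= cnorm x.
Proof. by apply: ge_inf; [exact: (proj2 (qn_has_inf _)) | exists x]. Qed.

Lemma quot_norm_lt y e : qn y < e -> exists x, mproj J x = y /\ cnorm x < e.
Proof. by move=> /(inf_lt (proj1 (qn_has_inf y)))[_ [x xy <-] xe]; exists x. Qed.

Lemma quot_norm_lb y m : (forall x, mproj J x = y -> m <= cnorm x) -> m <= qn y.
Proof.
move=> ym; apply: lb_le_inf; first by have [] := qn_has_inf y.
by move=> _ [x xy <-]; exact: ym.
Qed.

Lemma quot_norm_ge0 y : 0 <= qn y.
Proof. by apply: quot_norm_lb => x _; exact: cnorm_ge0. Qed.

Lemma quot_normD y z : qn (y + z) <= qn y + qn z.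
Proof.
apply/ler_addgt0Pl => e e0.
have [x [<- xe]] : exists x, mproj J x = y /\ cnorm x < qn y + e / 2.
  by apply: quot_norm_lt; rewrite ltrDl divr_gt0.
have [x' [<- xe']] : exists x, mproj J x = z /\ cnorm x < qn z + e / 2.
  by apply: quot_norm_lt; rewrite ltrDl divr_gt0.
rewrite -raddfD; apply: le_trans (quot_norm_le _) _.
by apply: le_trans (cnormD _ _) _; lra.
Qed.

(** Increments of a fast subsequence lift to elements of norm below [2^-k]; the series of the lifts
    converges upstairs. *)
Lemma quot_norm_complete : norm_complete qn.
Proof.
move=> v vc.
have pow0 k : 0 < (1 / 2) ^+ k :> R by rewrite exprn_gt0 ?divr_gt0.
pose M k := sval (cid (vc _ (pow0 k))).
have MP k : forall m n, (M k <= m)%N -> (M k <= n)%N -> qn (v m - v n) < (1 / 2) ^+ k.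
  exact: (svalP (cid (vc _ (pow0 k)))).
(* Summing the thresholds makes both [N k] and [N k.+1] at least [M k], whether or not [M] is
   monotone. *)
pose N k := (\sum_(j < k.+1) M j)%N.
have MN k : (M k <= N k)%N by rewrite /N big_ord_recr /= leq_addl.
have MN1 k : (M k <= N k.+1)%N.
  by rewrite /N big_ord_recr /= -/(N k) (leq_trans (MN k))// leq_addr.
have dP k : exists d, mproj J d = v (N k.+1) - v (N k) /\ cnorm d < (1 / 2) ^+ k.
  exact/quot_norm_lt/MP.
pose d k := sval (cid (dP k)).
have [dE dn] : (forall k, mproj J (d k) = v (N k.+1) - v (N k)) /\
    forall k, cnorm (d k) < (1 / 2) ^+ k.
  by split=> k; have [] := svalP (cid (dP k)).
pose x k := mrepr (v (N 0)) + \sum_(j < k) d j.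
have xE k : mproj J (x k) = v (N k).
  elim: k => [|k IHk]; first by rewrite /x big_ord0 addr0 mproj_surj.
  by rewrite /x big_ord_recr addrA raddfD /= -/(x k) IHk dE addrC subrK.
(* The increments of this majorant are exactly [2^-k]. *)
have [k|k|k|l xl] := @telescope_cvg _ U x (fun k => 2 - 2 * (1 / 2) ^+ k) 2.
- have -> : x k.+1 - x k = d k by rewrite /x big_ord_recr /=; ncring.
  by rewrite (le_trans (ltW (dn k)))// exprS; lra.
- by have := pow0 k; rewrite exprS; lra.
- by have := pow0 k; lra.
exists (mproj J l); apply/(norm_cvgP quot_norm_ge0) => e e0.
have [K1 xK] := xl (e / 4) ltac:(by rewrite divr_gt0).
pose K2 := Num.Def.archi_bound (4 / e).
have K2e : (1 / 2) ^+ K2 < e / 4.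
  have K2P : 4 / e < K2%:R by apply: archi_boundP; rewrite divr_ge0// ltW.
  have : K2%:R <= (2 ^ K2)%:R :> R by rewrite ler_nat ltnW// ltn_expl.
  rewrite natrX div1r exprVn => le.
  have -> : e / 4 = (4 / e)^-1 by rewrite invf_div.
  by rewrite ltf_pV2 ?posrE ?exprn_gt0 ?divr_gt0// (lt_le_trans K2P).
pose k := maxn K1 K2.
have ke : (1 / 2) ^+ k < e / 4.
  apply: le_lt_trans K2e; apply: ler_wiXn2l; rewrite ?leq_maxr ?divr_ge0//; lra.
exists (M k) => n Mn.
have -> : v n - mproj J l = (v n - v (N k)) + mproj J (x k - l).
  by rewrite raddfB /= xE addrA subrK.
apply: le_lt_trans (quot_normD _ _) _.
have := quot_norm_le (x k - l); have := xK k (leq_maxl _ _).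
have := MP k n (N k) Mn (MN k); lra.
Qed.

End QuotientNorm.

(** * The quotient of the universal C*-algebra *)

Section UniversalQuotient.
Context {R : realType} {A U : cstarType R}.
Variables (J : submodClosed (cstar_mos A)) (iota : {linear cstar_mos A -> cstar_mos U}).
Variables (H : hilbert R) (Phi : quot_mos J -> {linear H -> H}).
Hypothesis embPhi : BH_embedding Phi.
Hypothesis univ : universal_cstar iota.
Variables (h0 : H) (h0n : h0 != 0).

Let I := ideal_gen ([set iota x | x in [set x | x \in J]] : set U).
Let q (a : A) : mquot I := mproj I (iota a).

Let idealI : closed_ideal [set x : U | x \in I].
Proof.
split=> [u l uI ul|||a x|a x] /=; rewrite ?rpred0//; last first.
- move=> /asboolP xI; apply/asboolP => K clK EK; have [_ _ _ _ Kr] := clK.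
  by apply: Kr; apply: xI.
- move=> /asboolP xI; apply/asboolP => K clK EK; have [_ _ _ Kl _] := clK.
  by apply: Kl; apply: xI.
- by move=> x y; exact: rpredD.
- apply/asboolP => K clK EK; have [Kcl _ _ _ _] := clK.
  by apply: (Kcl u) => // n; have /asboolP := uI n; exact.
Qed.

Let iotaI (x : A) : x \in J -> iota x \in I.
Proof. by move=> xJ; apply/asboolP => K _; apply; exists x. Qed.

Let toB : {linear cstar_mos A -> cstar_mos (bop h0n)} :=
  [the {linear cstar_mos A -> cstar_mos (bop h0n)} of embop h0n embPhi \o mproj J].

Let toB_ucp : ucp toB.
Proof.
have [_ _ _ [_ PhiU] Phip] := embPhi.
split; first by apply: bop_ext => h; exact: PhiU.
move=> n X Xp.
suff : opmx_pos (fun i j => Phi (map_mx (mproj J) X i j)).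
  move=> PX.
  apply: (@opmx_pos_square R H h0 h0n n (map_mx toB X)) => h.
  have := PX h; congr (0 <= _); apply: eq_bigr => i _; apply: eq_bigr => j _.
  by rewrite !mxE.
apply/Phip; exists X; split=> // e e0; exists 0; split=> [i j|]; first by rewrite mxE rpred0.
rewrite addr0.
have -> : \matrix_(i, j) ((e%:C%C *: mos_unit (cstar_mos A)) *+ (i == j)) + X
   = (rsc e)%:M + X.
  by congr (_ + _); apply/matrixP => i j; rewrite !mxE.
by apply: mos_posD => //; apply: mos_pos_rsc; exact: ltW.
Qed.

Lemma osy_le_quot_norm (a : A) : opnorm (Phi (mproj J a)) <= quot_norm (q a).
Proof.
have [_ _ /(_ _ _ toB_ucp)[pi [pis piE]]] := univ.
(* The kernel of [pi] is a closed ideal containing the image of [J]; it is closed because [pi] is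
   contractive. *)
have kerI u : u \in I -> pi u = 0.
  move=> /asboolP/(_ [set v | pi v = 0]); apply.
    split=> [v l v0 /(norm_cvgP cnorm_ge0) vl||x y /= x0 y0|x y /= y0|x y /= y0].
    - apply: cnorm_small => e /vl[N /(_ N (leqnn N)) vN].
      have -> : pi l = - pi (v N - l) by rewrite raddfB /= v0 sub0r opprK.
      by rewrite cnormN (le_trans (star_hom_contractive pis _))// ltW.
    - exact: raddf0.
    - by rewrite raddfD /= x0 y0 addr0.
    - by rewrite rmorphM /= y0 mulr0.
    - by rewrite rmorphM /= y0 mul0r.
  move=> _ [x /= xJ <-]; rewrite piE; apply: bop_ext => h.
  have /(mproj_eq J x 0) : x - 0 \in J by rewrite subr0.
  by move=> x0; rewrite bop0 /= x0 raddf0; exact: (embedding0 embPhi).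
apply: quot_norm_lb => u /mproj_eq uI.
have : pi u = pi (iota a).
  by apply/eqP; rewrite -subr_eq0 -raddfB; apply/eqP/kerI.
move=> uE; have := star_hom_contractive pis u; rewrite uE piE; exact.
Qed.

Lemma quot_norm_le_osy (a : A) (s : R) : 0 < s -> opnorm (Phi (mproj J a)) <= s ->
  quot_norm (q a) <= 4 * s.
Proof.
(* The tolerance in the quotient cone is taken equal to [s]. The lift then has diagonal [2 s] modulo
   [J], and [ideal_dist] at [2 s] produces the bound [4 s]. *)
move=> s0 /(embedding_norm_mx embPhi _ s0)[x [xE /(_ s s0)[k [kJ]]]].
set W := _ + _ => Wp.
have [[_ _ iU /(_ _ W)/iffLR/(_ Wp)[Y YE]] _ _] := univ.
have projW i j : mproj J (W i j) =
    mproj J ((s%:C%C *: 1) *+ (i == j)) + norm_mx (mproj J a : quot_mos J) s i j.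
  rewrite xE !mxE !raddfD /=.
  have /(mproj_eq J (k i j) 0) -> : k i j - 0 \in J by rewrite subr0.
  by rewrite raddf0 addr0.
have iscal (t : R) : iota (t%:C%C *: 1) = rsc t by rewrite linearZ /= iU.
have W00 (i : 'I_2) : iota (W i i) - rsc (2 * s) \in I.
  rewrite -iscal -raddfB; apply: iotaI; apply/mproj_eq; rewrite projW !mxE eqxx.
  by rewrite linearZ /= -linearZ /= -raddfD /= -scalerDl -rmorphD -mulr2n mulr_natl.
have W01 : iota (W 0 1) - iota a \in I.
  rewrite -raddfB; apply: iotaI; apply/mproj_eq; rewrite projW !mxE /=.
  by rewrite raddf0 add0r.
have WY i j : iota (W i j) = star (Y 0 i) * Y 0 j + star (Y 1 i) * Y 1 j.
  have := congr1 (fun Z : 'M[U]_2 => Z i j) YE; rewrite !mxE => ->.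
  rewrite big_ord_recl big_ord1 !mxE.
  by have -> : lift ord0 ord0 = 1 :> 'I_2 by exact/val_inj.
have := W00 0; have := W00 1; rewrite !WY => W1 W0; rewrite WY in W01.
have [|u [uI us]] := ideal_dist idealI _ W0 W1; first by rewrite mulr_gt0.
have -> : q a = mproj I u.
  by apply/esym/mproj_eq; have := rpredD uI W01; rewrite addrA subrK.
have uq : quot_norm (mproj I u) <= cnorm u by exact: quot_norm_le.
by apply: le_trans uq _; apply: le_trans us _; lra.
Qed.

End UniversalQuotient.

Lemma universal_quotient_not_closed (R : realType) (A : cstarType R)
    (J : submodClosed (cstar_mos A)) (osy : quot_mos J -> R) :
  is_operator_norm osy -> ~ norm_complete osy ->
  forall (U : cstarType R) (iota : {linear cstar_mos A -> cstar_mos U}),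
    universal_cstar iota ->
    let I := ideal_gen ([set iota x | x in [set x | x \in J]] : set U) in
    let q := fun a : A => mproj I (iota a) in
    ~ norm_closed (quot_norm (J := I)) (range q).
Proof.
move=> [[H [Phi embPhi]] osyE] osync U iota univ I q qcl; apply: osync.
have {}osyE y : osy y = opnorm (Phi y) by exact: osyE.
have osy_ge0 y : 0 <= osy y by rewrite osyE; exact: (embedding_norm_ge0 embPhi).
(* The C*-algebra [bop] needs a nonzero vector. On a zero space the quotient is zero, and its norm
   is complete. *)
have [[h0 h0n]|Htriv] := pselect (exists h0 : H, h0 != 0); last first.
  have triv (y : quot_mos J) : y = 0.
    case: embPhi => _ _ inj _ _; apply: inj => h; apply/eqP/negP => /negP hn.
    by apply: Htriv; exists (Phi y h).
  move=> u uc; exists 0; apply/(norm_cvgP osy_ge0) => e /uc[M uM].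
  by exists M => n Mn; rewrite [_ - 0]triv -(triv (u M - u M)) uM.
have lower a : osy (mproj J a) <= quot_norm (q a).
  by rewrite osyE; exact: (osy_le_quot_norm embPhi univ h0n).
have upper (a : A) s : 0 < s -> osy (mproj J a) <= s -> quot_norm (q a) <= 4 * s.
  by rewrite osyE; exact: quot_norm_le_osy.
have qB a b : q (a - b) = q a - q b by rewrite /q !raddfB.
move=> u uc; pose a n : A := mrepr (u n).
have aE n : mproj J (a n) = u n by exact: mproj_surj.
have [e e0|l ql] := @quot_norm_complete R U I (fun n => q (a n)).
  (* The upper estimate multiplies by 4, and [4 (e / 5) < e]. *)
  have [M uM] := uc (e / 5) ltac:(by rewrite divr_gt0).
  exists M => m n Mm Mn; rewrite -qB.
  have := upper (a m - a n) (e / 5) ltac:(by rewrite divr_gt0).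
  by rewrite raddfB /= !aE => /(_ (ltW (uM m n Mm Mn))); lra.
have [b _ bl] := qcl _ _ (fun n => ex_intro2 _ _ (a n) Logic.I erefl) ql.
exists (mproj J b); apply/(norm_cvgP osy_ge0) => e e0.
move/(norm_cvgP (@quot_norm_ge0 _ _ _)) : ql => /(_ e e0)[M qM].
exists M => n Mn; rewrite -aE -raddfB; apply: le_lt_trans (lower _) _.
by rewrite qB bl qM.
Qed.

(** * The Hilbert space of square summable sequences *)

Section RealSums.
Context {R : realType}.
Implicit Types (a b : nat -> R) (s t : R).

Definition has_sum a s : Prop := (fun n => \sum_(k < n) a k) @ \oo --> s.

Lemma has_sumD a b s t : has_sum a s -> has_sum b t ->
  has_sum (fun k => a k + b k) (s + t).
Proof.
move=> sa' tb; rewrite /has_sum; under eq_fun do rewrite big_split /=.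
exact: cvgD.
Qed.

Lemma has_sumZ a s t : has_sum a s -> has_sum (fun k => t * a k) (t * s).
Proof.
move=> sa'; rewrite /has_sum; under eq_fun do rewrite -mulr_sumr.
exact: cvgMr.
Qed.

Lemma has_sum_unique a s t : has_sum a s -> has_sum a t -> s = t.
Proof. by move=> sa' ta; apply: cvg_unique sa' ta. Qed.

Lemma has_sum_ge a s : has_sum a s -> (forall k, 0 <= a k) ->
  forall n, \sum_(k < n) a k <= s.
Proof.
move=> sa' a0 n; rewrite -(cvg_lim (@Rhausdorff R) sa').
apply: nondecreasing_cvgn_le; last by apply/cvg_ex; exists s.
by apply/nondecreasing_seqP => m; rewrite big_ord_recr /= lerDl.
Qed.

Lemma has_sum_ge0 a s : has_sum a s -> (forall k, 0 <= a k) -> 0 <= s.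
Proof. by move=> sa' a0; have := has_sum_ge sa' a0 0; rewrite big_ord0. Qed.

Lemma has_sum_le a s (M : R) : has_sum a s -> (forall n, \sum_(k < n) a k <= M) -> s <= M.
Proof.
move=> sa' aM; apply/ler_addgt0Pl => e e0.
have /cvgrPdist_lt/(_ e e0)[N _ /(_ N (leqnn N))] := sa'.
by rewrite /= ltr_norml => /andP[_]; have := aM N; lra.
Qed.

Lemma has_sum_nonneg a (M : R) : (forall k, 0 <= a k) -> (forall n, \sum_(k < n) a k <= M) ->
  exists s, has_sum a s.
Proof.
move=> a0 aM; apply/cvg_ex/nondecreasing_is_cvgn.
  by apply/nondecreasing_seqP => m; rewrite big_ord_recr /= lerDl.
by exists M => _ [n _ <-].
Qed.

(** The terms [a + b] lie between 0 and [2 b]; the sum of [b] is subtracted afterwards. *)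
Lemma has_sum_abs a b s : has_sum b s -> (forall k, `|a k| <= b k) -> exists t, has_sum a t.
Proof.
move=> sb ab.
have b0 k : 0 <= b k := le_trans (normr_ge0 _) (ab k).
have [|n|t ts] := @has_sum_nonneg (fun k => a k + b k) (2 * s).
- by move=> k; have := ab k; rewrite ler_norml => /andP[? _]; lra.
- apply: (@le_trans _ _ (\sum_(k < n) 2 * b k)).
    apply: ler_sum => k _; have := ab k; rewrite ler_norml => /andP[_ ?]; lra.
  by rewrite -mulr_sumr ler_pM2l// has_sum_ge.
exists (t + -1 * s); have := has_sumD ts (has_sumZ (t := -1) sb).
by rewrite /has_sum; under eq_fun do under eq_bigr do rewrite mulN1r addrK.
Qed.

Lemma has_sum_big (I : finType) (P : pred I) (F : I -> nat -> R) (G : I -> R) :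
  (forall i, P i -> has_sum (F i) (G i)) ->
  has_sum (fun k => \sum_(i | P i) F i k) (\sum_(i | P i) G i).
Proof.
move=> FG.
have -> : (fun k => \sum_(i | P i) F i k) = \sum_(i | P i) F i.
  by apply/funext => k; rewrite fct_sumE.
elim/big_ind2: _ => //; last by move=> a s b t; exact: has_sumD.
rewrite /has_sum; under eq_fun do rewrite big1//.
exact: cvg_cst.
Qed.

Lemma real_cauchy_cvg (u : nat -> R) :
  (forall e, 0 < e -> exists N, forall m n, (N <= m)%N -> (N <= n)%N ->
    `|u m - u n| < e) -> exists l : R, u @ \oo --> l.
Proof.
move=> uc; apply/cvg_ex; apply: cauchy_cvg; apply/cauchy_ballP => e e0.
have [N uN] := uc _ e0.
exists (u @` [set n | (N <= n)%N], u @` [set n | (N <= n)%N]) => /=.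
  by split; exists N => // n Nn; exists n.
by move=> [_ _] [/= [m Nm <-] [n Nn <-]]; exact: uN.
Qed.

End RealSums.

Section SquareSummable.
Context {R : realType}.
Local Notation C := R[i].
Implicit Types (z w : C) (t : R).

(** The real part of [z * w^*]: with it every series of the construction is real, and [l2ip]
    rebuilds the complex inner product. *)
Definition cdot z w : R := complex.Re z * complex.Re w + complex.Im z * complex.Im w.

Lemma cdotDl z z' w : cdot (z + z') w = cdot z w + cdot z' w.
Proof. by case: z z' w => [a b] [a' b'] [c d]; rewrite /cdot /=; ring. Qed.
Lemma cdotC z w : cdot z w = cdot w z.
Proof. by rewrite /cdot; ring. Qed.
Lemma cdotZ t z w : cdot (t%:C%C * z) w = t * cdot z w.
Proof. by case: z w => [a b] [c d]; rewrite /cdot /=; ring. Qed.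
Lemma cdot_mul (u : C) z w : cdot (u * z) w = cdot z (u^* * w).
Proof. by case: u z w => [p q] [a b] [c d]; rewrite /cdot /=; ring. Qed.
Lemma cdot_ge0 z : 0 <= cdot z z.
Proof. by rewrite /cdot; nra. Qed.
Lemma cdot_eq0 z : cdot z z = 0 -> z = 0.
Proof.
case: z => a b; rewrite /cdot /= => ab; have a0 : a = 0 by nra.
by have b0 : b = 0 by [nra]; rewrite a0 b0.
Qed.
Lemma cdot_abs z w : `|cdot z w| <= cdot z z + cdot w w.
Proof.
case: z w => [a b] [c d]; rewrite /cdot /= ler_norml.
have := sqr_ge0 (a - c); have := sqr_ge0 (a + c).
have := sqr_ge0 (b - d); have := sqr_ge0 (b + d).
have := sqr_ge0 a; have := sqr_ge0 b; have := sqr_ge0 c; have := sqr_ge0 d.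
by move=> *; apply/andP; split; lra.
Qed.
Lemma cdot_normsq (u : C) : (cdot u u)%:C%C = `|u| ^+ 2.
Proof. by rewrite -add_Re2_Im2 /cdot !expr2. Qed.
Lemma cdot_mulnorm (u : C) z : cdot (u * z) (u * z) = cdot u u * cdot z z.
Proof. by case: u z => [p q] [a b]; rewrite /cdot /=; ring. Qed.

Definition l2_pred : {pred nat -> C} := fun f =>
  `[< exists M : R, forall n, \sum_(k < n) cdot (f k) (f k) <= M >].

Fact l2_submod : submod_closed l2_pred.
Proof.
split=> [|u f g /asboolP[M fM] /asboolP[K gK]].
  apply/asboolP; exists 0 => n; rewrite big1// => k _.
  by rewrite /cdot /= !mul0r addr0.
apply/asboolP; exists (2 * (cdot u u * M + K)) => n.
apply: (@le_trans _ _ (\sum_(k < n) 2 * (cdot u u * cdot (f k) (f k) + cdot (g k) (g k)))).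
  apply: ler_sum => k _; rewrite -[(_ + _) (val k)]/(u * f k + g k) -cdot_mulnorm.
  move: (u * f k) (g k) => [a b] [c d]; rewrite /cdot /=.
  by have := sqr_ge0 (a - c); have := sqr_ge0 (b - d); lra.
rewrite -mulr_sumr ler_pM2l// big_split/= -mulr_sumr lerD ?gK//.
by rewrite ler_wpM2l ?cdot_ge0 ?fM.
Qed.
HB.instance Definition _ := GRing.isSubmodClosed.Build R[i] (nat -> C) l2_pred
  (GRing.submod_closed_semi l2_submod).

Record l2 := L2 { l2fun :> nat -> C; l2P : l2fun \in l2_pred }.
HB.instance Definition _ := [isSub for l2fun].
HB.instance Definition _ := [Choice of l2 by <:].
HB.instance Definition _ := [SubChoice_isSubLmodule of l2 by <:].
Implicit Types f g h : l2.

Lemma l2_ext f g : (forall k, f k = g k) -> f = g.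
Proof. by move=> fg; apply/val_inj/funext. Qed.
Lemma l2D f g k : (f + g) k = f k + g k.
Proof. by rewrite -[l2fun (f + g)]/(val (f + g)) raddfD. Qed.
Lemma l2N f k : (- f) k = - f k.
Proof. by rewrite -[l2fun (- f)]/(val (- f)) raddfN. Qed.
Lemma l2Z (u : C) f k : (u *: f) k = u * f k.
Proof. reflexivity. Qed.
Lemma l20 k : (0 : l2) k = 0.
Proof. by rewrite -(scale0r 0) l2Z mul0r. Qed.

Lemma l2_dot_ex f g : exists s, has_sum (fun k => cdot (f k) (g k)) s.
Proof.
have ex f' : exists s, has_sum (fun k => cdot (f' k) (f' k)) s.
  have /asboolP[M fM] := l2P f'.
  by apply: has_sum_nonneg fM => k; exact: cdot_ge0.
have [s fs] := ex f; have [t gt] := ex g.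
by apply: has_sum_abs (has_sumD fs gt) _ => k; exact: cdot_abs.
Qed.

Definition l2dot f g : R := sval (cid (l2_dot_ex f g)).

Lemma l2dotP f g : has_sum (fun k => cdot (f k) (g k)) (l2dot f g).
Proof. exact: (svalP (cid (l2_dot_ex f g))). Qed.
Arguments l2dotP : clear implicits.

Lemma l2dot_uniq f g s : has_sum (fun k => cdot (f k) (g k)) s -> l2dot f g = s.
Proof. exact/has_sum_unique/l2dotP. Qed.

Lemma l2dotDl f g h : l2dot (f + g) h = l2dot f h + l2dot g h.
Proof.
apply: l2dot_uniq; have := has_sumD (l2dotP f h) (l2dotP g h).
by under eq_fun do rewrite -cdotDl -l2D.
Qed.
Lemma l2dotZl t f g : l2dot (t%:C%C *: f) g = t * l2dot f g.
Proof.
apply: l2dot_uniq; have := has_sumZ (t := t) (l2dotP f g).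
by under eq_fun do rewrite -cdotZ -l2Z.
Qed.
Lemma l2dotC f g : l2dot f g = l2dot g f.
Proof. by apply: l2dot_uniq; under eq_fun do rewrite cdotC; exact: l2dotP. Qed.
Lemma l2dot_mul (u : C) f g : l2dot (u *: f) g = l2dot f (u^* *: g).
Proof.
apply: l2dot_uniq; have := l2dotP f (u^* *: g).
by under eq_fun do rewrite l2Z -cdot_mul -l2Z.
Qed.
Lemma l2dot_sum_le f n : \sum_(k < n) cdot (f k) (f k) <= l2dot f f.
Proof. by apply: has_sum_ge (l2dotP f f) _ n => k; exact: cdot_ge0. Qed.
Lemma l2dot_ge0 f : 0 <= l2dot f f.
Proof. by apply: has_sum_ge0 (l2dotP f f) _ => k; exact: cdot_ge0. Qed.
Lemma l2dot_entry f k : cdot (f k) (f k) <= l2dot f f.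
Proof.
apply: le_trans (l2dot_sum_le f k.+1); rewrite big_ord_recr /= lerDr.
by apply: sumr_ge0 => j _; exact: cdot_ge0.
Qed.
Lemma l2dot_eq0 f : l2dot f f = 0 -> f = 0.
Proof.
move=> f0; apply: l2_ext => k; rewrite l20; apply: cdot_eq0; apply/eqP.
by rewrite eq_le cdot_ge0 andbT -f0 l2dot_entry.
Qed.

Definition l2norm f : C := (Num.sqrt (l2dot f f))%:C%C.

Fact l2normD f g : l2norm (f + g) <= l2norm f + l2norm g.
Proof.
rewrite -rmorphD lecR.
exact: (real_form_triangle l2dotDl l2dotZl l2dotC l2dot_ge0).
Qed.
Fact l2normZ (u : C) f : l2norm (u *: f) = `|u| * l2norm f.
Proof.
rewrite /l2norm l2dot_mul scalerA mulrC -normCK -cdot_normsq l2dotC l2dotZl.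
rewrite sqrtrM ?cdot_ge0// rmorphM; congr (_ * _).
apply/eqP; rewrite -(eqrXn2 (n := 2)) ?normr_ge0 ?lecR ?sqrtr_ge0//.
by rewrite -rmorphXn /= sqr_sqrtr ?cdot_ge0// cdot_normsq.
Qed.
Fact l2norm_eq0 f : l2norm f = 0 -> f = 0.
Proof.
move=> /complexI/eqP; rewrite sqrtr_eq0 => f0; apply: l2dot_eq0; apply/eqP.
by rewrite eq_le f0 l2dot_ge0.
Qed.

HB.instance Definition _ := Lmodule_isNormed.Build C l2 l2normD l2normZ l2norm_eq0.

Lemma l2_normE f : `|f| = (Num.sqrt (l2dot f f))%:C%C.
Proof. by []. Qed.

Let nrm f : R := Num.sqrt (l2dot f f).

Let entry_le f k : `|complex.Re (f k)| <= nrm f /\ `|complex.Im (f k)| <= nrm f.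
Proof.
have := l2dot_entry f k; rewrite -(sqr_sqrtr (l2dot_ge0 f)) -/(nrm f) /cdot => le.
by split; rewrite -(ler_pXn2r (n := 2)) ?nnegrE ?sqrtr_ge0// real_normK ?num_real//;
  have := sqr_ge0 (complex.Re (f k)); have := sqr_ge0 (complex.Im (f k)); lra.
Qed.

(** Coordinates converge, and the Cauchy bound passes to the limit on each partial sum, with its
    length fixed. The limit is square summable because its difference from some [u N] is. *)
Lemma l2_seq_complete (u : nat -> l2) :
  (forall e, 0 < e -> exists N, forall m n, (N <= m)%N -> (N <= n)%N ->
    nrm (u m - u n) < e) ->
  exists l, forall e, 0 < e -> exists N, forall n, (N <= n)%N -> nrm (u n - l) <= e.
Proof.
move=> uc.
have ReC k : exists l : R, (fun n => complex.Re (u n k)) @ \oo --> l.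
  apply: real_cauchy_cvg => e /uc[N uN]; exists N => m n Nm Nn.
  apply: le_lt_trans (uN m n Nm Nn).
  have [+ _] := entry_le (u m - u n) k; rewrite l2D l2N.
  by case: (u m k) (u n k) => [a b] [c d].
have ImC k : exists l : R, (fun n => complex.Im (u n k)) @ \oo --> l.
  apply: real_cauchy_cvg => e /uc[N uN]; exists N => m n Nm Nn.
  apply: le_lt_trans (uN m n Nm Nn).
  have [_] := entry_le (u m - u n) k; rewrite l2D l2N.
  by case: (u m k) (u n k) => [a b] [c d].
pose p k := sval (cid (ReC k)); pose q k := sval (cid (ImC k)).
have pP k : (fun n => complex.Re (u n k)) @ \oo --> p k := svalP (cid (ReC k)).
have qP k : (fun n => complex.Im (u n k)) @ \oo --> q k := svalP (cid (ImC k)).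
pose l k : C := (p k +i* q k)%C.
have bound e N : 0 < e -> (forall m n, (N <= m)%N -> (N <= n)%N -> nrm (u m - u n) < e) ->
  forall n, (N <= n)%N -> forall K, \sum_(k < K) cdot (u n k - l k) (u n k - l k) <= e ^+ 2.
  move=> e0 uN n Nn K.
  have cv : (fun m => \sum_(k < K) cdot (u n k - u m k) (u n k - u m k)) @ \oo -->
      \sum_(k < K) cdot (u n k - l k) (u n k - l k).
    have -> : (fun m => \sum_(k < K) cdot (u n k - u m k) (u n k - u m k))
      = \sum_(k < K) (fun m => cdot (u n k - u m k) (u n k - u m k)).
      by apply/funext => m; rewrite fct_sumE.
    apply: (big_ind2 (fun (a : nat -> R) (b : R) => a @ \oo --> b)).
    - exact: cvg_cst.
    - by move=> a b c d; exact: cvgD.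
    move=> k _.
    have cE z w : cdot (z - w) (z - w) = (complex.Re z - complex.Re w) ^+ 2
        + (complex.Im z - complex.Im w) ^+ 2.
      by case: z w => [a b] [c d]; rewrite /cdot /= !expr2.
    under eq_fun do rewrite cE.
    rewrite cE; apply: cvgD; rewrite expr2; under eq_fun do rewrite expr2;
      by apply: cvgM; apply: cvgB => //; exact: cvg_cst.
  rewrite -(cvg_lim (@Rhausdorff R) cv); apply: limr_le; first by apply/cvg_ex; eexists; exact: cv.
  exists N => // m Nm /=.
  have -> : \sum_(k < K) cdot (u n k - u m k) (u n k - u m k)
      = \sum_(k < K) cdot ((u n - u m) k) ((u n - u m) k).
    by apply: eq_bigr => k _; rewrite l2D l2N.
  apply: le_trans (l2dot_sum_le _ K) _; rewrite -(sqr_sqrtr (l2dot_ge0 _)).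
  by rewrite ler_pXn2r ?nnegrE ?sqrtr_ge0 ?(ltW e0)// ltW// uN.
have [N uN] := uc 1 ltr01.
have dl2 : (fun k => u N k - l k) \in l2_pred.
  by apply/asboolP; exists (1 ^+ 2); exact: bound ltr01 uN N (leqnn N).
pose L := u N - L2 dl2.
have LE k : L k = l k by rewrite /L l2D l2N /= opprB addrC subrK.
exists L => e e0; have [M uM] := uc e e0; exists M => n Mn.
rewrite -(ler_pXn2r (n := 2)) ?nnegrE ?sqrtr_ge0 ?(ltW e0)//.
rewrite sqr_sqrtr ?l2dot_ge0//; apply: has_sum_le (l2dotP _ _) _ => K.
under eq_bigr do rewrite l2D l2N LE.
exact: (bound e M e0 uM n Mn K).
Qed.

(** Reduction to sequences: the centres of balls of radius [1 / (n + 1)] belonging to [F] form a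
    Cauchy sequence, whose limit is that of [F]. *)
Fact l2_complete (F : set_system l2) : ProperFilter F -> cauchy F -> cvg F.
Proof.
move=> FF /cauchyP Fc.
have nrmE f : `|f| = (nrm f)%:C%C by [].
have ballE (y z : l2) (e : C) : ball y e z -> `|y - z| < e by rewrite -ball_normE.
have Fn n : exists x : l2, F (ball x (n.+1%:R^-1 : C)).
  by apply: Fc; rewrite invr_gt0.
pose x n := sval (cid (Fn n)).
have Fx n : F (ball (x n) (n.+1%:R^-1 : C)) := svalP (cid (Fn n)).
have invE n : (n.+1%:R^-1 : C) = (n.+1%:R^-1)%:C%C by rewrite fmorphV rmorph_nat.
have xb m n : nrm (x m - x n) < m.+1%:R^-1 + n.+1%:R^-1.
  have [z [+ +]] := filter_ex (filterI (Fx m) (Fx n)).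
  move=> /ballE; rewrite nrmE invE ltcR => mz /ballE; rewrite nrmE invE ltcR => nz.
  rewrite -ltcR -nrmE; have -> : x m - x n = (x m - z) - (x n - z).
    by rewrite opprB addrA subrK.
  apply: le_lt_trans (ler_normB _ _) _.
  by rewrite !nrmE -rmorphD ltcR ltrD.
have inv_small e : 0 < e -> exists N, forall n, (N <= n)%N -> n.+1%:R^-1 < e :> R.
  move=> e0; exists (Num.Def.archi_bound e^-1) => n Nn.
  rewrite -[e]invrK ltf_pV2 ?posrE ?invr_gt0//.
  have := archi_boundP (ltW (_ : 0 < e^-1)); rewrite invr_gt0 => /(_ e0) lt.
  by apply: lt_le_trans lt _; rewrite ler_nat (leq_trans Nn).
have [e e0|L xL] := l2_seq_complete (u := x).
  have [N iN] := inv_small (e / 2) ltac:(by rewrite divr_gt0).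
  exists N => m n Nm Nn; apply: lt_trans (xb m n) _.
  by rewrite [e]splitr ltrD ?iN.
apply/cvg_ex; exists L; apply/cvgrPdist_lt => e e0.
have e1 : 0 < complex.Re e by rewrite -ltcR RRe_real// gtr0_real.
have [N1 xN] := xL (complex.Re e / 2) ltac:(by rewrite divr_gt0).
have [N2 iN] := inv_small (complex.Re e / 2) ltac:(by rewrite divr_gt0).
pose n := maxn N1 N2.
apply: filterS (Fx n) => z /ballE xz.
have -> : L - z = (x n - z) - (x n - L) by rewrite opprB [RHS]addrC addrA subrK.
apply: le_lt_trans (ler_normB _ _) _.
rewrite nrmE invE ltcR in xz; rewrite !nrmE -rmorphD -(RRe_real (gtr0_real e0)) ltcR.
by rewrite [ltRHS]splitr ltr_leD ?xN ?leq_maxl// (lt_trans xz)// iN ?leq_maxr.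
Qed.

HB.instance Definition _ := Uniform_isComplete.Build l2 l2_complete.

(** Conjugate linearity on the right makes [<f, i g>] equal to [- i <f, g>], whose real part is the
    imaginary part of [<f, g>]. *)
Definition l2ip f g : C := (l2dot f g +i* l2dot f ('i *: g))%C.

End SquareSummable.

#[global] Arguments l2dotP {R} f g.

Section SquareSummableInner.
Context {R : realType}.
Local Notation C := R[i].
Local Notation l2 := (@l2 R).
Implicit Types (f g h : l2) (u : C).

Let l2dot_i f g : l2dot ('i *: f) g = - l2dot f ('i *: g).
Proof.
rewrite l2dot_mul conjCi scaleNr -scaleN1r l2dotC -(rmorphN1 (real_complex R)).
by rewrite l2dotZl mulN1r l2dotC.
Qed.

Fact l2ip_herm f g : l2ip f g = (-1) ^+ false * (l2ip g f)^*.
Proof.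
rewrite expr0 mul1r /l2ip [in LHS]l2dotC; apply/eqP; rewrite eq_complex /= eqxx /=.
by rewrite l2dotC l2dot_i.
Qed.

Lemma l2ipDl f g h : l2ip (f + g) h = l2ip f h + l2ip g h.
Proof. by rewrite /l2ip !l2dotDl. Qed.

Lemma l2ipZl u f g : l2ip (u *: f) g = u * l2ip f g.
Proof.
have -> : u *: f = (complex.Re u)%:C%C *: f + (complex.Im u)%:C%C *: ('i *: f).
  by rewrite scalerA -scalerDl {1}(complexE u) -complexiE [X in _ + X]mulrC.
rewrite l2ipDl /l2ip !l2dotZl !l2dot_i scalerA -expr2 sqrCi scaleN1r.
have -> : l2dot f (- g) = - l2dot f g.
  by rewrite l2dotC -scaleN1r -(rmorphN1 (real_complex R)) l2dotZl mulN1r l2dotC.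
apply/eqP; case: u => p q; rewrite eq_complex /=.
by apply/andP; split; apply/eqP; ring.
Qed.

Lemma l2ipDr f g h : l2ip f (g + h) = l2ip f g + l2ip f h.
Proof.
rewrite l2ip_herm l2ipDl rmorphD mulrDr.
by rewrite -!l2ip_herm.
Qed.

Lemma l2ipZr u f g : l2ip f (u *: g) = u^* * l2ip f g.
Proof.
by rewrite l2ip_herm l2ipZl rmorphM mulrCA -l2ip_herm.
Qed.

Fact l2ip_zmodl g : zmod_morphism (l2ip ^~ g).
Proof.
move=> f h /=; rewrite l2ipDl; congr (_ + _).
by rewrite -scaleN1r l2ipZl mulN1r.
Qed.
Fact l2ip_zmodr f : zmod_morphism (l2ip f).
Proof.
move=> g h /=; rewrite l2ipDr; congr (_ + _).
by rewrite -scaleN1r l2ipZr rmorphN1 mulN1r.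
Qed.
Fact l2ip_scalel g : scalable_for *%R (l2ip ^~ g).
Proof. by move=> u f /=; rewrite l2ipZl. Qed.
Fact l2ip_scaler f : scalable_for (Num.conj \; *%R) (l2ip f).
Proof. by move=> u g /=; rewrite l2ipZr. Qed.

HB.instance Definition _ := isBilinear.Build C l2 l2 C *%R (Num.conj \; *%R)
  (@l2ip R) l2ip_zmodl l2ip_zmodr l2ip_scalel l2ip_scaler.
HB.instance Definition _ := isHermitianSesquilinear.Build C l2 false Num.conj
  (@l2ip R) l2ip_herm.

Lemma l2ip_self f : l2ip f f = (l2dot f f)%:C%C.
Proof.
rewrite /l2ip; apply/eqP; rewrite eq_complex /= eqxx /=.
by have := l2dot_i f f; rewrite l2dotC => e; apply/eqP; lra.
Qed.

Fact l2ip_gt0 f : f != 0 -> 0 < l2ip f f.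
Proof.
move=> f0; rewrite l2ip_self ltcR lt_def l2dot_ge0 andbT.
by apply: contraNneq f0 => /l2dot_eq0 ->.
Qed.
HB.instance Definition _ := isDotProduct.Build C l2 (@l2ip R) l2ip_gt0.

Fact l2_inner_norm f : `|f| ^+ 2 = l2ip f f.
Proof. by rewrite l2_normE -rmorphXn /= sqr_sqrtr ?l2dot_ge0// l2ip_self. Qed.

Definition l2_hilbert : hilbert R :=
  @Hilbert R l2 [the {dot l2 for Num.conj} of @l2ip R] l2_inner_norm.

End SquareSummableInner.

(** * Diagonal operators *)

Section ComplexModulus.
Context {R : realType}.
Implicit Types (z w : R[i]) (t : R).

Definition cn z : R := complex.Re `|z|.

Lemma cn_real z : `|z| = (cn z)%:C%C.
Proof. by rewrite RRe_real// ger0_real. Qed.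
Lemma cn_ge0 z : 0 <= cn z. Proof. by rewrite -ler0c -cn_real. Qed.
Lemma cnD z w : cn (z + w) <= cn z + cn w.
Proof. by rewrite -lecR rmorphD -!cn_real ler_normD. Qed.
Lemma cnM z w : cn (z * w) = cn z * cn w.
Proof. by apply: complexI; rewrite rmorphM -!cn_real normrM. Qed.
Lemma cnN z : cn (- z) = cn z. Proof. by rewrite /cn normrN. Qed.
Lemma cn_conj z : cn z^* = cn z. Proof. by rewrite /cn norm_conjC. Qed.
Lemma cn_rC t : cn t%:C%C = `|t|. Proof. exact: Re_normC_real. Qed.
Lemma cn0 : cn 0 = 0. Proof. by rewrite /cn normr0. Qed.
Lemma cn_sqr z : cn z ^+ 2 = cdot z z.
Proof. by apply: complexI; rewrite cdot_normsq cn_real -rmorphXn. Qed.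
Lemma Re_cn z : - cn z <= complex.Re z.
Proof.
have : `|complex.Re z| <= cn z.
  rewrite -(ler_pXn2r (n := 2)) ?nnegrE ?cn_ge0// real_normK ?num_real// cn_sqr /cdot.
  by have := sqr_ge0 (complex.Im z); lra.
by rewrite ler_norml => /andP[].
Qed.
Lemma cn_sum (I : finType) (F : I -> R[i]) : cn (\sum_i F i) <= \sum_i cn (F i).
Proof.
elim/big_ind2: _ => [|a x b y xa yb|//]; first by rewrite cn0.
by apply: le_trans (cnD _ _) _; exact: lerD.
Qed.

End ComplexModulus.

Section QuadraticForms.
Context {R : realType} {n : nat}.
Local Notation C := R[i].
Implicit Types (G : 'I_n -> 'I_n -> C) (v : 'I_n -> C).

Definition qform G v : C := \sum_i \sum_j G i j * v j * (v i)^*.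

Definition vsq v : R := \sum_i cn (v i) ^+ 2.

Lemma vsq_ge0 v : 0 <= vsq v.
Proof. by apply: sumr_ge0 => i _; exact: sqr_ge0. Qed.

Lemma qformD G G' v : qform (fun i j => G i j + G' i j) v = qform G v + qform G' v.
Proof.
rewrite /qform -big_split; apply: eq_bigr => i _; rewrite -big_split.
by apply: eq_bigr => j _; rewrite !mulrDl.
Qed.
Lemma qformZ (a : C) G v : qform (fun i j => a * G i j) v = a * qform G v.
Proof.
rewrite /qform mulr_sumr; apply: eq_bigr => i _; rewrite mulr_sumr.
by apply: eq_bigr => j _; rewrite !mulrA.
Qed.
Lemma qform_scalar (a : C) v : qform (fun i j => a *+ (i == j)) v = a * (vsq v)%:C%C.
Proof.
rewrite /qform /vsq rmorph_sum mulr_sumr; apply: eq_bigr => i _.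
rewrite (bigD1 i)//= eqxx big1 => [|j /negbTE ji]; last first.
  by rewrite eq_sym ji mulr0n !mul0r.
by rewrite addr0 mulr1n -mulrA -normCK cn_real rmorphXn.
Qed.

(** A hermitian form is real, and [|v_i| |v_j| <= |v|^2] bounds it below without eigenvalues. *)
Lemma qform_herm_bound G v : (forall i j, G i j = (G j i)^*) ->
  0 <= (\sum_i \sum_j cn (G i j))%:C%C * (vsq v)%:C%C + qform G v.
Proof.
move=> Gh; have qC : (qform G v)^* = qform G v.
  rewrite {2}/qform exchange_big rmorph_sum; apply: eq_bigr => i _.
  rewrite rmorph_sum; apply: eq_bigr => j _.
  by rewrite !rmorphM /= -Gh conjCK mulrAC.
have qIm : complex.Im (qform G v) = 0.
  by move: qC; case: (qform G v) => a b /= [] e; lra.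
have le : cn (qform G v) <= (\sum_i \sum_j cn (G i j)) * vsq v.
  apply: le_trans (cn_sum _) _; rewrite mulr_suml; apply: ler_sum => i _.
  apply: le_trans (cn_sum _) _; rewrite mulr_suml; apply: ler_sum => j _.
  rewrite !cnM cn_conj -mulrA ler_wpM2l ?cn_ge0//.
  have e k : cn (v k) ^+ 2 <= vsq v.
    by rewrite /vsq (bigD1 k)//= lerDl sumr_ge0// => l _; exact: sqr_ge0.
  have := e i; have := e j; have := sqr_ge0 (cn (v i) - cn (v j)); lra.
rewrite -rmorphM lecE /=; have := Re_cn (qform G v).
case: (qform G v) qIm le => a b /= -> le re; rewrite addr0 eqxx /=; lra.
Qed.

End QuadraticForms.

Section BoundedDiagonal.
Context {R : realType}.
Local Notation C := R[i].
Local Notation H := (@l2_hilbert R).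
Implicit Types (f g h : H) (d : nat -> C).

Lemma has_sum_single (a : nat -> R) p : (forall k, k != p -> a k = 0) -> has_sum a (a p).
Proof.
move=> a0; apply/cvgrPdist_lt => e e0; exists p.+1 => // n /= pn.
rewrite (bigD1 (Ordinal pn))//= big1 ?addr0 ?subrr ?normr0// => k kp.
by apply: a0; apply: contraNneq kp => kp; apply/eqP/val_inj.
Qed.

Fact l2_basis_subproof p : (fun k => (k == p)%:R : C) \in @l2_pred R.
Proof.
apply/asboolP; exists 1 => n.
have s := @has_sum_single (fun k => cdot ((k == p)%:R : C) ((k == p)%:R)) p.
apply: le_trans (has_sum_ge (s _) _ n) _.
- by move=> k /negbTE ->; rewrite /cdot /= !mulr0 addr0.
- by move=> k; exact: cdot_ge0.
- by rewrite eqxx /cdot /= mulr1 mulr0 addr0.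
Qed.
Definition l2e p : H := L2 (l2_basis_subproof p).

Lemma l2ip_basis (f : H) p : inner H f (l2e p) = f p.
Proof.
have fk u k : k != p -> cdot (f k) ((u *: (l2e p : @l2 R)) k) = 0.
  by move=> /negbTE kp; rewrite l2Z /= kp mulr0 /cdot /= !mulr0 addr0.
have E u : l2dot f (u *: (l2e p : @l2 R)) = cdot (f p) u.
  rewrite (l2dot_uniq (has_sum_single (fk u))) l2Z /= eqxx mulr1//.
rewrite -[LHS]/(l2ip f (l2e p)) /l2ip E -{1}(scale1r (l2e p)) E.
by case: (f p) => a b; rewrite /cdot -complexiE /= !mulr1 !mulr0 addr0 add0r.
Qed.

Lemma hn_l2e p : hn (l2e p) = 1.
Proof.
apply/eqP; rewrite -(eqrXn2 (n := 2)) ?hn_ge0// -ripE /rip l2ip_basis /= eqxx.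
by rewrite expr1n.
Qed.

Lemma l2e_neq0 p : l2e p != 0.
Proof. by apply/eqP => /(congr1 hn); rewrite hn_l2e hn0 => /eqP; rewrite oner_eq0. Qed.

Local Notation B := (bop (l2e_neq0 0)).

Definition bounded_by d (M : R) := forall k, cn (d k) <= M.

Lemma hn_l2 (f : H) : hn f ^+ 2 = l2dot f f.
Proof. by rewrite -ripE. Qed.

Lemma diag_sum_le d M f n : bounded_by d M ->
  \sum_(k < n) cdot (d k * f k) (d k * f k) <= M ^+ 2 * l2dot f f.
Proof.
move=> dM; have M0 : 0 <= M := le_trans (cn_ge0 _) (dM 0).
apply: (@le_trans _ _ (\sum_(k < n) M ^+ 2 * cdot (f k) (f k))).
  apply: ler_sum => k _; rewrite cdot_mulnorm ler_wpM2r ?cdot_ge0//.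
  by rewrite -cn_sqr ler_pXn2r ?nnegrE ?cn_ge0.
by rewrite -mulr_sumr ler_wpM2l ?sqr_ge0// l2dot_sum_le.
Qed.

Section DiagonalOperator.
Variables (d : nat -> C) (M : R) (dM : bounded_by d M).

Fact diag_l2_subproof f : (fun k => d k * f k) \in @l2_pred R.
Proof. by apply/asboolP; exists (M ^+ 2 * l2dot f f) => n; exact: diag_sum_le. Qed.
Definition diagf f : H := L2 (diag_l2_subproof f).

End DiagonalOperator.

Fact bounded_by_conj d M : bounded_by d M -> bounded_by (fun k => (d k)^*) M.
Proof. by move=> dM k; rewrite cn_conj. Qed.

Lemma diagf_adj d M (dM : bounded_by d M) f g :
  inner H (diagf dM f) g = inner H f (diagf (bounded_by_conj dM) g).
Proof.
rewrite -[LHS]/(l2ip _ _) -[RHS]/(l2ip _ _) /l2ip.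
have E h : l2dot (diagf dM f) h = l2dot f (diagf (bounded_by_conj dM) h).
  apply: l2dot_uniq; have := l2dotP f (diagf (bounded_by_conj dM) h).
  by congr (has_sum _ _); apply/funext => k /=; rewrite cdot_mul.
rewrite !E; congr (_ +i* l2dot _ _)%C; apply: l2_ext => k.
exact: mulrCA.
Qed.

Fact diagf_adjointable d M (dM : bounded_by d M) : diagf dM \in @adjointable_pred R H.
Proof.
apply/asboolP; exists (diagf (bounded_by_conj dM)), M; split=> [f g|f].
  exact: diagf_adj.
have M0 : 0 <= M := le_trans (cn_ge0 _) (dM 0).
rewrite -(ler_pXn2r (n := 2)) ?nnegrE ?mulr_ge0 ?hn_ge0// exprMn !hn_l2.
apply: has_sum_le (l2dotP _ _) _ => n; exact: diag_sum_le.
Qed.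

(* Junk value 0 when the diagonal is unbounded. *)
Definition diagop d : B :=
  if pselect (exists M, bounded_by d M) is left dM
  then Bop _ (diagf_adjointable (svalP (cid dM))) else 0.

Lemma diagopE d M (h : H) k : bounded_by d M -> diagop d h k = d k * h k.
Proof. by rewrite /diagop; case: pselect => // nb dM; case: nb; exists M. Qed.

Lemma diagop_norm d M : 0 <= M -> bounded_by d M -> bnorm (diagop d) <= M.
Proof.
move=> M0 dM; apply: bnorm_le => // h.
rewrite -(ler_pXn2r (n := 2)) ?nnegrE ?mulr_ge0 ?hn_ge0// exprMn !hn_l2.
apply: has_sum_le (l2dotP _ _) _ => n.
under eq_bigr do rewrite (diagopE _ _ dM).
exact: diag_sum_le.
Qed.

Definition coef (T : B) p : C := T (l2e p) p.

Lemma coefE (T : B) p : coef T p = inner H (T (l2e p)) (l2e p).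
Proof. by rewrite l2ip_basis. Qed.

Lemma coef_linear (a : C) (S T : B) p : coef (a *: S + T) p = a * coef S p + coef T p.
Proof. by rewrite !coefE bopD bopZ ipDl ipZl. Qed.
Lemma coef_star (T : B) p : coef (star T) p = (coef T p)^*.
Proof. by rewrite !coefE ipC; congr (_^*); rewrite -bop_starP. Qed.
Lemma coef1 p : coef 1 p = 1.
Proof. by rewrite /coef bop1h /= eqxx. Qed.
Lemma coef_diagop d M p : bounded_by d M -> coef (diagop d) p = d p.
Proof. by move=> dM; rewrite /coef (diagopE _ _ dM) /= eqxx mulr1. Qed.
Lemma coef_bound (T : B) : bounded_by (coef T) (bnorm T).
Proof.
move=> p; rewrite -(ler_pXn2r (n := 2)) ?nnegrE ?cn_ge0 ?bnorm_ge0//.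
rewrite cn_sqr /coef (le_trans (l2dot_entry _ _))// -hn_l2.
rewrite ler_pXn2r ?nnegrE ?hn_ge0 ?bnorm_ge0//.
by rewrite -[leRHS]mulr1 -(hn_l2e p) bnorm_ub.
Qed.

(** The sum of inner products is a series over the coordinates; its imaginary part vanishes term by
    term and its real part has nonnegative terms. *)
Lemma l2_form_ge0 (I : finType) (a b : I -> H) :
  (forall k, 0 <= \sum_s a s k * (b s k)^*) -> 0 <= \sum_s inner H (a s) (b s).
Proof.
move=> ab0.
have reim k : complex.Im (\sum_s a s k * (b s k)^*) = 0 /\
    0 <= complex.Re (\sum_s a s k * (b s k)^*).
  by have := ab0 k; rewrite lecE /= => /andP[/eqP].
have ReM k s : complex.Re (a s k * (b s k)^*) = cdot (a s k) (b s k).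
  by rewrite /cdot; case: (a s k) (b s k) => [x y] [z w] /=; ring.
have ImM k s : complex.Im (a s k * (b s k)^*) = cdot (a s k) (('i *: (b s : @l2 R)) k).
  rewrite l2Z -complexiE /cdot; case: (a s k) (b s k) => [x y] [z w] /=; ring.
have ReS (J : finType) (F : J -> C) : complex.Re (\sum_j F j) = \sum_j complex.Re (F j).
  exact: (big_morph _ ReD (erefl _)).
have ImS (J : finType) (F : J -> C) : complex.Im (\sum_j F j) = \sum_j complex.Im (F j).
  by apply: big_morph => // -[x y] [z w].
have sRe := has_sum_big (P := xpredT) (fun s _ => l2dotP (a s) (b s)).
have sIm := has_sum_big (P := xpredT) (fun s _ => l2dotP (a s) ('i *: (b s : @l2 R))).
rewrite lecE ReS ImS; apply/andP; split.
  apply/eqP; apply: has_sum_unique sIm _.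
  have -> : (fun k => \sum_s cdot (a s k) (('i *: (b s : @l2 R)) k)) = fun=> 0.
    apply/funext => k; have [+ _] := reim k; rewrite ImS => e.
    by rewrite -[RHS]e; apply: eq_bigr => s _; rewrite ImM.
  exact: (@has_sum_single (fun=> 0) 0%N).
apply: has_sum_ge0 sRe _ => k; have [_] := reim k; rewrite ReS.
by under eq_bigr do rewrite ReM.
Qed.

(** After reindexing, a matrix of diagonal operators is the direct sum over [k] of scalar matrices
    of order [n]. *)
Lemma diagop_pos n (G : 'I_n -> 'I_n -> nat -> C) (M : R) :
  (forall i j, bounded_by (G i j) M) ->
  opmx_pos (fun i j => diagop (G i j)) <->
  forall k v, 0 <= qform (fun i j => G i j k) v.
Proof.
move=> GM; split=> [Gp k v|Gp h].
  have := Gp (fun i => v i *: l2e k); congr (0 <= _).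
  apply: eq_bigr => i _; apply: eq_bigr => j _.
  by rewrite bopZh ipZl ipZr l2ip_basis (diagopE _ _ (GM i j)) /= eqxx mulr1; ring.
rewrite pair_big /=.
apply: (@l2_form_ge0 _ (fun s => diagop (G s.1 s.2) (h s.2)) (fun s => h s.1)) => k.
have := Gp k (fun i => h i k); rewrite /qform pair_big /=; congr (0 <= _).
by apply: eq_bigr => s _; rewrite (diagopE _ _ (GM _ _)).
Qed.

(** The form of [Y* Y] at [h] is the sum over [k] of the squared norms of the components of
    [Y h]. *)
Lemma square_opmx_pos n (X : 'M[B]_n) : mos_pos (m := cstar_mos B) X ->
  opmx_pos (fun i j => X i j).
Proof.
move=> [Y ->] h.
have E i j : inner H (((map_mx star Y)^T *m Y) i j (h j)) (h i) =
    \sum_k inner H (Y k j (h j)) (Y k i (h i)).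
  rewrite mxE bop_sum linear_sumlz; apply: eq_bigr => k _.
  by rewrite !mxE bopM; exact: badjP'.
under eq_bigr do under eq_bigr do rewrite E.
under eq_bigr do rewrite exchange_big.
rewrite exchange_big; apply: sumr_ge0 => k _ /=.
have -> : \sum_i \sum_j inner H (Y k j (h j)) (Y k i (h i)) =
    inner H (\sum_j Y k j (h j)) (\sum_i Y k i (h i)).
  by rewrite linear_sumr; apply: eq_bigr => i _; rewrite linear_sumlz.
by rewrite innerE ler0c sqr_ge0.
Qed.

(** A diagonal coefficient is a vector state, hence completely positive. *)
Lemma opmx_pos_coef n (X : 'M[B]_n) : opmx_pos (fun i j => X i j) ->
  forall p v, 0 <= qform (fun i j => coef (X i j) p) v.
Proof.
move=> Xp p v; have := Xp (fun i => v i *: l2e p); congr (0 <= _).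
apply: eq_bigr => i _; apply: eq_bigr => j _.
by rewrite bopZh ipZl ipZr -coefE; ring.
Qed.

End BoundedDiagonal.

(** * The incomplete quotient *)

HB.instance Definition _ (R : realType) (H : hilbert R) (h0 : H) (h0n : h0 != 0)
    (T : bop h0n) :=
  GRing.isLinear.Build R[i] H H *:%R (bfun T)
    (fun a x y => etrans (bopDh T (a *: x) y) (congr1 (+%R^~ (T y)) (bopZh T a x))).

Section IncompleteQuotient.
Context {R : realType}.
Local Notation C := R[i].
Local Notation H := (@l2_hilbert R).
Local Notation B := (bop (@l2e_neq0 R 0)).
Implicit Types (S T : B) (m n p : nat).

Definition eps n : R := (n.+2%:R ^+ 2)^-1.

Lemma eps_gt0 n : 0 < eps n.
Proof. by rewrite invr_gt0 exprn_gt0. Qed.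

Lemma eps_le n : eps n <= 1 / 4.
Proof.
rewrite div1r lef_pV2 ?posrE ?exprn_gt0//.
have : (2 : R) <= n.+2%:R by rewrite ler_nat.
move: (n.+2%:R) => x x2; nra.
Qed.

(* The functionals number [2n] and [2n + 1] share the coefficient [2n + 1], and
   each of them has a coefficient of its own with the small weight [eps n]. *)
Definition slice T m : C := (eps m./2)%:C%C * coef T m.*2
  + (1 - eps m./2)%:C%C * coef T (m./2).*2.+1.

Lemma slice_linear (a : C) S T m : slice (a *: S + T) m = a * slice S m + slice T m.
Proof. by rewrite /slice !coef_linear; ring. Qed.

Lemma sliceD S T m : slice (S + T) m = slice S m + slice T m.
Proof. by rewrite -[S in LHS]scale1r slice_linear mul1r. Qed.

Lemma slice0 m : slice 0 m = 0.
Proof. by apply: (addrI (slice 0 m)); rewrite -sliceD !addr0. Qed.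

Lemma sliceN T m : slice (- T) m = - slice T m.
Proof. by rewrite -[- T]addr0 -scaleN1r slice_linear mulN1r slice0 addr0. Qed.

Lemma sliceZ (a : C) T m : slice (a *: T) m = a * slice T m.
Proof. by rewrite -[a *: T]addr0 slice_linear slice0 addr0. Qed.

Lemma slice_star T m : slice (star T) m = (slice T m)^*.
Proof.
rewrite /slice !coef_star [RHS]rmorphD; congr (_ + _).
  by rewrite [RHS]rmorphM [X in _ = X * _]conjC_real_complex.
by rewrite [RHS]rmorphM [X in _ = X * _]conjC_real_complex.
Qed.

Lemma slice1 m : slice 1 m = 1.
Proof. by rewrite /slice !coef1 !mulr1 -rmorphD addrC subrK. Qed.

Lemma slice_bound T : bounded_by (slice T) (bnorm T).
Proof.
move=> m; have e0 := eps_gt0 m./2; have e4 := eps_le m./2.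
apply: le_trans (cnD _ _) _; rewrite !cnM !cn_rC !ger0_norm ?subr_ge0; try lra.
have := @coef_bound R T m.*2; have := @coef_bound R T (m./2).*2.+1.
by move: (cn _) (cn _) (bnorm T) (eps _) e0 e4 => x y z e ? ? ? ?; nra.
Qed.

Definition slice_ker_pred : {pred B} := fun T => `[< forall m, slice T m = 0 >].

Fact slice_ker_submod : submod_closed slice_ker_pred.
Proof.
split=> [|a S T /asboolP S0 /asboolP T0]; apply/asboolP => m; first exact: slice0.
by rewrite slice_linear S0 T0 mulr0 addr0.
Qed.
HB.instance Definition _ := GRing.isSubmodClosed.Build C (cstar_mos B) slice_ker_pred
  (GRing.submod_closed_semi slice_ker_submod).

Definition slice_ker : submodClosed (cstar_mos B) := slice_ker_pred.

Lemma slice_mproj (T : B) m : slice (mrepr (mproj slice_ker T)) m = slice T m.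
Proof.
have /mproj_eq/asboolP/(_ m) :
    mproj slice_ker (mrepr (mproj slice_ker T)) = mproj slice_ker T.
  exact: mproj_surj.
by rewrite sliceD sliceN => /eqP; rewrite subr_eq0 => /eqP.
Qed.

Definition slice_diag (y : quot_mos slice_ker) : {linear H -> H} := diagop (slice (mrepr y)).

Lemma slice_diagE y h k : slice_diag y h k = slice (mrepr y) k * h k.
Proof. exact: diagopE (slice_bound _). Qed.

Lemma slice_mx_bound n (x : 'I_n -> 'I_n -> B) i j :
  bounded_by (slice (x i j)) (\sum_i \sum_j bnorm (x i j)).
Proof.
move=> m; apply: le_trans (slice_bound _ _) _.
by apply: (le_double_sum (F := fun i j => bnorm (x i j))) => *; exact: bnorm_ge0.
Qed.

(** Polarization is borrowed from [opmx_pos_herm] through the matrix of diagonal operators with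
    these slices. *)
Lemma slice_herm n (x : 'M[B]_n) :
  (forall m v, 0 <= qform (fun i j => slice (x i j) m) v) ->
  forall i j m, slice (x i j) m = (slice (x j i) m)^*.
Proof.
move=> xp i j m.
have Xp : opmx_pos (fun i j => (\matrix_(i, j) diagop (slice (x i j)) : 'M[B]_n) i j).
  have /(diagop_pos (slice_mx_bound (fun i j => x i j))) := xp; move=> xp' h.
  by have := xp' h; congr (0 <= _); apply: eq_bigr => k _; apply: eq_bigr => l _; rewrite mxE.
have := congr1 (fun Z : 'M[B]_n => coef (Z i j) m) (opmx_pos_herm Xp).
by rewrite !mxE coef_star !(coef_diagop _ (slice_bound _)).
Qed.

(* For [n] with [eps n * K <= e] the negative part of the shared coefficient is
   absorbed by [e]; for the finitely many other [n] the coefficients with weight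
   [eps n] may be chosen large. *)
Lemma lift_psd n (x : 'M[B]_n) (e : R) : 0 < e ->
  (forall m v, 0 <= qform (fun i j => slice (x i j) m) v) ->
  exists D : 'I_n -> 'I_n -> nat -> C, [/\ exists M, forall i j, bounded_by (D i j) M,
    forall i j m, (eps m./2)%:C%C * D i j m.*2
      + (1 - eps m./2)%:C%C * D i j (m./2).*2.+1 = slice (x i j) m
  & forall p v, 0 <= e%:C%C * (vsq v)%:C%C + qform (fun i j => D i j p) v].
Proof.
move=> e0 xp; have herm := slice_herm xp.
(* As [eps <= 1/4], this gives [(1 - eps) K >= 3 N], which exceeds the bound [2 N] of [GS] on the
   form of [G]. *)
pose N := \sum_i \sum_j bnorm (x i j); pose K := 4 * N + 1.
have N0 : 0 <= N.
  by apply: sumr_ge0 => i _; apply: sumr_ge0 => j _; exact: bnorm_ge0.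
pose small k := eps k * K <= e.
(* The difference between the own coefficient of slice [m] and that of the even slice of its pair,
   hence 0 for even [m]. By [GE] the slices of a pair differ by [eps] times a bounded quantity,
   which is where the boundedness of [x] enters. *)
pose G i j m : C := coef (x i j) m.*2 - coef (x i j) (m./2).*2.*2.
have GE i j m : (eps m./2)%:C%C * G i j m = slice (x i j) m - slice (x i j) (m./2).*2.
  by rewrite /slice doubleK /G; ring.
have en0 k : (eps k)%:C%C != 0 :> C by apply: lt0r_neq0; rewrite ltcR eps_gt0.
have Gherm m i j : G i j m = (G j i m)^*.
  apply: (mulfI (en0 m./2)); rewrite -[X in X * _^*](conjC_real_complex) -rmorphM.
  by rewrite !GE [RHS]rmorphB; congr (_ - _); exact: herm.
have xN i j : bnorm (x i j) <= N.
  by apply: (le_double_sum (F := fun i j => bnorm (x i j))) => *; exact: bnorm_ge0.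
have cN i j p : cn (coef (x i j) p) <= N := le_trans (coef_bound _ _) (xN i j).
have sN i j m : cn (slice (x i j) m) <= N := le_trans (slice_bound _ _) (xN i j).
have GN i j m : cn (G i j m) <= 2 * N.
  apply: le_trans (cnD _ _) _; rewrite cnN.
  by have := cN i j m.*2; have := cN i j (m./2).*2.*2; lra.
have GS m : \sum_i \sum_j cn (G i j m) <= 2 * N.
  rewrite /N mulr_sumr; apply: ler_sum => i _; rewrite mulr_sumr; apply: ler_sum => j _.
  apply: le_trans (cnD _ _) _; rewrite cnN.
  by have := @coef_bound R (x i j) m.*2; have := @coef_bound R (x i j) (m./2).*2.*2; lra.
clearbody G.
pose Da i j m : C := if small m./2
  then G i j m + slice (x i j) (m./2).*2 + ((1 - eps m./2) * K)%:C%C *+ (i == j)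
  else (eps m./2)^-1%:C%C * slice (x i j) m.
pose Db i j k : C := if small k
  then slice (x i j) k.*2 + (- (eps k * K))%:C%C *+ (i == j) else 0.
pose D i j p := if odd p then Db i j p./2 else Da i j p./2.
have Dae i j m : D i j m.*2 = Da i j m by rewrite /D odd_double doubleK.
have Dbo i j m : D i j m.*2.+1 = Db i j m by rewrite /D /= odd_double /= uphalf_double.
exists D; split.
- have NK : 0 <= K / e * N by rewrite mulr_ge0// divr_ge0 ?(ltW e0)// /K; lra.
  have dK (i j : 'I_n) (t : R) : `|t| <= K -> cn (t%:C%C *+ (i == j)) <= K.
    move=> tK; case: (i == j); first by rewrite mulr1n cn_rC.
    by rewrite mulr0n cn0 (le_trans (normr_ge0 t)).
  have eK k : `|(1 - eps k) * K| <= K /\ `|- (eps k * K)| <= K.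
    have := eps_gt0 k; have := eps_le k; have K0 : 0 <= K by rewrite /K; lra.
    rewrite normrN !normrM (ger0_norm K0) => e4 e1.
    rewrite !ger0_norm; [|lra|lra].
    by clear -e4 e1 K0; split; nra.
  exists (K / e * N + 3 * N + K) => i j p; have K1 : 0 <= K by rewrite /K; lra.
  rewrite /D; case: ifP => _; rewrite /Db /Da; case: ifP => sm.
  + apply: le_trans (cnD _ _) _.
    by have := sN i j (p./2).*2; have := dK i j _ (proj2 (eK p./2)); lra.
  + by rewrite cn0; lra.
  + apply: le_trans (cnD _ _) _; apply: le_trans (lerD (cnD _ _) (lexx _)) _.
    have := sN i j (p./2./2).*2; have := dK i j _ (proj1 (eK p./2./2)).
    by have := GN i j p./2; lra.
  have ei : 0 < (eps p./2./2)^-1 by rewrite invr_gt0; exact: eps_gt0.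
  rewrite cnM cn_rC gtr0_norm//.
  move/negbT: sm; rewrite -ltNge => sm.
  (* Failure of [small] bounds the inverse weight, so one constant bounds all these coefficients. *)
  have eK1 : (eps p./2./2)^-1 <= K / e.
    rewrite -[leLHS]div1r ler_pdivrMr ?eps_gt0// mulrAC ler_pdivlMr// mul1r.
    by rewrite mulrC ltW.
  apply: (@le_trans _ _ (K / e * N)); last by lra.
  by apply: ler_pM => //; [exact: ltW | exact: cn_ge0].
- move=> i j m; rewrite Dae Dbo /Da /Db; case: ifP => _; last first.
    rewrite mulr0 addr0 mulrA -rmorphM mulfV ?rmorph1 ?mul1r//.
    by rewrite gt_eqF ?eps_gt0.
  have -> : ((1 - eps m./2) * K)%:C%C = (1 - (eps m./2)%:C%C) * K%:C%C :> C.
    by rewrite rmorphM rmorphB rmorph1.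
  have -> : (- (eps m./2 * K))%:C%C = - ((eps m./2)%:C%C * K%:C%C) :> C.
    by rewrite rmorphN rmorphM.
  have -> : (1 - eps m./2)%:C%C = 1 - (eps m./2)%:C%C :> C by rewrite rmorphB rmorph1.
  have := GE i j m.
  move: (slice (x i j) m) (slice (x i j) (m./2).*2) (G i j m) ((eps m./2)%:C%C) (K%:C%C).
  move=> s s' g a b sE.
  by rewrite !mulrDr sE; case: (i == j); rewrite ?mulr0n ?mulr1n; ring.
move=> p v; have v0 := vsq_ge0 v.
have tv0 (t : R) : 0 <= t -> 0 <= t%:C%C * (vsq v)%:C%C :> C.
  by move=> t0; rewrite -rmorphM ler0c mulr_ge0.
have [/eqP pE|/eqP pE] := boolP (odd p == true).
  have -> : (fun i j => D i j p) = (fun i j => Db i j p./2).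
    by apply/funext => i; apply/funext => j; rewrite /D pE.
  rewrite /Db; have [sm|_] := boolP (small p./2).
    rewrite (qformD _ (fun i j => _ *+ (i == j))) qform_scalar addrCA -mulrDl -rmorphD.
    by apply: addr_ge0; [exact: xp | apply: tv0; rewrite subr_ge0].
  rewrite [qform _ _]big1 ?addr0 => [|i _]; last first.
    by rewrite big1// => j _; rewrite !mul0r.
  exact/tv0/ltW.
have -> : (fun i j => D i j p) = (fun i j => Da i j p./2).
  by apply/funext => i; apply/funext => j; rewrite /D; move: pE; case: odd.
rewrite /Da; have [sm|_] := boolP (small p./2./2); last first.
  rewrite qformZ addr_ge0 ?tv0 ?(ltW e0)// mulr_ge0//.
  by rewrite ler0c invr_ge0 ltW ?eps_gt0.
rewrite (qformD _ (fun i j => _ *+ (i == j))) (qformD (fun i j => G i j _)) qform_scalar.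
set g := qform (fun i j => G i j _) v; set sl := qform _ v.
set c := \sum_i \sum_j cn (G i j p./2).
have cG : c <= 2 * N by exact: GS.
have -> : e%:C%C * (vsq v)%:C%C + (g + sl + ((1 - eps p./2./2) * K)%:C%C * (vsq v)%:C%C)
   = c%:C%C * (vsq v)%:C%C + g + sl + (e + (1 - eps p./2./2) * K - c)%:C%C * (vsq v)%:C%C.
  by rewrite rmorphB rmorphD; ring.
apply: addr_ge0; first by apply: addr_ge0 (xp _ _); exact: qform_herm_bound.
apply: tv0; have := eps_le p./2./2; have := eps_gt0 p./2./2.
move: (eps _) => y y0 y4; rewrite /K; nra.
Qed.

End IncompleteQuotient.

(** * The quotient as diagonal operators, and its incompleteness *)

Section IncompleteQuotientEmbedding.
Context {R : realType}.
Local Notation C := R[i].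
Local Notation H := (@l2_hilbert R).
Local Notation B := (bop (@l2e_neq0 R 0)).
Local Notation J := (@slice_ker R).
Local Notation Phi := (@slice_diag R).

Lemma unit_mxE n (e : R) : \matrix_(i < n, j < n)
  ((e%:C%C *: mos_unit (cstar_mos B)) *+ (i == j)) = (rsc e)%:M :> 'M[B]_n.
Proof. by apply/matrixP => i j; rewrite !mxE. Qed.

Lemma slice_diag_pos n (X : 'M[quot_mos J]_n) :
  mos_pos X <-> opmx_pos (fun i j => Phi (X i j)).
Proof.
have diagE : opmx_pos (fun i j => Phi (X i j)) <->
    forall m v, 0 <= qform (fun i j => slice (mrepr (X i j)) m) v.
  exact: diagop_pos (slice_mx_bound (fun i j => mrepr (X i j))).
rewrite diagE; split=> [[x [xE xp]] m v|Xp].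
  have approx (e : R) : 0 < e ->
      0 <= e%:C%C * (vsq v)%:C%C + qform (fun i j => slice (mrepr (X i j)) m) v.
    move=> e0; have [k [kJ]] := xp e e0; rewrite unit_mxE; set W := _ + _ => Wp.
    have := opmx_pos_coef (square_opmx_pos Wp); move=> cW.
    have sW i j : slice (W i j) m = e%:C%C *+ (i == j) + slice (mrepr (X i j)) m.
      have -> : X i j = mproj J (x i j) by rewrite xE mxE.
      rewrite slice_mproj /W !mxE !sliceD.
      have /asboolP -> : k i j \in @slice_ker_pred R by exact: kJ.
      rewrite addr0; congr (_ + _); case: (i == j); last by rewrite slice0.
      by rewrite sliceZ slice1 mulr1.
    have -> : e%:C%C * (vsq v)%:C%C + qform (fun i j => slice (mrepr (X i j)) m) v
        = qform (fun i j => slice (W i j) m) v.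
      rewrite -qform_scalar -qformD; congr qform.
      by apply/funext => i; apply/funext => j; rewrite sW.
    have -> : qform (fun i j => slice (W i j) m) v =
        (@eps R m./2)%:C%C * qform (fun i j => coef (W i j) m.*2) v
        + (1 - @eps R m./2)%:C%C * qform (fun i j => coef (W i j) (m./2).*2.+1) v.
      by rewrite -!qformZ -qformD.
    have e1 := eps_gt0 (R := R) m./2; have e4 := eps_le (R := R) m./2.
    by apply: addr_ge0; apply: mulr_ge0; rewrite ?cW// ler0c; lra.
  (* The case [e = 1] already makes the form real; only then is [e] sent to 0 in its real part. *)
  have := approx 1 ltr01; rewrite -rmorphM lecE /= => /andP[/eqP im _].
  move: im approx; case: (qform _ v) => a b /=; rewrite add0r => -> approx.
  rewrite lecE /= eqxx /=; apply/ler_addgt0Pl => e e0.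
  have v1 : 0 < vsq v + 1 by have := vsq_ge0 v; lra.
  have := approx (e / (vsq v + 1)) ltac:(by rewrite divr_gt0).
  rewrite -rmorphM lecE /= => /andP[_]; rewrite mulrAC => le.
  apply: le_trans le _; rewrite lerD2r ler_pdivrMr// ler_wpM2l ?(ltW e0)//; lra.
exists (map_mx (@mrepr _ _ J) X); split.
  by apply/matrixP => i j; rewrite !mxE mproj_surj.
move=> e e0.
have [|D [[M DM] Ds Dp]] := @lift_psd R n (map_mx (@mrepr _ _ J) X) e e0.
  by move=> m v; have := Xp m v; congr (0 <= qform _ _); apply/funext => i;
    apply/funext => j; rewrite mxE.
(* The lift has the same slices as the representative, so their difference lies in [J]. *)
exists (\matrix_(i, j) (diagop (D i j) - mrepr (X i j))); split=> [i j|].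
  rewrite mxE; apply/asboolP => m; rewrite sliceD sliceN /slice !(coef_diagop _ (DM i j)).
  by rewrite Ds mxE subrr.
rewrite unit_mxE; apply: opmx_pos_square.
have DM' i j : bounded_by (fun p => e%:C%C *+ (i == j) + D i j p) (e + M).
  move=> p; apply: le_trans (cnD _ _) _; rewrite lerD// ?DM//.
  by case: (i == j); rewrite ?mulr1n ?mulr0n ?cn0 ?cn_rC ?gtr0_norm// ltW.
have := diagop_pos DM'; set G := opmx_pos _ => -[_ Gp].
have {}Gp : G.
  apply: Gp => p v; rewrite (qformD (fun i j => _ *+ (i == j))) qform_scalar; exact: Dp.
move=> h; have := Gp h; congr (0 <= _); apply: eq_bigr => i _; apply: eq_bigr => j _.
congr (inner H _ _); rewrite !mxE [mrepr _ + _]addrC subrK; apply: l2_ext => p.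
rewrite (diagopE _ _ (DM' i j)) bopD -[RHS]/(l2fun _ p + l2fun _ p).
rewrite (diagopE _ _ (DM i j)) mulrDl; congr (_ + _).
case: (i == j); last by rewrite mulr0n mul0r bop0.
by rewrite !mulr1n /rsc bopZ; reflexivity.
Qed.

Lemma slice_mrepr_linear (a : C) (x y : quot_mos J) m :
  slice (mrepr (a *: x + y)) m = a * slice (mrepr x) m + slice (mrepr y) m.
Proof.
rewrite -slice_linear -[in LHS](mproj_surj x) -[in LHS](mproj_surj y) -linearP.
exact: slice_mproj.
Qed.

Lemma bop_continuous (T : B) : continuous (T : {linear H -> H}).
Proof.
apply: bounded_linear_continuous; apply/linear_boundedP.
exists (bnorm T)%:C%C; split; first by apply/complex_realP; exists (bnorm T).
move=> r Tr h; rewrite hn_real; apply: (@le_trans _ _ ((bnorm T)%:C%C * `|h|)).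
  by rewrite hn_real -rmorphM lecR bnorm_ub.
by rewrite ler_wpM2r// ltW.
Qed.

Lemma diagop_star (d : nat -> C) (M : R) : bounded_by d M ->
  bop_star (diagop d) = diagop (fun k => (d k)^*).
Proof.
move=> dM; apply: bop_star_unique => f g.
have -> : diagop d f = diagf dM f by apply: l2_ext => k; exact: diagopE dM.
have -> : diagop (fun k => (d k)^*) g = diagf (bounded_by_conj dM) g.
  by apply: l2_ext => k; exact: diagopE (bounded_by_conj dM).
exact: diagf_adj.
Qed.

Lemma slice_diag_embedding : BH_embedding Phi.
Proof.
split.
- by move=> x; exact: bop_continuous.
- move=> a x y h; apply: l2_ext => k.
  rewrite slice_diagE slice_mrepr_linear -[RHS]/(a * Phi x h k + Phi y h k) !slice_diagE.
  by rewrite mulrDl mulrA.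
- move=> x x0; have xJ : mrepr x \in J.
    apply/asboolP => m; have := congr1 (fun f : H => f m) (x0 (l2e m)).
    by rewrite slice_diagE /= eqxx mulr1.
  have /(mproj_eq J _ 0) : mrepr x - 0 \in J by rewrite subr0.
  by rewrite mproj_surj raddf0.
- split=> [x h k|h]; last first.
    by apply: l2_ext => m; rewrite slice_diagE slice_mproj slice1 mul1r.
  have -> : Phi (mos_star x) h = bop_star (diagop (slice (mrepr x))) h.
    rewrite (diagop_star (slice_bound _)); apply: l2_ext => m.
    rewrite slice_diagE slice_mproj slice_star.
    by rewrite (diagopE _ _ (bounded_by_conj (slice_bound _))).
  exact: badjP'.
exact: slice_diag_pos.
Qed.

(** The map is the quotient map itself, whose target is an operator system by
    [slice_diag_embedding]. *)
Lemma slice_ker_is_kernel : is_kernel J.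
Proof.
exists (quot_mos J), (mproj J); split.
- by exists H, Phi; exact: slice_diag_embedding.
- exists (mproj J 1); apply/eqP => e1.
  have /mproj_eq : mproj J 1 = mproj J 0 by rewrite e1 raddf0.
  rewrite subr0 => /asboolP/(_ 0%N); rewrite slice1 => /eqP.
  by rewrite oner_eq0.
- split=> // n X Xp; exists X; split=> // e e0.
  exists 0; split=> [i j|]; first by rewrite mxE rpred0.
  rewrite addr0 unit_mxE; apply: mos_posD => //.
  by apply: mos_pos_rsc; exact: ltW.
move=> x; have := mproj_eq J x 0; rewrite subr0 raddf0 => ->.
by [].
Qed.

Lemma slice_le_norm (y : quot_mos J) m : cn (slice (mrepr y) m) <= opnorm (Phi y).
Proof.
have le := coef_bound (diagop (slice (mrepr y))) m.
by rewrite (coef_diagop _ (slice_bound _)) in le.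
Qed.

(** The classes [u N] converge slicewise to [1 / (n + 2)] at [2n] and 0 at [2n + 1], with uniformly
    small tails. A limit class would have a representative whose coefficients [4n] and [4n + 2]
    differ by [n + 2], against boundedness. *)
Lemma slice_diag_norm_incomplete : ~ norm_complete (fun y : quot_mos J => opnorm (Phi y)).
Proof.
move=> complete.
(* The coefficient is [n + 2] at [p = 4n] for [n < N], so that slice [2n] becomes
   [eps n * (n + 2) = 1 / (n + 2)]. The norms of these operators grow, those of their classes do
   not. *)
pose x N p : C := if (odd p || odd p./2) || (N <= p./2./2)%N then 0
  else ((p./2./2).+2%:R : R)%:C%C.
have xb N : bounded_by (x N) N.+2%:R.
  move=> p; rewrite /x; case: ifP; first by rewrite cn0.
  move=> /negbT; rewrite !negb_or => /andP[_]; rewrite -ltnNge => pN.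
  by rewrite cn_rC ger0_norm// ler_nat !ltnS ltnW.
pose u N : quot_mos J := mproj J (diagop (x N) : B).
pose g N m : C := if odd m || (N <= m./2)%N then 0 else ((m./2).+2%:R^-1 : R)%:C%C.
have ug N m : slice (mrepr (u N)) m = g N m.
  have x1 : x N (m./2).*2.+1 = 0 by rewrite /x /= odd_double.
  rewrite slice_mproj /slice !(coef_diagop _ (xb N)) x1 mulr0 addr0.
  rewrite /x /g odd_double doubleK orFb; case: ifP => _; first by rewrite mulr0.
  rewrite -rmorphM; congr (_%:C)%C.
  by rewrite /eps expr2 invfM -mulrA mulVf ?mulr1 ?pnatr_eq0.
have gN N m n : (N <= n)%N -> cn (g n m - g N m) <= N.+2%:R^-1.
  move=> Nn; rewrite /g; case: (odd m) => /=; first by rewrite subr0 cn0 invr_ge0.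
  case: (leqP N m./2) => Nm; last first.
    by rewrite leqNgt (leq_trans Nm Nn) /= subrr cn0 invr_ge0.
  case: ifP => _; first by rewrite subr0 cn0 invr_ge0.
  rewrite subr0 cn_rC ger0_norm ?invr_ge0//.
  by rewrite lef_pV2 ?posrE// ler_nat.
have inv_small (e : R) : 0 < e -> exists N, N.+2%:R^-1 < e.
  move=> e0; exists (Num.Def.archi_bound e^-1).
  rewrite -[e]invrK ltf_pV2 ?posrE ?invr_gt0//.
  have ei : 0 <= e^-1 by rewrite invr_ge0 ltW.
  by apply: lt_trans (archi_boundP ei) _; rewrite ltr_nat invrK.
have sliceB (y z : quot_mos J) m :
    slice (mrepr (y - z)) m = slice (mrepr y) m - slice (mrepr z) m.
  rewrite addrC -scaleN1r slice_mrepr_linear mulN1r addrC//.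
have [e e0|l ul] := complete u.
  have [N Ne] := inv_small (e / 2) ltac:(by rewrite divr_gt0).
  exists N => m n Nm Nn; apply: (@le_lt_trans _ _ (N.+2%:R^-1 + N.+2%:R^-1)); last first.
    by rewrite [e]splitr ltrD.
  apply: diagop_norm => [|k]; first by rewrite addr_ge0// invr_ge0.
  rewrite sliceB !ug; have -> : g m k - g n k = (g m k - g N k) - (g n k - g N k) by ring.
  by apply: le_trans (cnD _ _) _; rewrite cnN lerD ?gN.
have osy_ge0 (y : quot_mos J) : 0 <= opnorm (Phi y).
  exact: (embedding_norm_ge0 slice_diag_embedding).
have lim m : slice (mrepr l) m = if odd m then 0 else ((m./2).+2%:R^-1 : R)%:C%C.
  apply/eqP; rewrite -subr_eq0; apply/eqP; apply: normr0_eq0.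
  rewrite cn_real; congr (_%:C)%C; apply/eqP; rewrite eq_le cn_ge0 andbT.
  apply/ler_addgt0Pl => e e0; rewrite addr0.
  move/(norm_cvgP osy_ge0) : ul => /(_ e e0)[N uN].
  have := uN (maxn N (m./2).+1) (leq_maxl _ _); set M := maxn _ _.
  have gM : g M m = if odd m then 0 else ((m./2).+2%:R^-1 : R)%:C%C.
    by rewrite /g leqNgt (_ : (m./2 < M)%N) ?orbF// /M leq_maxr.
  move=> /(le_lt_trans (slice_le_norm _ m))/ltW.
  by rewrite sliceB ug gM -cnN opprB.
pose b := bnorm (mrepr l : B).
have big n : n.+2%:R <= 2 * b.
  have := lim n.*2; have := lim n.*2.+1.
  rewrite /slice /= odd_double /= uphalf_double doubleK /= => l1 l0.
  have e0 : eps n != 0 :> R by rewrite gt_eqF ?eps_gt0.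
  have : (eps n)%:C%C * (coef (mrepr l : B) n.*2.*2 - coef (mrepr l : B) n.*2.+1.*2)
      = (n.+2%:R^-1 : R)%:C%C.
    by rewrite -[RHS]subr0 -l0 -l1; ring.
  move=> /(congr1 (fun z : C => cn z)); rewrite cnM !cn_rC ger0_norm; last exact/ltW/eps_gt0.
  rewrite ger0_norm ?invr_ge0// => E.
  have cb : cn (coef (mrepr l : B) n.*2.*2 - coef (mrepr l : B) n.*2.+1.*2) <= 2 * b.
    apply: le_trans (cnD _ _) _; rewrite cnN.
    by have := @coef_bound R (mrepr l) n.*2.*2; have := @coef_bound R (mrepr l) n.*2.+1.*2;
      rewrite /b; lra.
  apply: le_trans cb; apply: (@le_trans _ _ ((eps n)^-1 * n.+2%:R^-1)); last first.
    by rewrite -E mulKf.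
  by rewrite /eps invrK expr2 mulfK ?pnatr_eq0.
have b0 : 0 <= 2 * b by rewrite mulr_ge0// bnorm_ge0.
have := archi_boundP b0; have := big (Num.Def.archi_bound (2 * b)).
have : (Num.Def.archi_bound (2 * b))%:R <= (Num.Def.archi_bound (2 * b)).+2%:R :> R.
  by rewrite ler_nat; exact/leqW/leqW.
lra.
Qed.


End IncompleteQuotientEmbedding.

Theorem proposition4p5 (R : realType) :
  (exists (A : cstarType R) (J : submodClosed (cstar_mos A))
          (osy : quot_mos J -> R),
     [/\ is_kernel J, is_operator_norm osy & ~ norm_complete osy]) /\
  (forall (A : cstarType R) (J : submodClosed (cstar_mos A))
          (osy : quot_mos J -> R),
     is_kernel J -> is_operator_norm osy -> ~ norm_complete osy ->
     forall (U : cstarType R) (iota : {linear cstar_mos A -> cstar_mos U}),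
       universal_cstar iota ->
       let I := ideal_gen ([set iota x | x in [set x | x \in J]] : set U) in
       let q := fun a : A => mproj I (iota a) in
       ~ norm_closed (quot_norm (J := I)) (range q)).
Proof.
split; last by move=> A J osy _; exact: universal_quotient_not_closed.
exists (bop (@l2e_neq0 R 0)), slice_ker, (fun y => opnorm (slice_diag y)).
split; [exact: slice_ker_is_kernel | exact: embedding_operator_norm slice_diag_embedding |].
exact: slice_diag_norm_incomplete.
Qed.
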